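(* Let $\mathcal{M}=(0,\infty)\times\mathbb{R}^3$, $\lambda>0$, let $S$ be the operator acting in spatial Fourier space by $(\widetilde{S}\widetilde{\varphi})(t,k)=\cosh(3\lambda k_1)^{-1/2}\,\widetilde{\varphi}(t,k)$, and let $C^\infty_{\mathrm{img}}(\mathcal{M},\mathbb{R})=S[C_0^\infty(\mathcal{M},\mathbb{R})]$. Then $C^\infty_{\mathrm{img}}(\mathcal{M},\mathbb{R})$ is not invariant under the geometric action of $SO(3)\ltimes\mathbb{R}^3$. The preserved subgroup, i.e. the subgroup of $SO(3)\ltimes\mathbb{R}^3$ whose geometric action preserves $C^\infty_{\mathrm{img}}(\mathcal{M},\mathbb{R})$, is $SO(2)\ltimes\mathbb{R}^3$, where the $SO(2)$-rotation preserves the $x^1$-axis.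
   Context: The spatial Fourier transform is $\widetilde{\varphi}(t,k)=\int_{\mathbb{R}^3}d^3x\,e^{ikx}\varphi(t,x)$. The geometric action of $(R,a)\in SO(3)\ltimes\mathbb{R}^3$ on functions on $\mathcal{M}$ is $(\alpha_{(R,a)}\varphi)(t,x)=\varphi(t,R^{-1}(x-a))$, i.e. in Fourier space $(\widetilde{\alpha}_{(R,a)}\widetilde{\varphi})(t,k)=e^{ika}\,\widetilde{\varphi}(t,R^{-1}k)$. $C_0^\infty(\mathcal{M},\mathbb{R})$ denotes the real valued compactly supported smooth functions on $\mathcal{M}$.
   Formalization: The preserved subgroup is really all rotations mapping the x^1-axis to itself, including those reversing it (e.g. diag(-1,-1,1), as cosh is even), times R^3; SO(2)⋉R^3 is proved to be its identity component, not the whole preserved subgroup. *)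

(* Defs.v *)
From mathcomp Require Import all_boot all_order all_algebra.
From mathcomp Require Import complex.
From mathcomp Require Import all_classical all_reals all_analysis.
Import Order.TTheory GRing.Theory Num.Theory.
Import numFieldNormedType.Exports.

Set Implicit Arguments.
Unset Strict Implicit.
Unset Printing Implicit Defensive.

Local Open Scope classical_set_scope.
Local Open Scope ring_scope.
Local Open Scope complex_scope.

(* Points of R x R^3 are pairs (t, x). A function on M = ]0, +oo[ x R^3 is
   represented by a function on R x R^3 : compactly supported functions on M by
   their extension by zero, and the spatial operators below act at fixed t, so
   that everything obtained from them also vanishes for t <= 0. *)
Notation spacetime R := (R * 'cV[R]_3)%type.

Section Smooth.
Variable R : realType.

Definition Mdom : set (spacetime R) := [set p | 0 < p.1].

(* iterated directional derivatives, along the vectors of vs *)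
Fixpoint iter_derive (vs : seq (spacetime R)) (f : spacetime R -> R) :
    spacetime R -> R :=
  if vs is v :: vs' then fun p => 'D_v (iter_derive vs' f) p else f.

Definition smooth (f : spacetime R -> R) : Prop :=
  forall vs : seq (spacetime R),
    continuous (iter_derive vs f) /\
    forall v p, derivable (iter_derive vs f) p v.

Definition supp (f : spacetime R -> R) : set (spacetime R) :=
  closure [set p | f p != 0].

Definition C0oo : set (spacetime R -> R) :=
  [set f | [/\ smooth f, compact (supp f) & supp f `<=` Mdom]].

End Smooth.

Section Fourier.
Variable R : realType.

Definition lebesgue2 :
    {measure set (measurableTypeR R * measurableTypeR R)%type -> \bar R} :=
  ((@lebesgue_measure R) \x (@lebesgue_measure R))%E.

Definition lebesgue3 :
    {measure set ((measurableTypeR R * measurableTypeR R) *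
                  measurableTypeR R)%type -> \bar R} :=
  (lebesgue2 \x (@lebesgue_measure R))%E.

Definition vec3 (y : (R * R) * R) : 'cV[R]_3 :=
  \col_(i < 3) [:: y.1.1; y.1.2; y.2]`_i.

(* the library integrates real functions only: integrate componentwise *)
Definition integral3 (f : 'cV[R]_3 -> R[i]) : R[i] :=
  (\int[lebesgue3]_y complex.Re (f (vec3 y))) +i*
  (\int[lebesgue3]_y complex.Im (f (vec3 y))).

Definition dot (k x : 'cV[R]_3) : R := \sum_(i < 3) k i 0 * x i 0.

Definition expi (theta : R) : R[i] := cos theta +i* sin theta.

Definition cosh (x : R) : R := (expR x + expR (- x)) / 2.

Definition fourier (phi : spacetime R -> R[i]) : spacetime R -> R[i] :=
  fun p => integral3 (fun x => expi (dot p.2 x) * phi (p.1, x)).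

Definition inv_fourier (g : spacetime R -> R[i]) : spacetime R -> R[i] :=
  fun p => ((2 * pi) ^- 3)%:C *
           integral3 (fun k => expi (- dot k p.2) * g (p.1, k)).

(* k_1 is k ord0 0 since indices start at 0 *)
Definition S_op (lambda : R) (phi : spacetime R -> R[i]) : spacetime R -> R[i] :=
  inv_fourier (fun p =>
    (cosh (3 * lambda * p.2 ord0 0) `^ (- 2^-1))%:C * fourier phi p).

(* S psi is real valued for real psi, the multiplier being even in k *)
Definition Cimg (lambda : R) : set (spacetime R -> R) :=
  [set phi | exists2 psi, C0oo psi &
     forall p, (phi p)%:C = S_op lambda (fun q => (psi q)%:C) p].

End Fourier.

Section Group.
Variable R : realType.

Definition SO n : set 'M[R]_n := [set A | A *m A^T = 1%:M /\ \det A = 1].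
Arguments SO n : clear implicits.

(* affine maps x |-> A x + a as pairs (A, a) *)
Notation motion := ('M[R]_3 * 'cV[R]_3)%type.

Definition motion1 : motion := (1%:M, 0).
Definition motion_mul (g h : motion) : motion :=
  (g.1 *m h.1, g.1 *m h.2 + g.2).
Definition motion_inv (g : motion) : motion :=
  (invmx g.1, - (invmx g.1 *m g.2)).

(* K |x R^3, with the group law above *)
Definition semidirect (K : set 'M[R]_3) : set motion := [set g | K g.1].

Definition is_subgroup (H G : set motion) : Prop :=
  [/\ H `<=` G, H motion1,
      forall g h, H g -> H h -> H (motion_mul g h)
    & forall g, H g -> H (motion_inv g)].

Definition geom_action (g : motion) (phi : spacetime R -> R) :
    spacetime R -> R :=
  fun p => phi (p.1, invmx g.1 *m (p.2 - g.2)).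

(* inclusion only; equality follows as soon as g^-1 preserves C as well *)
Definition preserves (C : set (spacetime R -> R)) (g : motion) : Prop :=
  forall phi, C phi -> C (geom_action g phi).

Definition invariant_under (G : set motion) (C : set (spacetime R -> R)) : Prop :=
  forall g, G g -> preserves C g.

Definition preserved_subgroup (C : set (spacetime R -> R)) : set motion :=
  [set g | semidirect (SO 3) g /\ preserves C g].

Definition x1_axis : set 'cV[R]_3 :=
  [set x | exists s : R, x = s *: delta_mx ord0 0].

(* rotations mapping the x^1-axis onto itself, possibly reversing it: the
   rotations by pi about an axis orthogonal to e_1 are included *)
Definition x1_axis_rotations : set 'M[R]_3 :=
  [set A | SO 3 A /\ [set A *m x | x in x1_axis] = x1_axis].

(* SO(2) acting on the coordinates x^2, x^3 *)
Definition SO2_x1 : set 'M[R]_3 :=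
  [set block_mx (1%:M : 'M[R]_1) 0 0 Q | Q in SO 2].

End Group.
Arguments SO R n : clear implicits.
Arguments x1_axis_rotations R : clear implicits.
Arguments SO2_x1 R : clear implicits.
Arguments motion1 {R}.

(* Main.v *)
(** The multiplier of [S] depends on [k_1] only through its absolute value, so
    every rotation mapping the [x^1]-axis to itself, and every translation,
    commutes with [S] and preserves the image.  Conversely, let the rotation [A]
    preserve the image, and suppose that some [u] with [u_1 = 1] has
    [(A^T u)_1 = 0].  Since [S] is injective in Fourier space, a bump [f >= 0] and
    its partner [f'] satisfy, with [v = A^T u] and for all real [s],

      [(cosT f (s v))^2 * cosh (3 lambda s) = (cosT f' (s u))^2].

    Compact supports make both transforms entire and even in [s], so the identity
    may be continued to imaginary [s = i y].  At [3 lambda y = pi] the [cosh] is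
    [-1] while the transforms are real, that of [f] being positive: a
    contradiction.  No such [u] exists exactly when [A] maps [e_1] to [+- e_1], and
    the sign, being continuous, is [1] on the identity component. *)

From HB Require Import structures.
Require Import Defs.
From mathcomp Require Import all_boot all_order all_algebra.
From mathcomp Require Import complex ring lra.
From mathcomp Require Import all_classical all_reals all_analysis.
From mathcomp Require Import measurable_realfun lebesgue_integral_fubini.
Import Order.TTheory GRing.Theory Num.Theory.
Import numFieldNormedType.Exports.

Local Open Scope classical_set_scope.
Local Open Scope ring_scope.
Set Implicit Arguments.
Unset Strict Implicit.
Unset Printing Implicit Defensive.

(** Injectivity in Fourier space is proved for continuous integrable functions without an inversion
    formula: a function orthogonal to all waves [cos] and [sin] is orthogonal to trigonometric
    polynomials, hence to Gaussians, and a tall Gaussian peak detects its sign at a point. Only the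
    cosine transforms are compared: in the equation between two images the cosine part is even and
    the sine part odd under [x -> - x], so they separate. Squaring makes the continuation possible,
    since it replaces the root of [cosh] by an entire function. The continuation is carried out with
    polynomials in [X = - s^2]: the Taylor truncations of the two sides agree below order [n] and
    have coefficients dominated, uniformly in [n], by those of an exponential, so at a fixed [X > 0]
    they differ by at most a constant over [2^n]. Rotations are substituted in integrals by way of
    shears, which generate the special linear group. The vector [u] is explicit: if [A j 0] is
    nonzero for some [j] other than 0, then [u = e_1 - (A 0 0 / A j 0) e_j] will do. *)

Section MeasurePreserving.
Context d (T : measurableType d) (R : realType).
Variable mu : {measure set T -> \bar R}.

(** * Measure-preserving maps and substitution in integrals *)

Definition mpres (f : T -> T) :=
  measurable_fun setT f /\ forall A, measurable A -> mu (f @^-1` A) = mu A.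

Lemma mpres_comp f g : mpres f -> mpres g -> mpres (f \o g).
Proof.
move=> [mf pf] [mg pg]; split; first exact: measurableT_comp.
move=> A mA; rewrite comp_preimage pg ?pf //.
by rewrite -[X in measurable X]setTI; exact: mf.
Qed.

Import HBNNSimple.

Let comp_nnsfun (f : T -> T) (mf : measurable_fun setT f) (h : {nnsfun T >-> R}) :
  exists h' : {nnsfun T >-> R}, forall x, h' x = h (f x).
Proof.
have mh : measurable_fun setT (h \o f) by exact: measurableT_comp.
pose m1 := isMeasurableFun.Build _ _ _ _ _ mh.
have fh : finite_set (range (h \o f)).
  apply: (sub_finite_set _ (@fimfunP _ _ h)) => _ [x _ <-]; by exists (f x).
pose m2 := FiniteImage.Build _ _ _ fh.
have nh x : 0 <= (h \o f) x by exact: fun_ge0.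
pose m3 := isNonNegFun.Build _ _ _ nh.
pose h' : {nnsfun T >-> R} := HB.pack (h \o f) m1 m2 m3.
by exists h'.
Qed.

(** A simple function below [g], composed with [f], is a simple function below [g \o f] whose level
    sets have the same measures. The reverse inequality will come from the same statement for the
    inverse map. *)
Let le_nnintegral (f : T -> T) (pf : mpres f) (g : T -> \bar R) :
  (ereal_sup [set sintegral mu h | h in
     [set h : {nnsfun T >-> R} | forall x, ((h x)%:E <= g x)%E]] <=
  ereal_sup [set sintegral mu h | h in
     [set h : {nnsfun T >-> R} | forall x, ((h x)%:E <= g (f x))%E]])%E.
Proof.
apply: ge_ereal_sup => _ [h hg <-]; have [h' h'E] := comp_nnsfun pf.1 h.
apply: ereal_sup_ubound; exists h'; first by move=> x; rewrite h'E; exact: hg.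
rewrite !sintegralET; apply: eq_fsbigr => r _; congr (_ * _)%E.
have -> : h' @^-1` [set r] = f @^-1` (h @^-1` [set r]).
  by apply/seteqP; split => x /=; rewrite /preimage /= h'E.
by rewrite pf.2.
Qed.

(* Neither measurability nor integrability of [g] is needed: the library's
   integral is a supremum over simple functions, which are transported by [f]
   and [f']. *)
Lemma integral_mpres (f f' : T -> T) (g : T -> \bar R) :
  mpres f -> mpres f' -> cancel f' f ->
  (\int[mu]_x g (f x) = \int[mu]_x g x)%E.
Proof.
move=> pf pf' ff'.
have aux (k : T -> \bar R) : ereal_sup [set sintegral mu h | h in
     [set h : {nnsfun T >-> R} | forall x, ((h x)%:E <= k (f x))%E]] =
   ereal_sup [set sintegral mu h | h in
     [set h : {nnsfun T >-> R} | forall x, ((h x)%:E <= k x)%E]].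
  apply/eqP; rewrite eq_le; apply/andP; split; last exact: le_nnintegral.
  apply: le_trans (le_nnintegral pf' _) _.
  by rewrite (_ : [set h : {nnsfun T >-> R} | _ ] =
    [set h : {nnsfun T >-> R} | forall x, ((h x)%:E <= k x)%E]) //;
    apply/seteqP; split => h /= H x; have := H x; rewrite ff'.
rewrite /integral !patch_setT.
rewrite /integral.
by rewrite -(aux (g^\+)%E) -(aux (g^\-)%E) !unlock.
Qed.

End MeasurePreserving.

(** * Maps of a product that act fibrewise *)

Section ProductMeasurePreserving.
Context d1 d2 (T1 : measurableType d1) (T2 : measurableType d2) (R : realType).
Variable m1 : {sigma_finite_measure set T1 -> \bar R}.
Variable m2 : {sigma_finite_measure set T2 -> \bar R}.

(** The product measure integrates over [x] the measures of the [xsection]s, and each section is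
    moved by the measure-preserving [t x]. When [t x] is a translation, the map is a shear. *)
Lemma mpres_fiber2 (t : T1 -> T2 -> T2) :
  measurable_fun setT (fun p : T1 * T2 => t p.1 p.2) ->
  (forall x, mpres m2 (t x)) -> mpres (m1 \x m2)%E (fun p => (p.1, t p.1 p.2)).
Proof.
move=> mt pt.
have mf : measurable_fun setT (fun p : T1 * T2 => (p.1, t p.1 p.2)).
  exact: measurable_fun_pair.
split => // A mA; rewrite /product_measure1; apply: eq_integral => x _ /=.
rewrite -((pt x).2 (xsection A x) (measurable_xsection x mA)).
congr (m2 _); apply/seteqP; split => y /=; rewrite /xsection /= !inE //.
Qed.

(** Here the moved sections are the [ysection]s, while the product measure is defined by the other
    ones. By uniqueness it equals the product taken in the other order of integration. *)
Lemma mpres_fiber1 (t : T2 -> T1 -> T1) :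
  measurable_fun setT (fun p : T1 * T2 => t p.2 p.1) ->
  (forall x, mpres m1 (t x)) -> mpres (m1 \x m2)%E (fun p => (t p.2 p.1, p.2)).
Proof.
move=> mt pt.
have mf : measurable_fun setT (fun p : T1 * T2 => (t p.2 p.1, p.2)).
  exact: measurable_fun_pair.
split => // A mA.
have swap B : measurable B -> (m1 \x m2)%E B = (m1 \x^ m2)%E B.
  by apply: product_measure_unique => // ? ? ? ? /=; rewrite product_measure2E.
have mfA : measurable ((fun p : T1 * T2 => (t p.2 p.1, p.2)) @^-1` A).
  by rewrite -[X in measurable X]setTI; exact: mf.
apply: (eq_trans (swap _ mfA)); apply: (eq_trans _ (esym (swap _ mA))).
rewrite /product_measure2; apply: eq_integral => x _ /=.
rewrite -((pt x).2 (ysection A x) (measurable_ysection x mA)).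
congr (m1 _); apply/seteqP; split => y /=; rewrite /ysection /= !inE //.
Qed.

End ProductMeasurePreserving.

(** * Shears and the reflection preserve Lebesgue measure on three-space *)

Section LebesgueR3.
Context {R : realType}.
Local Notation mu := (@lebesgue_measure R).
Local Notation RR := (measurableTypeR R).

Lemma mpres_translation (a : R) : mpres mu ((fun x => x + a) : RR -> RR).
Proof.
have mf : measurable_fun setT ((fun x => x + a) : RR -> RR).
  exact: measurable_realfun.measurable_funD.
split => // A mA.
rewrite -[LHS]/(pushforward mu ((fun x => x + a) : RR -> RR) A).
apply/esym/lebesgue_measure_unique => //= _ [[u v]] _ <-.
rewrite /pushforward.
have -> : (fun x : R => x + a) @^-1` [set` `]u, v]] = [set` `]u - a, v - a]].
  by apply/seteqP; split => x /=; rewrite !in_itv /= ltrBlDr lerBrDr.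
rewrite /= !lebesgue_measure_itv /= !lte_fin ltrD2r.
by case: ifP => // _; rewrite -!EFinD; congr (_%:E); ring.
Qed.

Lemma mpres_opp : mpres mu (-%R : RR -> RR).
Proof. by split => [|A mA]; [exact: oppr_measurable|exact: lebesgue_measureN]. Qed.

Let lebesgue2_sigma_finite : sigma_finite setT (@lebesgue2 R).
Proof.
pose B n : set R := [set` `[- n%:R, n%:R]].
exists (fun n => B n `*` B n).
  apply/seteqP; split => // -[x y] _.
  exists (Num.truncn (`|x| + `|y|)).+1 => //=.
  have : `|x| + `|y| < (Num.truncn (`|x| + `|y|)).+1%:R by exact: truncnS_gt.
  set n := (_.+1)%:R => h.
  have /andP[hx hy] : (`|x| <= n) && (`|y| <= n).
    have := normr_ge0 x; have := normr_ge0 y; move: h; lra.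
  by split; rewrite /B /= in_itv /= -ler_norml.
move=> n; split; first by apply: measurableX; exact: measurable_itv.
rewrite [X in (X < _)%E](_ : _ = (mu (B n) * mu (B n))%E); last first.
  by apply: product_measure1E; exact: measurable_itv.
by rewrite lebesgue_measure_itv /=; case: ifP => _; rewrite -?EFinM ?mule0 ltry.
Qed.

(** [lebesgue2] is declared as a plain measure. The fibre lemmas and Tonelli ask for sigma-finite
    factors, so a convertible copy carries that structure and stands for the first factor of
    [lebesgue3]. *)
Definition lebesgue2_fun : set (RR * RR)%type -> \bar R := lebesgue2 R.
HB.instance Definition _ := Measure.copy lebesgue2_fun (lebesgue2 R).
HB.instance Definition _ :=
  Measure_isSigmaFinite.Build _ _ _ lebesgue2_fun lebesgue2_sigma_finite.

Definition lebesgue2_sf : {sigma_finite_measure set (RR * RR)%type -> \bar R} :=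
  lebesgue2_fun.

Notation R3 := ((measurableTypeR R * measurableTypeR R) * measurableTypeR R)%type.

Let mpres_shear2 (c : R) :
  mpres lebesgue2_sf ((fun p => (p.1, p.2 + c * p.1)) : RR * RR -> RR * RR).
Proof.
apply: (@mpres_fiber2 _ _ _ _ _ mu mu (fun x y => (y : RR) + c * x)).
  apply: measurable_funD => //; exact: measurable_funM.
by move=> x; exact: mpres_translation.
Qed.

Let mpres_shear1 (c a : R) :
  mpres lebesgue2_sf ((fun p => (p.1 + (c * p.2 + a), p.2)) : RR * RR -> RR * RR).
Proof.
apply: (@mpres_fiber1 _ _ _ _ _ mu mu (fun y x => (x : RR) + (c * y + a))).
  apply: measurable_funD => //; apply: measurable_funD => //; exact: measurable_funM.
by move=> x; exact: mpres_translation.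
Qed.

(** Along each vertical fibre the map is a translation by an amount fixed by the other coordinates,
    so one-dimensional translation invariance suffices. The constant [c] lets the same lemma produce
    translations of the space. *)
Lemma mpres_shear_z (a b c : R) : mpres (lebesgue3 R)
  ((fun p => (p.1, p.2 + (a * p.1.1 + b * p.1.2 + c))) : R3 -> R3).
Proof.
apply: (@mpres_fiber2 _ _ _ _ _ lebesgue2_sf mu
  (fun q z => (z : RR) + (a * q.1 + b * q.2 + c))).
  apply: measurable_funD => //; apply: measurable_funD => //.
  apply: measurable_funD => //; apply: measurable_funM => //.
    exact: (measurableT_comp measurable_fst measurable_fst).
  exact: (measurableT_comp measurable_snd measurable_fst).
by move=> x; exact: mpres_translation.
Qed.

Lemma mpres_shear_y (a b c : R) : mpres (lebesgue3 R)
  ((fun p => ((p.1.1, p.1.2 + (a * p.1.1 + b * p.2 + c)), p.2)) : R3 -> R3).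
Proof.
apply: (@mpres_fiber1 _ _ _ _ _ lebesgue2_sf mu
  (fun z q => (q.1, (q.2 : RR) + (a * q.1 + b * z + c)))).
  apply: measurable_fun_pair.
    exact: (measurableT_comp measurable_fst measurable_fst).
  apply: measurable_funD.
    exact: (measurableT_comp measurable_snd measurable_fst).
  apply: measurable_funD => //.
  apply: measurable_funD => //; apply: measurable_funM => //.
  exact: (measurableT_comp measurable_fst measurable_fst).
move=> z; apply: (@mpres_fiber2 _ _ _ _ _ mu mu
  (fun x y => (y : RR) + (a * x + b * z + c))).
  apply: measurable_funD => //; apply: measurable_funD => //.
  by apply: measurable_funD => //; exact: measurable_funM.
by move=> x; exact: mpres_translation.
Qed.

Lemma mpres_shear_x (a b c : R) : mpres (lebesgue3 R)
  ((fun p => ((p.1.1 + (a * p.1.2 + b * p.2 + c), p.1.2), p.2)) : R3 -> R3).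
Proof.
apply: (@mpres_fiber1 _ _ _ _ _ lebesgue2_sf mu
  (fun z q => ((q.1 : RR) + (a * q.2 + b * z + c), q.2))).
  apply: measurable_fun_pair; last first.
    exact: (measurableT_comp measurable_snd measurable_fst).
  apply: measurable_funD.
    exact: (measurableT_comp measurable_fst measurable_fst).
  apply: measurable_funD => //.
  apply: measurable_funD => //; apply: measurable_funM => //.
  exact: (measurableT_comp measurable_snd measurable_fst).
move=> z; apply: (@mpres_fiber1 _ _ _ _ _ mu mu
  (fun y x => (x : RR) + (a * y + b * z + c))).
  apply: measurable_funD => //; apply: measurable_funD => //.
  by apply: measurable_funD => //; exact: measurable_funM.
by move=> x; exact: mpres_translation.
Qed.

Lemma mpres_opp3 : mpres (lebesgue3 R)
  ((fun p => ((- p.1.1, - p.1.2), - p.2)) : R3 -> R3).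
Proof.
have m2 : mpres lebesgue2_sf ((fun q => (- q.1, - q.2)) : RR * RR -> RR * RR).
  rewrite (_ : (fun _ => _) = ((fun q : RR * RR => (- q.1, q.2)) : RR * RR -> RR * RR)
    \o ((fun q => (q.1, - q.2)) : RR * RR -> RR * RR)) //.
  apply: mpres_comp.
    apply: (@mpres_fiber1 _ _ _ _ _ mu mu (fun _ x => - (x : RR))).
      exact: measurable_funN.
    by move=> _; exact: mpres_opp.
  apply: (@mpres_fiber2 _ _ _ _ _ mu mu (fun _ x => - (x : RR))).
    exact: measurable_funN.
  by move=> _; exact: mpres_opp.
rewrite (_ : (fun _ => _) = ((fun p : R3 => ((- p.1.1, - p.1.2), p.2)) : R3 -> R3)
  \o ((fun p => (p.1, - p.2)) : R3 -> R3)) //.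
apply: mpres_comp.
  apply: (@mpres_fiber1 _ _ _ _ _ lebesgue2_sf mu
    (fun _ q => ((- q.1, - q.2) : RR * RR))); last by [].
  apply: measurable_fun_pair; apply: measurable_funN.
    exact: (measurableT_comp measurable_fst measurable_fst).
  exact: (measurableT_comp measurable_snd measurable_fst).
apply: (@mpres_fiber2 _ _ _ _ _ lebesgue2_sf mu (fun _ x => - (x : RR))).
  exact: measurable_funN.
by move=> _; exact: mpres_opp.
Qed.

End LebesgueR3.

(** * Three by three matrices and transvections *)

Section Matrices3.
Variable R : comNzRingType.

Lemma big_ord3 (V : nmodType) (F : 'I_3 -> V) : \sum_(i < 3) F i = F 0 + F 1 + F 2.
Proof.
rewrite !big_ord_recl big_ord0 addr0 addrA.
by congr (F _ + F _ + F _); apply/val_inj.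
Qed.

Lemma ord3_cases (P : 'I_3 -> Prop) : P 0 -> P 1 -> P 2 -> forall i, P i.
Proof.
move=> P0 P1 P2 [[|[|[|//]]] hi].
- by rewrite (_ : Ordinal hi = 0) //; exact/val_inj.
- by rewrite (_ : Ordinal hi = 1) //; exact/val_inj.
- by rewrite (_ : Ordinal hi = 2) //; exact/val_inj.
Qed.

Lemma det_mx22 (A : 'M[R]_2) : \det A = A 0 0 * A 1 1 - A 0 1 * A 1 0.
Proof.
rewrite (expand_det_row _ 0) !big_ord_recl big_ord0 /cofactor !det_mx11 !mxE.
have e1 : lift (0 : 'I_2) 0 = 1 by apply/val_inj.
have e2 : lift (1 : 'I_2) 0 = 0 by apply/val_inj.
rewrite !e1 e2 /=; ring.
Qed.

Lemma det_mx33 (A : 'M[R]_3) : \det A =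
  A 0 0 * (A 1 1 * A 2 2 - A 1 2 * A 2 1) -
  A 0 1 * (A 1 0 * A 2 2 - A 1 2 * A 2 0) +
  A 0 2 * (A 1 0 * A 2 1 - A 1 1 * A 2 0).
Proof.
rewrite (expand_det_row _ 0) big_ord3 /cofactor !det_mx22 !mxE.
have e1 : lift (1 : 'I_3) 0 = 0 by apply/val_inj.
have e2 : lift (1 : 'I_3) 1 = 2 by apply/val_inj.
have e3 : lift (0 : 'I_3) 0 = 1 by apply/val_inj.
have e4 : lift (0 : 'I_3) 1 = 2 by apply/val_inj.
have e5 : lift (2 : 'I_3) 0 = 0 by apply/val_inj.
have e6 : lift (2 : 'I_3) 1 = 1 by apply/val_inj.
rewrite e1 e2 e3 e4 e5 e6 /=; ring.
Qed.

(** The matrix [1 + e_i w^T]. For [w i = 0] it is the linear part of a shear changing coordinate [i]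
    only. *)
Definition transvection (i : 'I_3) (w : 'I_3 -> R) : 'M[R]_3 :=
  \matrix_(p, q) ((p == q)%:R + (p == i)%:R * w q).

Lemma transvection_mulmx n i w (A : 'M[R]_(3, n)) p q :
  (transvection i w *m A) p q = A p q + (p == i)%:R * (\sum_k w k * A k q).
Proof.
rewrite mxE; under eq_bigr do rewrite mxE mulrDl.
rewrite big_split /=; congr (_ + _).
  rewrite (bigD1 p) //= eqxx mul1r big1 ?addr0 // => k /negPf.
  by rewrite eq_sym => ->; rewrite mul0r.
by rewrite mulr_sumr; apply: eq_bigr => k _; rewrite mulrA.
Qed.

Lemma mulmx_transvection n i w (A : 'M[R]_(n, 3)) p q :
  (A *m transvection i w) p q = A p q + A p i * w q.
Proof.
rewrite mxE; under eq_bigr do rewrite mxE mulrDr.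
rewrite big_split /=; congr (_ + _).
  by rewrite (bigD1 q) //= eqxx mulr1 big1 ?addr0 // => k /negPf ->; rewrite mulr0.
by rewrite (bigD1 i) //= eqxx mul1r big1 ?addr0 // => k /negPf ->; rewrite mul0r mulr0.
Qed.

Lemma transvectionK i w : w i = 0 ->
  transvection i w *m transvection i (fun k => - w k) = 1%:M.
Proof.
move=> wi; apply/matrixP => p q; rewrite mulmx_transvection !mxE wi mulr0 addr0.
case: (p == i); case: (p == q); case: (i == i) => //=; rewrite ?eqxx //=; ring.
Qed.

End Matrices3.

(** * Transvections generate the special linear group *)

Section SpecialLinear.
Variable R : fieldType.
Variable G : 'M[R]_3 -> Prop.
Hypothesis GM : forall A B, G A -> G B -> G (A *m B).
Hypothesis G1 : G 1%:M.
Hypothesis GT : forall i w, w i = 0 -> G (transvection i w).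

(** The inverse of a transvection is a transvection, so a row operation may be performed on the
    matrix in the goal; [red_r] does this for columns. *)
Let red_l i w A : w i = 0 -> G (transvection i w *m A) -> G A.
Proof.
move=> wi GA.
have := GM (@GT i (fun k => - w k) _) GA; rewrite mulmxA.
have := @transvectionK _ i (fun k => - w k); rewrite wi oppr0.
rewrite (_ : (fun k => - - w k) = w) ?mul1mx; last by apply/funext => k; rewrite opprK.
by move=> -> //; rewrite mul1mx; exact.
Qed.

Let red_r i w A : w i = 0 -> G (A *m transvection i w) -> G A.
Proof.
move=> wi GA.
have := GM GA (@GT i (fun k => - w k) _).
by rewrite -mulmxA transvectionK // mulmx1 wi oppr0; exact.
Qed.

Let wt (a b c : R) : 'I_3 -> R := fun k => [:: a; b; c]`_k.

Let det1 (A : 'M[R]_3) i w : w i = 0 -> \det (transvection i w *m A) = \det A.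
Proof.
move=> wi; rewrite det_mulmx det_mx33 !mxE.
by elim/ord3_cases: i wi => wi; rewrite /= wi /=; ring.
Qed.

Let det2 (A : 'M[R]_3) i w : w i = 0 -> \det (A *m transvection i w) = \det A.
Proof. by move=> wi; rewrite det_mulmx mulrC -det_mulmx det1. Qed.

Let sl_step4 (A : 'M[R]_3) : \det A = 1 -> A 0 0 = 1 -> A 1 0 = 0 -> A 2 0 = 0 ->
  A 0 1 = 0 -> A 0 2 = 0 -> A 1 1 = 1 -> G A.
Proof.
move=> dA a b c d e f.
apply: (@red_l 2 (wt 0 (- A 2 1) 0)) => //.
apply: (@red_r 1 (wt 0 0 (- A 1 2))) => //.
set B := (X in G X); have -> : B = 1%:M; last exact: G1.
have : \det B = 1 by rewrite det2 ?det1.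
rewrite det_mx33.
have E p q : B p q = A p q + (p == 2)%:R * (- A 2 1 * A 1 q) +
   (A p 1 + (p == 2)%:R * (- A 2 1 * A 1 1)) * wt 0 0 (- A 1 2) q.
  rewrite mulmx_transvection !transvection_mulmx !big_ord3 /wt /=; ring.
rewrite !E a b c d e f /wt /= => h.
apply/matrixP => p q; rewrite E mxE.
elim/ord3_cases: p; elim/ord3_cases: q; rewrite /wt /= ?a ?b ?c ?d ?e ?f; try ring.
(* Only the entry (2, 2) is left; it is 1 because the determinant of the reduced matrix is. *)
by rewrite -[RHS]h; ring.
Qed.

Let sl_step3 (A : 'M[R]_3) : \det A = 1 -> A 0 0 = 1 -> A 1 0 = 0 -> A 2 0 = 0 ->
  A 0 1 = 0 -> A 0 2 = 0 -> A 2 1 != 0 -> G A.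
Proof.
move=> dA a b c d e f.
apply: (@red_l 1 (wt 0 0 ((1 - A 1 1) / A 2 1))) => //.
apply: sl_step4; rewrite ?det1 // transvection_mulmx big_ord3 /wt /= ?a ?b ?c ?d ?e; try ring.
by field.
Qed.

Let sl_step2 (A : 'M[R]_3) : \det A = 1 -> A 0 0 = 1 -> A 1 0 = 0 -> A 2 0 = 0 ->
  A 0 1 = 0 -> A 0 2 = 0 -> G A.
Proof.
move=> dA a b c d e; have [f|] := eqVneq (A 2 1) 0; last exact: sl_step3.
apply: (@red_l 2 (wt 0 1 0)) => //.
apply: sl_step3; rewrite ?det1 // transvection_mulmx big_ord3 /wt /= ?a ?b ?c ?d ?e ?f; try ring.
(* After row 1 is added to row 2 the entry is [A 1 1]; if it vanished, column 1 would be zero and so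
   would the determinant. *)
rewrite !mul0r !mul1r !add0r !addr0.
apply/eqP => g; move/eqP: dA; rewrite det_mx33 a b c d e f g.
by rewrite !(mul0r, mulr0, subr0, addr0) eq_sym oner_eq0.
Qed.

Let sl_step1 (A : 'M[R]_3) : \det A = 1 -> A 0 0 = 1 -> G A.
Proof.
move=> dA a.
apply: (@red_l 1 (wt (- A 1 0) 0 0)) => //.
apply: (@red_l 2 (wt (- A 2 0) 0 0)) => //.
apply: (@red_r 0 (wt 0 (- A 0 1) (- A 0 2))) => //.
by apply: sl_step2; rewrite ?det2 ?det1 // mulmx_transvection
  !(transvection_mulmx, big_ord3) /wt /= ?a; ring.
Qed.

Let sl_step0 (A : 'M[R]_3) : \det A = 1 -> A 1 0 != 0 -> G A.
Proof.
move=> dA a.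
apply: (@red_l 0 (wt 0 ((1 - A 0 0) / A 1 0) 0)) => //.
by apply: sl_step1; rewrite ?det1 // transvection_mulmx big_ord3 /wt /=; field.
Qed.

(** Gaussian elimination without scalings: a nonzero entry below a diagonal position is used to turn
    the diagonal entry into 1, after which its row and column are cleared. The last diagonal entry
    is settled by the determinant. *)
Lemma special_linear_ind (A : 'M[R]_3) : \det A = 1 -> G A.
Proof.
move=> dA.
have [a|] := eqVneq (A 1 0) 0; last exact: sl_step0.
(* Column 0 is not zero, so adding row 0 or row 2 to row 1 puts a nonzero entry in position (1,
   0). *)
have [b|b] := eqVneq (A 2 0) 0.
  apply: (@red_l 1 (wt 1 0 0)) => //.
  apply: sl_step0; rewrite ?det1 // transvection_mulmx big_ord3 /wt /= a b.
  rewrite !(mul0r, mulr0, addr0, mul1r, add0r).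
  apply/eqP => c; move/eqP: dA; rewrite det_mx33 a b c.
  by rewrite !(mul0r, mulr0, subr0, addr0) eq_sym oner_eq0.
apply: (@red_l 1 (wt 0 0 1)) => //.
apply: sl_step0; rewrite ?det1 // transvection_mulmx big_ord3 /wt /= a.
by rewrite !(mul0r, mulr0, addr0, mul1r, add0r).
Qed.

End SpecialLinear.

(** * The integral over column vectors and its invariances *)

Section Integral3.
Context {R : realType}.
Local Notation V := 'cV[R]_3.
Local Notation mu3 := (lebesgue3 R).
Local Notation RR := (measurableTypeR R).
Local Notation R3 := ((RR * RR) * RR)%type.

Definition int3 (f : V -> R) : R := \int[mu3]_y f (vec3 y).
Definition integrable3 (f : V -> R) : Prop :=
  mu3.-integrable setT (fun y => (f (vec3 y))%:E).

Lemma vec3E (y : (R * R) * R) :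
  (vec3 y 0 0 = y.1.1) * (vec3 y 1 0 = y.1.2) * (vec3 y 2 0 = y.2).
Proof. by rewrite !mxE. Qed.

(** Measurability lives on nested pairs, continuity on column vectors. The link is that an open set
    is the union of the countably many cubes it contains with rational centre and radius
    [1/(n+1)]. *)
Lemma open_measurable3 (U : set V) : open U -> measurable ((@vec3 R) @^-1` U : set R3).
Proof.
move=> oU.
pose B (i : (rat * rat * rat) * nat) : set R3 :=
  (ball (ratr i.1.1.1 : R) (i.2.+1%:R^-1) `*` ball (ratr i.1.1.2 : R) (i.2.+1%:R^-1))
  `*` ball (ratr i.1.2 : R) (i.2.+1%:R^-1).
have -> : (@vec3 R) @^-1` U =
    \bigcup_i (if `[< B i `<=` (@vec3 R) @^-1` U >] then B i else set0).
  apply/seteqP; split => [y Uy|y [i _]]; last by case: asboolP => // BU; exact: BU.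
  have /nbhs_ballP[e /= e0 eU] : nbhs (vec3 y) U by exact: open_nbhs_nbhs.
  (* The radius is then below [e / 2], so a cube of that radius containing [y] stays within distance
     [e] of [y]. *)
  pose n := Num.truncn (2 / e).
  have n0 : 0 < (n.+1%:R : R)^-1 by rewrite invr_gt0.
  have ne : (n.+1%:R : R)^-1 < e / 2.
    by rewrite -[e / 2]invrK ltf_pV2 ?posrE ?invr_gt0 ?divr_gt0 // invf_div truncnS_gt.
  have rat_near (x : R) : exists q : rat, ball (ratr q : R) n.+1%:R^-1 x.
    have : x - n.+1%:R^-1 < x + n.+1%:R^-1.
      by rewrite ltrBlDr -addrA ltrDl addr_gt0.
    move=> /rat_in_itvoo[q]; rewrite in_itv /= => /andP[h1 h2]; exists q.
    move: h1 h2; rewrite /ball /= ltr_norml.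
    by move: (n.+1%:R^-1) => c h1 h2; apply/andP; split; lra.
  have close (q x z : R) : ball q n.+1%:R^-1 x -> ball q n.+1%:R^-1 z -> ball x e z.
    move: ne; rewrite /ball /= !ltr_norml; move: (n.+1%:R^-1) => c ?.
    by move=> /andP[? ?] /andP[? ?]; apply/andP; split; lra.
  have [q1 h1] := rat_near y.1.1; have [q2 h2] := rat_near y.1.2.
  have [q3 h3] := rat_near y.2.
  exists ((q1, q2, q3), n) => //.
  case: asboolP; first by [].
  case=> z [[/= z1 z2] z3]; apply: eU; split => // i j; rewrite (ord1 j).
  by elim/ord3_cases: i; rewrite !vec3E; [exact: close h1 z1|exact: close h2 z2|exact: close h3 z3].
apply: countable_bigcupT_measurable; first exact: countableP.
move=> i.
case: asboolP => // _; apply: measurableX; first apply: measurableX;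
  exact: measurable_ball.
Qed.

Lemma continuous_measurable3 (f : V -> R) : continuous f ->
  measurable_fun setT (fun y : R3 => f (vec3 y)).
Proof.
move=> /continuousP cf; apply: (measurability _ (RGenOpens.measurableE R)).
move=> _ [_ [a [b ->] <-]]; rewrite setTI.
have oI : open (f @^-1` [set` `]a, b[]) by apply: cf; exact: interval_open.
exact: open_measurable3 oI.
Qed.

(** Ranging over arbitrary extended functions makes the property visibly stable under composition,
    and lets it transport integrability as well as values. *)
Definition int_invariant (S : V -> V) := forall f : V -> \bar R,
  (\int[mu3]_y f (S (vec3 y)) = \int[mu3]_y f (vec3 y))%E.

Lemma int_invariant_mpres (T T' : R3 -> R3) (S : V -> V) :
  mpres mu3 T -> mpres mu3 T' -> cancel T' T ->
  (forall y, S (vec3 y) = vec3 (T y)) -> int_invariant S.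
Proof.
move=> pT pT' TT' SE f; rewrite -[RHS](integral_mpres _ pT pT' TT').
by apply: eq_integral => y _; rewrite SE.
Qed.

Lemma int_invariant_comp S S' : int_invariant S -> int_invariant S' ->
  int_invariant (S \o S').
Proof. by move=> iS iS' f; rewrite -(iS f) -(iS' (f \o S)). Qed.

Lemma int_invariant_opp : int_invariant -%R.
Proof.
apply: (int_invariant_mpres mpres_opp3 mpres_opp3).
  by move=> [[a b] c]; rewrite /= !opprK.
by move=> y; apply/matrixP => i j; rewrite (ord1 j) mxE; elim/ord3_cases: i; rewrite !vec3E.
Qed.

Lemma int_invariant_shear i (w : 'I_3 -> R) a : w i = 0 ->
  int_invariant (fun x => transvection i w *m x + a *: delta_mx i 0).
Proof.
move=> wi.
elim/ord3_cases: i wi => wi.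
- apply: (int_invariant_mpres (mpres_shear_x (w 1) (w 2) a) (mpres_shear_x (- w 1) (- w 2) (- a))).
    by move=> [[p q] r] /=; congr ((_, _), _); ring.
  move=> y; apply/matrixP => i j; rewrite (ord1 j) mxE transvection_mulmx big_ord3 !mxE wi.
  by elim/ord3_cases: i; rewrite /=; ring.
- apply: (int_invariant_mpres (mpres_shear_y (w 0) (w 2) a) (mpres_shear_y (- w 0) (- w 2) (- a))).
    by move=> [[p q] r] /=; congr ((_, _), _); ring.
  move=> y; apply/matrixP => i j; rewrite (ord1 j) mxE transvection_mulmx big_ord3 !mxE wi.
  by elim/ord3_cases: i; rewrite /=; ring.
- apply: (int_invariant_mpres (mpres_shear_z (w 0) (w 1) a) (mpres_shear_z (- w 0) (- w 1) (- a))).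
    by move=> [[p q] r] /=; congr ((_, _), _); ring.
  move=> y; apply/matrixP => i j; rewrite (ord1 j) mxE transvection_mulmx big_ord3 !mxE wi.
  by elim/ord3_cases: i; rewrite /=; ring.
Qed.

Lemma transvection0 i : transvection i (fun=> 0) = 1%:M :> 'M[R]_3.
Proof. by apply/matrixP => p q; rewrite !mxE mulr0 addr0. Qed.

(** Invariance is multiplicative and holds for shears, so it propagates to everything they generate,
    rotations included. *)
Lemma int_invariant_mulmx (A : 'M[R]_3) : \det A = 1 -> int_invariant (mulmx A).
Proof.
move: A; apply: (@special_linear_ind _ (fun A => int_invariant (mulmx A))).
- move=> A B iA iB; rewrite (_ : mulmx _ = mulmx A \o mulmx B).
    exact: int_invariant_comp.
  by apply/funext => x /=; rewrite mulmxA.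
- by rewrite (_ : mulmx _ = id) //; apply/funext => x; rewrite mul1mx.
- move=> i w wi; have := int_invariant_shear 0 wi.
  by congr int_invariant; apply/funext => x; rewrite scale0r addr0.
Qed.

Lemma int_invariant_translation (a : V) : int_invariant (fun x => x + a).
Proof.
have tr i c : int_invariant (fun x => x + c *: delta_mx i 0).
  have := @int_invariant_shear i (fun=> 0) c erefl; congr int_invariant.
  by apply/funext => x; rewrite transvection0 mul1mx.
have := int_invariant_comp (int_invariant_comp (tr 0 (a 0 0)) (tr 1 (a 1 0))) (tr 2 (a 2 0)).
congr int_invariant; apply/funext => x /=; rewrite -!addrA; congr (_ + _).
by apply/matrixP => i j; rewrite (ord1 j) !mxE; elim/ord3_cases: i => /=; ring.
Qed.

Lemma int3_invariant S f : int_invariant S -> int3 (f \o S) = int3 f.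
Proof. by move=> iS; rewrite /int3 /Rintegral -(iS (EFin \o f)). Qed.

End Integral3.

(** * Product integrands, domination and lower bounds *)

Section IntegralTools.
Context {R : realType}.
Local Notation V := 'cV[R]_3.
Local Notation mu := (@lebesgue_measure R).
Local Notation mu3 := (lebesgue3 R).
Local Notation RR := (measurableTypeR R).
Local Notation R3 := ((RR * RR) * RR)%type.

Lemma integral_prod d1 d2 (T1 : measurableType d1) (T2 : measurableType d2)
    (m1 : {sigma_finite_measure set T1 -> \bar R})
    (m2 : {sigma_finite_measure set T2 -> \bar R}) (a : T1 -> R) (b : T2 -> R) :
  measurable_fun setT a -> measurable_fun setT b ->
  (forall x, 0 <= a x) -> (forall x, 0 <= b x) ->
  (\int[m1 \x m2]_z (a z.1 * b z.2)%:E =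
   (\int[m1]_x (a x)%:E) * \int[m2]_y (b y)%:E)%E.
Proof.
move=> ma mb a0 b0; rewrite fubini_tonelli1 /fubini_F /=.
- under eq_integral => x _.
    under eq_integral do rewrite EFinM.
    rewrite ge0_integralZl //; last 3 first.
    + exact/measurable_EFinP.
    + by move=> y _; rewrite lee_fin.
    + by rewrite lee_fin.
    over.
  rewrite ge0_integralZr //.
  + exact/measurable_EFinP.
  + by move=> y _; rewrite lee_fin.
  + by apply: integral_ge0 => y _; rewrite lee_fin.
- apply/measurable_EFinP; apply: measurable_funM.
    exact: (measurableT_comp ma measurable_fst).
  exact: (measurableT_comp mb measurable_snd).
- by move=> z; rewrite lee_fin mulr_ge0.
Qed.

Let measurable_coord3 (a b c : R -> R) :
  measurable_fun setT a -> measurable_fun setT b -> measurable_fun setT c ->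
  measurable_fun setT (fun y : R3 => a y.1.1 * b y.1.2 * c y.2).
Proof.
move=> ma mb mc; apply: measurable_funM; first apply: measurable_funM.
- exact: (measurableT_comp ma (measurableT_comp measurable_fst measurable_fst)).
- exact: (measurableT_comp mb (measurableT_comp measurable_snd measurable_fst)).
- exact: (measurableT_comp mc measurable_snd).
Qed.

Lemma integral_prod3 (a b c : R -> R) :
  measurable_fun setT a -> measurable_fun setT b -> measurable_fun setT c ->
  (forall x, 0 <= a x) -> (forall x, 0 <= b x) -> (forall x, 0 <= c x) ->
  (\int[mu3]_y (a (vec3 y 0 0) * b (vec3 y 1 0) * c (vec3 y 2 0))%:E =
   (\int[mu]_x (a x)%:E) * (\int[mu]_x (b x)%:E) * \int[mu]_x (c x)%:E)%E.
Proof.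
move=> ma mb mc a0 b0 c0.
under eq_integral do rewrite !vec3E.
have mab : measurable_fun setT (fun q : RR * RR => a q.1 * b q.2).
  apply: measurable_funM.
    exact: (measurableT_comp ma measurable_fst).
  exact: (measurableT_comp mb measurable_snd).
rewrite [LHS](@integral_prod _ _ _ _ (@lebesgue2_sf R) mu (fun q => a q.1 * b q.2) c) //.
  by congr (_ * _)%E; rewrite [LHS](@integral_prod _ _ _ _ mu mu a b).
by move=> q; rewrite mulr_ge0.
Qed.

Lemma integrable_prod3 (a b c : R -> R) :
  measurable_fun setT a -> measurable_fun setT b -> measurable_fun setT c ->
  (forall x, 0 <= a x) -> (forall x, 0 <= b x) -> (forall x, 0 <= c x) ->
  mu.-integrable setT (EFin \o a) -> mu.-integrable setT (EFin \o b) ->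
  mu.-integrable setT (EFin \o c) ->
  integrable3 (fun x : V => a (x 0 0) * b (x 1 0) * c (x 2 0)).
Proof.
move=> ma mb mc a0 b0 c0 /(integrable_fin_num measurableT) ia
  /(integrable_fin_num measurableT) ib /(integrable_fin_num measurableT) ic.
apply/integrableP; split.
  apply/measurable_EFinP; rewrite (_ : (fun _ => _) = fun y : R3 => a y.1.1 * b y.1.2 * c y.2).
    exact: measurable_coord3.
  by apply/funext => y; rewrite !vec3E.
under eq_integral do rewrite gee0_abs ?lee_fin ?mulr_ge0 //.
rewrite integral_prod3 //.
by rewrite ltey_eq !fin_numM.
Qed.

(** By evenness the integral is twice that over the half-line, where [atan] is a bounded
    antiderivative. *)
Lemma integrable_inv_oneDsqr : mu.-integrable setT (EFin \o (fun x : R => (1 + x ^+ 2)^-1)).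
Proof.
have pos (x : R) : 0 < 1 + x ^+ 2 by rewrite ltr_pwDl ?sqr_ge0.
have cf : continuous (fun x : R => (1 + x ^+ 2)^-1) by exact: continuous_oneDsqrV.
apply/integrableP; split.
  by apply/measurable_EFinP; exact: continuous_measurable_fun.
under eq_integral do rewrite gee0_abs ?lee_fin ?invr_ge0 ?(ltW (pos _)) //.
rewrite (@ge0_symfun_integralT _ (fun x : R => (1 + x ^+ 2)^-1)) //; last 2 first.
- by move=> x; rewrite invr_ge0 ltW.
- by move=> x /=; rewrite sqrrN.
rewrite -set_itvcy (@ge0_continuous_FTC2y _ _ (@atan R) 0 (pi / 2)).
- by rewrite atan0 sube0 -EFinM ltry.
- by move=> x _; rewrite invr_ge0 ltW.
- exact: continuous_subspaceT.
- exact: cvgy_atan.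
- by move=> x _; exact: derivable_atan.
- by apply: cvg_at_right_filter; exact: continuous_atan.
- by move=> x _; rewrite derive1_atan.
Qed.

(** The common integrable majorant in momentum space. Its product form reduces integrability to one
    dimension and matches the gain of two derivatives along each axis. *)
Definition decay (x : V) : R :=
  (1 + x 0 0 ^+ 2)^-1 * (1 + x 1 0 ^+ 2)^-1 * (1 + x 2 0 ^+ 2)^-1.

Let oneDsqr_pos (x : R) : 0 < 1 + x ^+ 2.
Proof. by rewrite ltr_pwDl ?sqr_ge0. Qed.

Lemma integrable3_decay : integrable3 decay.
Proof.
have m : measurable_fun setT (fun x : R => (1 + x ^+ 2)^-1).
  by apply: continuous_measurable_fun; exact: continuous_oneDsqrV.
have p (x : R) : 0 <= (1 + x ^+ 2)^-1 by rewrite invr_ge0 ltW.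
exact: (integrable_prod3 m m m p p p integrable_inv_oneDsqr integrable_inv_oneDsqr
  integrable_inv_oneDsqr).
Qed.

Lemma integrable3_le (f g : V -> R) : continuous f -> (forall x, `|f x| <= g x) ->
  integrable3 g -> integrable3 f.
Proof.
move=> cf fg; apply: le_integrable => //.
  by apply/measurable_EFinP; apply: continuous_measurable3 => //; exact: cf.
by move=> y _ /=; rewrite lee_fin (le_trans (fg _)) // ler_norm.
Qed.

Lemma integrable3D (f g : V -> R) : integrable3 f -> integrable3 g ->
  integrable3 (fun x => f x + g x).
Proof. by move=> i1 i2; apply: (integrableD measurableT i1 i2). Qed.

Lemma integrable3B (f g : V -> R) : integrable3 f -> integrable3 g ->
  integrable3 (fun x => f x - g x).
Proof. by move=> i1 i2; apply: (integrableB measurableT i1 i2). Qed.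

Lemma integrable3Z (c : R) (f : V -> R) : integrable3 f ->
  integrable3 (fun x => c * f x).
Proof. by move=> i1; apply: (integrableZl measurableT c i1). Qed.

Lemma integrable3_norm (f : V -> R) : integrable3 f -> integrable3 (fun x => `|f x|).
Proof. by move=> i1; exact: (integrable_norm i1). Qed.

Lemma int3D (f g : V -> R) : integrable3 f -> integrable3 g ->
  int3 (fun x => f x + g x) = int3 f + int3 g.
Proof. by move=> i1 i2; rewrite /int3 RintegralD. Qed.

Lemma int3B (f g : V -> R) : integrable3 f -> integrable3 g ->
  int3 (fun x => f x - g x) = int3 f - int3 g.
Proof. by move=> i1 i2; rewrite /int3 RintegralB. Qed.

Lemma int3Z (c : R) (f : V -> R) : integrable3 f ->
  int3 (fun x => c * f x) = c * int3 f.
Proof. by move=> i1; rewrite /int3 RintegralZl. Qed.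

Lemma le_int3 (f g : V -> R) : integrable3 f -> integrable3 g ->
  (forall x, f x <= g x) -> int3 f <= int3 g.
Proof. by move=> i1 i2 fg; rewrite /int3 le_Rintegral. Qed.

Lemma int3_ge0 (f : V -> R) : (forall x, 0 <= f x) -> 0 <= int3 f.
Proof. by move=> f0; rewrite /int3 Rintegral_ge0. Qed.

Lemma le_norm_int3 (f g : V -> R) : integrable3 f -> integrable3 g ->
  (forall x, `|f x| <= g x) -> `|int3 f| <= int3 g.
Proof.
move=> i1 i2 fg; apply: (le_trans (le_normr_Rintegral measurableT i1)).
by apply: (@le_int3 (fun x => `|f x|) g) => //; exact: integrable3_norm.
Qed.

Lemma cvg_int3 (f_ : nat -> V -> R) (f g : V -> R) :
  (forall n, continuous (f_ n)) -> (forall x, f_ n x @[n --> \oo] --> f x) ->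
  integrable3 g -> (forall n x, `|f_ n x| <= g x) ->
  int3 (f_ n) @[n --> \oo] --> int3 f.
Proof.
move=> cf ff ig fg.
have h1 n : measurable_fun setT (fun y : R3 => (f_ n (vec3 y))%:E).
  by apply/measurable_EFinP; apply: continuous_measurable3 => //; exact: cf.
have h2 (y : R3) : setT y -> (f_ n (vec3 y))%:E @[n --> \oo] --> (f (vec3 y))%:E.
  by move=> _; apply: cvg_EFin; [exact: nearW|exact: ff].
have h3 n (y : R3) : setT y -> (`|(f_ n (vec3 y))%:E| <= (g (vec3 y))%:E)%E.
  by move=> _; rewrite lee_fin.
have mf : measurable_fun setT (fun y : R3 => (f (vec3 y))%:E).
  exact: (emeasurable_fun_cvg _ _ h1 h2).
have [fi _] := dominated_convergence measurableT h1 mf (aeW _ h2) ig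
  (aeW _ (fun y n => h3 n y)).
by rewrite -(fineK (integrable_fin_num measurableT fi)) => /fine_cvgP[].
Qed.

(** Balls of column vectors are those of the sup norm, that is cubes of side [r *+ 2], and the
    indicator of a cube is a product of three indicators. *)
Lemma le_int3_ball (f : V -> R) (x0 : V) (r c : R) : 0 < r -> 0 <= c ->
  integrable3 f -> (forall x, 0 <= f x) -> (forall x, ball x0 r x -> c <= f x) ->
  c * (r *+ 2) ^+ 3 <= int3 f.
Proof.
move=> r0 c0 fi f0 fc.
have mB i : measurable_fun setT (\1_(ball (x0 i 0) r) : R -> R).
  by apply/measurable_indicP; exact: measurable_ball.
have nB i (x : R) : 0 <= \1_(ball (x0 i 0) r) x :> R by rewrite indicE ler0n.
have iB i : mu.-integrable setT (EFin \o (\1_(ball (x0 i 0) r) : R -> R)).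
  by rewrite ball_itv; exact: integrable_indic_itv.
have eB i : (\int[mu]_x (\1_(ball (x0 i 0) r) x)%:E = (r *+ 2)%:E)%E.
  have mb : measurable (ball (x0 i 0) r) by exact: measurable_ball.
  rewrite (integral_indic mu measurableT mb) setIT.
  exact: (lebesgue_measure_ball _ (ltW r0)).
pose g (x : V) : R := \1_(ball (x0 0 0) r) (x 0 0) * \1_(ball (x0 1 0) r) (x 1 0)
  * \1_(ball (x0 2 0) r) (x 2 0).
have gi : integrable3 g.
  exact: (integrable_prod3 (mB 0) (mB 1) (mB 2) (nB 0) (nB 1) (nB 2) (iB 0) (iB 1) (iB 2)).
have eg : int3 g = (r *+ 2) ^+ 3.
  rewrite /int3 /Rintegral /g.
  have := integral_prod3 (mB 0) (mB 1) (mB 2) (nB 0) (nB 1) (nB 2).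
  by move=> /= ->; rewrite !eB /= !exprS expr0 mulr1 mulrA.
rewrite -eg -int3Z //; apply: le_int3 => //; first exact: integrable3Z.
move=> x; rewrite /g !indicE.
case: (boolP (x 0 0 \in _)) => [/set_mem h1|_]; last by rewrite !mul0r mulr0.
case: (boolP (x 1 0 \in _)) => [/set_mem h2|_]; last by rewrite !(mulr0, mul0r).
case: (boolP (x 2 0 \in _)) => [/set_mem h3|_]; last by rewrite !mulr0.
rewrite !mulr1; apply: fc; split => // i j; rewrite (ord1 j).
by elim/ord3_cases: i.
Qed.

End IntegralTools.

(** * Continuity of matrix maps and derivatives along affine maps *)

Lemma continuous_mx (T : topologicalType) (R : numFieldType) m n
    (f : T -> 'M[R]_(m, n)) :
  (forall i j, continuous (fun x => f x i j)) -> continuous f.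
Proof.
move=> cf x; apply/cvg_mx_entourageP => A entA.
apply: filter_forall => i; apply: filter_forall => j.
apply: (cf i j x [set z | (f x i j, z) \in A]).
by rewrite -nbhs_entourageE; exists A => // z; rewrite /xsection /= !inE.
Qed.

Lemma continuous_mulmx (R : numFieldType) m n p (A : 'M[R]_(m, n)) :
  continuous (mulmx A : 'M[R]_(n, p) -> 'M[R]_(m, p)).
Proof.
apply: continuous_mx => i j; under eq_fun do rewrite mxE.
apply: continuous_big => [|k _ x]; first exact: add_continuous.
have h : M k j @[M --> x] --> x k j by exact: coord_continuous.
exact: (cvgM (cvg_cst (A i k)) h).
Qed.

Section Derivatives.
Context {R : realType}.

(** The two difference quotients are the same function of [h], so value and derivability transfer
    together as plain equalities. *)
Lemma derive_precomp (U W : normedModType R) (g : W -> R) (T : U -> W) (v : U) (w : W) p :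
  (forall h : R, T (h *: v + p) = h *: w + T p) ->
  ('D_v (g \o T) p = 'D_w g (T p)) * (derivable (g \o T) p v = derivable g (T p) w).
Proof.
move=> HT; rewrite /derive /derivable.
have -> : (fun h : R => h^-1 *: ((g \o T \o shift p) (h *: v) - (g \o T) p)) =
   (fun h : R => h^-1 *: ((g \o shift (T p)) (h *: w) - g (T p))).
  by apply/funext => h /=; rewrite HT.
by [].
Qed.

Lemma is_derive_precomp (U : normedModType R) (f : R -> R) (l : U -> R) (v : U) (c df : R) p :
  (forall h : R, l (h *: v + p) = h * c + l p) -> is_derive (l p) 1 f df ->
  is_derive p v (f \o l) (c * df).
Proof.
move=> Hl [fd fE]; have fdiff : differentiable f (l p) by apply/derivable1_diffP.
have [e1 e2] := derive_precomp (w := c) f Hl.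
split; first by rewrite e2; exact: diff_derivable.
rewrite e1 deriveE //.
have -> : c = c *: (1 : R) by rewrite /GRing.scale /= mulr1.
by rewrite linearZ -deriveE // fE /GRing.scale /= mulr1.
Qed.

End Derivatives.

(** * Smooth and compactly supported functions *)

Section Smooth.
Context {R : realType}.
Local Notation V := 'cV[R]_3.
Local Notation ST := (R * V)%type.

Lemma iter_derive_precomp (T L : ST -> ST) (f : ST -> R) :
  (forall p v (h : R), T (h *: v + p) = h *: L v + T p) ->
  forall vs, iter_derive vs (f \o T) = iter_derive (map L vs) f \o T.
Proof.
move=> HT; elim=> //= v vs IH; apply/funext => p /=.
by rewrite IH (derive_precomp _ (HT p v)).
Qed.

Lemma iter_derive_rcons vs v (f : ST -> R) :
  iter_derive (rcons vs v) f = iter_derive vs (fun p => 'D_v f p).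
Proof. by elim: vs => //= w vs ->. Qed.

Lemma smooth_precomp (T L : ST -> ST) (f : ST -> R) : continuous T ->
  (forall p v (h : R), T (h *: v + p) = h *: L v + T p) ->
  smooth f -> smooth (f \o T).
Proof.
move=> cT HT sf vs; have [cf df] := sf (map L vs).
rewrite (iter_derive_precomp _ HT); split.
  by move=> p; apply: continuous_comp; [exact: cT|exact: cf].
by move=> v p; rewrite (derive_precomp _ (HT p v)).
Qed.

Lemma smooth_derive (f : ST -> R) v : smooth f -> smooth (fun p => 'D_v f p).
Proof. by move=> sf vs; rewrite -iter_derive_rcons; exact: sf. Qed.

(** Smoothness by coinduction: exhibiting a class closed under directional derivatives replaces the
    computation of iterated ones. *)
Lemma smooth_coind (P : (ST -> R) -> Prop) :
  (forall f, P f -> [/\ continuous f, forall v p, derivable f p v &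
     forall v, P (fun p => 'D_v f p)]) -> forall f, P f -> smooth f.
Proof.
move=> HP f Pf vs.
have : P (iter_derive vs f) by elim: vs => //= v vs /HP[].
by move=> /HP[].
Qed.

(** Off its support [f] is zero on a whole neighbourhood, so differentiating cannot enlarge the
    support. *)
Lemma C0oo_derive (f : ST -> R) v : C0oo f -> C0oo (fun p => 'D_v f p).
Proof.
move=> [sf cf Mf].
have sub : supp (fun p => 'D_v f p) `<=` supp f.
  rewrite [X in _ `<=` X](closure_id _).1; last exact: closed_closure.
  apply: closure_subset => p /= Dp; apply: contrapT => np.
  have : nbhs p (~` closure [set p0 | f p0 != 0]).
    by apply: open_nbhs_nbhs; split => //; apply: closed_openC; exact: closed_closure.
  move=> nb; move/eqP: Dp; apply.
  rewrite (@near_eq_derive _ _ _ f (cst 0)) ?derive_cst //.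
  near=> q; apply/eqP/negP => /negP fq.
  have : (~` closure [set p0 | f p0 != 0]) q by near: q.
  by apply; exact: subset_closure.
split; first exact: smooth_derive.
- by apply: subclosed_compact cf sub; exact: closed_closure.
- exact: subset_trans sub Mf.
Unshelve. all: by end_near. Qed.

Lemma C0oo_precomp (T S L : ST -> ST) (f : ST -> R) : continuous T -> continuous S ->
  cancel T S -> cancel S T -> (forall p, (T p).1 = p.1) ->
  (forall p v (h : R), T (h *: v + p) = h *: L v + T p) ->
  C0oo f -> C0oo (f \o T).
Proof.
move=> cT cS TS ST' T1 HT [sf cf Mf].
have sub : supp (f \o T) `<=` T @^-1` supp f.
  have cl : closed (T @^-1` supp f).
    by apply: preimage_closed => [p _|]; [exact: cT|exact: closed_closure].
  rewrite [X in _ `<=` X](closure_id _).1 //; apply: closure_subset => p /= fp.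
  exact: subset_closure.
split; first exact: smooth_precomp HT sf.
- apply: (@subclosed_compact _ _ (S @` supp f)).
  + exact: closed_closure.
  + by apply: continuous_compact => //; exact: continuous_subspaceT.
  + by move=> p /sub h; exists (T p) => //; rewrite TS.
- by move=> p /sub/Mf; rewrite /Mdom /= T1.
Qed.

(** Compact support in quantitative form: the same [M] bounds the values and the coordinates of the
    points where [f] is nonzero, which is what the majorants below need. *)
Definition Cc (f : V -> R) := continuous f /\
  exists M, forall x, `|f x| <= M /\ (f x != 0 -> forall i, `|x i 0| <= M).

Lemma Cc_slice (f : ST -> R) t : C0oo f -> Cc (fun x => f (t, x)).
Proof.
move=> [sf cf _]; have [cont _] := sf [::]; split.
  move=> x; apply: (@continuous_comp _ _ _ (fun x => (t, x)) f); last exact: cont.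
  exact: (cvg_pair (cvg_cst t) (@cvg_id _ (nbhs x))).
have bd (g : ST -> R) : continuous g -> exists M, forall p, supp f p -> `|g p| <= M.
  move=> cg; have : compact (g @` supp f).
    by apply: continuous_compact => //; exact: continuous_subspaceT.
  move=> /compact_bounded [M [_ HM]]; exists (M + 1) => p fp.
  have M1 : M < M + 1 by rewrite ltrDl.
  by have := HM _ M1 (g p); apply; exists p.
have [M0 h0] := bd f cont.
have cc i : continuous (fun p : ST => p.2 i 0).
  move=> p; apply: (@continuous_comp _ _ _ snd (fun x : V => x i 0)).
    exact: cvg_snd.
  exact: coord_continuous.
have [M1 h1] := bd _ (cc 0); have [M2 h2] := bd _ (cc 1); have [M3 h3] := bd _ (cc 2).
exists (`|M0| + `|M1| + `|M2| + `|M3|) => x.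
have a0 := normr_ge0 M0; have a1 := normr_ge0 M1; have a2 := normr_ge0 M2.
have a3 := normr_ge0 M3.
have b0 := ler_norm M0; have b1 := ler_norm M1; have b2 := ler_norm M2.
have b3 := ler_norm M3.
have sup : f (t, x) != 0 -> supp f (t, x) by move=> ?; exact: subset_closure.
split.
  have [->|/sup/h0 H] := eqVneq (f (t, x)) 0; first by rewrite normr0; lra.
  by lra.
move=> /sup s; have /= := h3 _ s; have /= := h2 _ s; have /= := h1 _ s => H1 H2 H3.
by elim/ord3_cases; lra.
Qed.

Lemma integrable3_box M : exists2 b : V -> R, integrable3 b &
  forall x, 0 <= b x /\ ((forall i, `|x i 0| <= M) -> b x = 1).
Proof.
pose b : R -> R := \1_[set` `[- M, M]].
have mb : measurable_fun setT b by apply/measurable_indicP; exact: measurable_itv.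
have nb x : 0 <= b x by rewrite /b indicE ler0n.
have ib : (@lebesgue_measure R).-integrable setT (EFin \o b) by exact: integrable_indic_itv.
exists (fun x => b (x 0 0) * b (x 1 0) * b (x 2 0)).
  exact: (integrable_prod3 mb mb mb nb nb nb ib ib ib).
move=> x; split; first by rewrite !mulr_ge0.
move=> xM; have e i : b (x i 0) = 1.
  by rewrite /b indicE mem_set //= in_itv /= -ler_norml.
by rewrite !e !mulr1.
Qed.

Lemma integrable3_Cc f : Cc f -> integrable3 f.
Proof.
move=> [cf [M HM]].
have M0 : 0 <= M by apply: le_trans (HM 0).1; exact: normr_ge0.
have [b ib b1] := integrable3_box M.
have := integrable3Z M ib; apply: integrable3_le => // x.
have [fM fs] := HM x; have [bx0 bx1] := b1 x.
have [->|/fs H] := eqVneq (f x) 0; first by rewrite normr0 mulr_ge0.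
by rewrite bx1 // mulr1.
Qed.

Lemma CcM (f g : V -> R) K : Cc f -> continuous g -> (forall x, `|g x| <= K) ->
  Cc (fun x => g x * f x).
Proof.
move=> [cf [M HM]] cg gK; split; first by move=> x; exact: (cvgM (cg x) (cf x)).
have M0 : 0 <= M by apply: le_trans (HM 0).1; exact: normr_ge0.
have K0 : 0 <= K by apply: le_trans (gK 0); exact: normr_ge0.
exists (K * M + M) => x; have [h1 h2] := HM x; split.
  rewrite normrM; apply: (@le_trans _ _ (K * M)); last by rewrite lerDl.
  by apply: ler_pM => //; exact: normr_ge0.
rewrite mulf_eq0 negb_or => /andP[_ /h2 H] i; apply: le_trans (H i) _.
by rewrite lerDr mulr_ge0.
Qed.

End Smooth.

(** * The integral of a derivative vanishes *)

Section IntegralOfDerivative.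
Context {R : realType}.
Local Notation V := 'cV[R]_3.
Local Notation ST := (R * V)%type.

Lemma cvg_harmonic_dnbhs : (fun n => n.+1%:R^-1 : R) @ \oo --> 0^'.
Proof.
move=> A hA.
have : \forall n \near \oo, ((n.+1%:R^-1 : R) != 0 -> A n.+1%:R^-1).
  exact: (@cvg_harmonic R _ hA).
by apply: filterS => n; apply; rewrite gt_eqF // invr_gt0.
Qed.

(** Each difference quotient of [g] along [v] has integral zero by translation invariance. The mean
    value theorem bounds these quotients by values of [g'], so dominated convergence passes to the
    limit. *)
Lemma int3_derive0 (g g' : V -> R) (v : V) : Cc g -> Cc g' ->
  (forall x, is_derive x v g (g' x)) -> int3 g' = 0.
Proof.
move=> Cg Cg' dg.
have [cg [M HM]] := Cg; have [cg' [M' HM']] := Cg'.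
pose h n : R := n.+1%:R^-1.
have h0 n : 0 < h n by rewrite invr_gt0.
have h1 n : h n <= 1 by rewrite invf_le1 // ler1n.
pose tr n (x : V) := x + h n *: v.
pose F n x := (h n)^-1 * (g (tr n x) - g x).
have ctr n : continuous (tr n).
  by move=> x; exact: (cvgD (@cvg_id _ (nbhs x)) (cvg_cst _)).
have cgt n : continuous (g \o tr n).
  by move=> x; apply: continuous_comp; [exact: ctr|exact: cg].
have igt n : integrable3 (g \o tr n) /\ int3 (g \o tr n) = int3 g.
  split; last by apply: int3_invariant; exact: int_invariant_translation.
  apply: integrable3_Cc; split => //.
  exists (M + (`|v 0 0| + `|v 1 0| + `|v 2 0|)) => x; have [m1 m2] := HM (tr n x).
  have vi i : `|v i 0| <= `|v 0 0| + `|v 1 0| + `|v 2 0|.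
    have := normr_ge0 (v 0 0); have := normr_ge0 (v 1 0); have := normr_ge0 (v 2 0).
    by elim/ord3_cases: i; lra.
  split; first by apply: le_trans m1 _; rewrite lerDl !addr_ge0.
  move=> /m2 H i; have -> : x i 0 = tr n x i 0 - h n * v i 0.
    by rewrite /tr !mxE addrK.
  apply: le_trans (ler_normB _ _) _; apply: lerD => //.
  by rewrite normrM gtr0_norm // (le_trans _ (vi i)) // ler_piMl.
have intF n : int3 (F n) = 0.
  have [i1 e1] := igt n.
  rewrite /F int3Z; last by apply: integrable3B => //; exact: integrable3_Cc.
  by rewrite int3B ?e1 ?subrr ?mulr0 //; exact: integrable3_Cc.
have phi (x : V) (s : R) : is_derive s 1 (fun s => g (x + s *: v)) (g' (x + s *: v)).
  have H k : x + (k *: (1 : R) + s) *: v = k *: v + (x + s *: v).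
    by rewrite scalerDl addrCA /GRing.scale /= mulr1.
  have [e1 e2] := derive_precomp (T := fun s : R => x + s *: v) (v := 1 : R) (p := s) g H.
  have [d1 d2] := dg (x + s *: v).
  by split; [rewrite e2|rewrite e1].
have mvt n x : exists2 c, 0 <= c <= h n & F n x = g' (x + c *: v).
  have [|c cI E] := MVT (h0 n) (fun s _ => phi x s).
  - apply: continuous_subspaceT => s.
    apply: (@continuous_comp _ _ _ (fun s : R => x + s *: v) g); last exact: cg.
    have e : s0 *: v @[s0 --> s] --> s *: v by exact: (@scalel_continuous _ _ v s).
    exact: (cvgD (cvg_cst x) e).
  - exists c; first by move: cI; rewrite in_itv /= => /andP[/ltW -> /ltW ->].
    by rewrite /F /tr; move: E; rewrite scale0r addr0 subr0 => ->; rewrite mulrC mulfK ?gt_eqF.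
have limF x : F n x @[n --> \oo] --> g' x.
  have [d1 d2] := dg x.
  pose q (k : R) := k^-1 *: ((g \o shift x) (k *: v) - g x).
  have qx : q k @[k --> 0^'] --> g' x by rewrite -d2; exact: d1.
  have -> : (fun n => F n x) = q \o (fun n => n.+1%:R^-1).
    by apply/funext => n; rewrite /F /tr /q /= [x + _]addrC.
  exact: (cvg_comp _ _ cvg_harmonic_dnbhs qx).
have M0 : 0 <= M' by apply: le_trans (HM' 0).1; exact: normr_ge0.
(* The mean value point is [x + c *: v] with [c <= 1], so the cube containing the support of [g'] is
   enlarged by the size of [v]. *)
have [b ib b1] := integrable3_box (M' + (`|v 0 0| + `|v 1 0| + `|v 2 0|)).
have : int3 (F n) @[n --> \oo] --> int3 g'.
  apply: (@cvg_int3 _ F g' (fun x => M' * b x)) => //.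
  - by move=> n x; exact: (cvgM (cvg_cst _) (cvgB (cgt n x) (cg x))).
  - exact: integrable3Z.
  - move=> n x; have [c /andP[c0 ch] ->] := mvt n x.
    have [m1 m2] := HM' (x + c *: v); have [bx0 bx1] := b1 x.
    have [->|/m2 H] := eqVneq (g' (x + c *: v)) 0; first by rewrite normr0 mulr_ge0.
    rewrite bx1 ?mulr1 // => i.
    have vi : `|v i 0| <= `|v 0 0| + `|v 1 0| + `|v 2 0|.
      have := normr_ge0 (v 0 0); have := normr_ge0 (v 1 0); have := normr_ge0 (v 2 0).
      by elim/ord3_cases: i {H}; lra.
    have -> : x i 0 = (x + c *: v) i 0 - c * v i 0 by rewrite !mxE addrK.
    apply: le_trans (ler_normB _ _) _; apply: lerD => //.
    rewrite normrM ger0_norm // (le_trans _ vi) // ler_piMl //.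
    exact: le_trans ch (h1 n).
under eq_cvg do rewrite intF.
by move=> /(cvg_lim (@Rhausdorff R)) <-; rewrite lim_cst.
Qed.

End IntegralOfDerivative.

(** * Cosine and sine transforms of test functions *)

Section Transforms.
Context {R : realType}.
Local Notation V := 'cV[R]_3.
Local Notation ST := (R * V)%type.

Lemma dotDr (k x y : V) : dot k (x + y) = dot k x + dot k y.
Proof. by rewrite /dot !big_ord3 !mxE; ring. Qed.

Lemma dotZr (k x : V) c : dot k (c *: x) = c * dot k x.
Proof. by rewrite /dot !big_ord3 !mxE; ring. Qed.

Lemma dotNr (k x : V) : dot k (- x) = - dot k x.
Proof. by rewrite /dot !big_ord3 !mxE; ring. Qed.

Lemma dotC (k x : V) : dot k x = dot x k.
Proof. by rewrite /dot; apply: eq_bigr => i _; rewrite mulrC. Qed.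

Lemma dot_mulmx (k x : V) (A : 'M[R]_3) : dot k (A *m x) = dot (A^T *m k) x.
Proof. by rewrite /dot !big_ord3 !mxE !big_ord3 !mxE; ring. Qed.

Lemma dot_delta (k : V) i : dot k (delta_mx i 0) = k i 0.
Proof.
rewrite /dot (bigD1 i) //= mxE !eqxx mulr1 big1 ?addr0 // => j /negPf ji.
by rewrite mxE ji mulr0.
Qed.

Lemma continuous_dot (k : V) : continuous (dot k).
Proof.
apply: continuous_big => [|i _ x]; first exact: add_continuous.
have h : M i 0 @[M --> x] --> x i 0 by exact: coord_continuous.
exact: (cvgM (cvg_cst (k i 0)) h).
Qed.

Lemma continuous_cos_dot (k : V) : continuous (fun x => cos (dot k x)).
Proof.
move=> x; apply: (@continuous_comp _ _ _ (dot k) cos); first exact: continuous_dot.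
exact: continuous_cos.
Qed.

Lemma continuous_sin_dot (k : V) : continuous (fun x => sin (dot k x)).
Proof.
move=> x; apply: (@continuous_comp _ _ _ (dot k) sin); first exact: continuous_dot.
exact: continuous_sin.
Qed.

Lemma Cc_cos k f : Cc f -> Cc (fun x : V => cos (dot k x) * f x).
Proof.
by move=> cf; apply: (CcM cf (@continuous_cos_dot k)) => x; exact: cos_max.
Qed.

Lemma Cc_sin k f : Cc f -> Cc (fun x : V => sin (dot k x) * f x).
Proof.
by move=> cf; apply: (CcM cf (@continuous_sin_dot k)) => x; exact: sin_max.
Qed.

Definition cosT (f : V -> R) (k : V) := int3 (fun x => cos (dot k x) * f x).
Definition sinT (f : V -> R) (k : V) := int3 (fun x => sin (dot k x) * f x).

Lemma cosT_bounded f : Cc f -> exists M, forall k, `|cosT f k| <= M.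
Proof.
move=> cf; exists (int3 (fun x => `|f x|)) => k.
apply: le_norm_int3; [exact/integrable3_Cc/Cc_cos|exact/integrable3_norm/integrable3_Cc|].
by move=> x; rewrite normrM ler_piMl //; exact: cos_max.
Qed.

Lemma sinT_bounded f : Cc f -> exists M, forall k, `|sinT f k| <= M.
Proof.
move=> cf; exists (int3 (fun x => `|f x|)) => k.
apply: le_norm_int3; [exact/integrable3_Cc/Cc_sin|exact/integrable3_norm/integrable3_Cc|].
by move=> x; rewrite normrM ler_piMl //; exact: sin_max.
Qed.

Lemma Cc_add (f g : V -> R) : Cc f -> Cc g -> Cc (fun x => f x + g x).
Proof.
move=> [cf [M HM]] [cg [M' HM']]; split; first by move=> x; exact: (cvgD (cf x) (cg x)).
have M0 : 0 <= M by apply: le_trans (HM 0).1; exact: normr_ge0.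
have M0' : 0 <= M' by apply: le_trans (HM' 0).1; exact: normr_ge0.
exists (M + M') => x; have [a b] := HM x; have [a' b'] := HM' x; split.
  by apply: le_trans (ler_normD _ _) _; exact: lerD.
move=> fg i; have [f0|/b /(_ i)] := eqVneq (f x) 0; last by move=> ?; lra.
have /b'/(_ i) ? : g x != 0 by move: fg; rewrite f0 add0r.
lra.
Qed.

Lemma CcZ (c : R) f : Cc f -> Cc (fun x : V => c * f x).
Proof.
move=> cf; have cc : continuous (fun _ : V => c) by exact: cst_continuous.
exact: (CcM cf cc (fun=> lexx `|c|)).
Qed.

(** Integration by parts at fixed time; there is no boundary term because the product of [u] and the
    slice has compact support. *)
Lemma int3_slice_derive0 (u u' : V -> R) (f : ST -> R) (t : R) (v : V) :
  C0oo f -> continuous u -> continuous u' -> (forall x, `|u x| <= 1) ->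
  (exists K, forall x, `|u' x| <= K) -> (forall x, is_derive x v u (u' x)) ->
  int3 (fun x => u x * 'D_(0, v) f (t, x)) = - int3 (fun x => u' x * f (t, x)).
Proof.
move=> Cf cu cu' u1 [K uK] du.
have C1 := Cc_slice t Cf; have C2 := Cc_slice t (C0oo_derive (0, v) Cf).
have Ca := CcM C2 cu u1; have Cb := CcM C1 cu' uK.
apply/eqP; rewrite -addr_eq0 -int3D; try exact: integrable3_Cc.
apply/eqP; apply: (@int3_derive0 _ (fun x => u x * f (t, x)) _ v).
- exact: CcM C1 cu u1.
- exact: Cc_add.
- move=> x; have d1 := du x.
  have [_ df] := (let: And3 sf _ _ := Cf in sf) [::].
  have H (h : R) : (t, h *: v + x) = h *: ((0, v) : ST) + (t, x).
    by rewrite [RHS]surjective_pairing /= scaler0 add0r.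
  have [e1 e2] := derive_precomp (T := fun x => (t, x) : ST) (v := v) (p := x) f H.
  have d2 : is_derive x v (fun x => f (t, x)) ('D_(0, v) f (t, x)).
    by split; [rewrite e2; exact: df|exact: e1].
  have := is_deriveM d1 d2; rewrite [u' x * _]mulrC.
  exact.
Qed.

Lemma is_derive_dot (k v x : V) (F F' : R -> R) :
  (forall s : R, is_derive s (1 : R) F (F' s)) ->
  is_derive x v (fun x => F (dot k x)) (dot k v * F' (dot k x)).
Proof.
move=> dF; apply: (is_derive_precomp (l := dot k)) => // h.
by rewrite dotDr dotZr.
Qed.

Lemma cosT_derive (f : ST -> R) (t : R) (v k : V) : C0oo f ->
  cosT (fun x => 'D_(0, v) f (t, x)) k = dot k v * sinT (fun x => f (t, x)) k.
Proof.
move=> Cf; rewrite /cosT.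
have dc (x : V) : is_derive x v (fun x => cos (dot k x)) (dot k v * (- sin (dot k x))).
  exact: is_derive_dot.
have cc : continuous (fun x : V => dot k v * (- sin (dot k x))).
  move=> x; have h : - sin (dot k y) @[y --> x] --> - sin (dot k x).
    apply: (@continuous_comp _ _ _ (fun y => sin (dot k y)) (@GRing.opp R)).
      exact: continuous_sin_dot.
    exact: opp_continuous.
  exact: (cvgM (cvg_cst (dot k v)) h).
have bc : exists K, forall x : V, `|dot k v * (- sin (dot k x))| <= K.
  by exists `|dot k v| => x; rewrite normrM normrN ler_piMr //; exact: sin_max.
rewrite (int3_slice_derive0 t Cf (@continuous_cos_dot k) cc (fun x => cos_max _) bc dc).
rewrite /sinT -int3Z; last exact/integrable3_Cc/Cc_sin/Cc_slice.
rewrite -[X in - X]mul1r -mulNr -int3Z; last first.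
  apply: integrable3_Cc; have := CcZ (- dot k v) (Cc_sin k (Cc_slice t Cf)).
  by congr Cc; apply/funext => x; ring.
by congr int3; apply/funext => x; ring.
Qed.

Lemma sinT_derive (f : ST -> R) (t : R) (v k : V) : C0oo f ->
  sinT (fun x => 'D_(0, v) f (t, x)) k = - (dot k v * cosT (fun x => f (t, x)) k).
Proof.
move=> Cf; rewrite /sinT.
have dc (x : V) : is_derive x v (fun x => sin (dot k x)) (dot k v * cos (dot k x)).
  exact: is_derive_dot.
have cc : continuous (fun x : V => dot k v * cos (dot k x)).
  move=> x; have h : cos (dot k y) @[y --> x] --> cos (dot k x).
    exact: continuous_cos_dot.
  exact: (cvgM (cvg_cst (dot k v)) h).
have bc : exists K, forall x : V, `|dot k v * cos (dot k x)| <= K.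
  by exists `|dot k v| => x; rewrite normrM ler_piMr //; exact: cos_max.
rewrite (int3_slice_derive0 t Cf (@continuous_sin_dot k) cc (fun x => sin_max _) bc dc).
rewrite /cosT -int3Z; last exact/integrable3_Cc/Cc_cos/Cc_slice.
by congr (- int3 _); apply/funext => x; ring.
Qed.

(** The weights keeping all transforms bounded. The quantifier over [f] sits inside because the next
    step applies the bound to second derivatives of [f]. *)
Let P (w : V -> R) := forall (f : ST -> R) t, C0oo f ->
  exists K, forall k, `|w k * cosT (fun x => f (t, x)) k| <= K /\
                      `|w k * sinT (fun x => f (t, x)) k| <= K.

(** Two derivatives along axis [i] multiply the transform by [- k_i^2], so the new weight amounts to
    transforming [f] minus its second derivative. *)
Let P_step w i : P w -> P (fun k => w k * (1 + k i 0 ^+ 2)).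
Proof.
move=> Pw f t Cf; pose v : V := delta_mx i 0.
have Cf1 := C0oo_derive (0, v) Cf; have Cf2 := C0oo_derive (0, v) Cf1.
have [K1 h1] := Pw f t Cf; have [K2 h2] := Pw _ t Cf2.
exists (K1 + K2) => k; have [a1 b1] := h1 k; have [a2 b2] := h2 k.
have := cosT_derive t v k Cf1; rewrite (sinT_derive t v k Cf) /v dot_delta => ec.
have := sinT_derive t v k Cf1; rewrite (cosT_derive t v k Cf) /v dot_delta => es.
have norm_split (a b c : R) : `|a| <= K1 -> `|b| <= K2 -> c = a - b -> `|c| <= K1 + K2.
  by move=> ha hb ->; apply: le_trans (ler_normB _ _) _; exact: lerD.
split.
- by apply: norm_split a1 a2 _; rewrite ec; ring.
- by apply: norm_split b1 b2 _; rewrite es; ring.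
Qed.

Lemma transform_decay (f : ST -> R) t : C0oo f -> exists K, forall k,
  `|cosT (fun x => f (t, x)) k| <= K * decay k /\
  `|sinT (fun x => f (t, x)) k| <= K * decay k.
Proof.
have P1 : P (fun=> 1).
  move=> g s Cg; have C1 := Cc_slice s Cg.
  have [K1 h1] := cosT_bounded C1; have [K2 h2] := sinT_bounded C1.
  exists (`|K1| + `|K2|) => k; rewrite !mul1r; split.
    by apply: le_trans (h1 k) _; rewrite (le_trans (ler_norm _)) // lerDl.
  by apply: le_trans (h2 k) _; rewrite (le_trans (ler_norm _)) // lerDr.
move=> Cf; have [K hK] := P_step 2 (P_step 1 (P_step 0 P1)) t Cf.
exists K => k; have [] := hK k; rewrite !normrM normr1 mul1r.
have pos (x : R) : 0 < 1 + x ^+ 2 by rewrite ltr_pwDl ?sqr_ge0.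
rewrite !(gtr0_norm (pos _)) /decay -!invfM => h1 h2.
by split; rewrite ler_pdivlMr ?mulr_gt0 // mulrC.
Qed.

Lemma norm_sub_cos (a b : R) : `|cos a - cos b| <= `|a - b|.
Proof.
wlog ab : a b / b <= a => [H|].
  by case: (leP b a) => [|/ltW] /H //; rewrite distrC [X in _ <= X]distrC.
have [|c _ ->] := MVT_segment ab (fun x _ => is_derive_cos x).
  by apply: continuous_subspaceT => x; exact: continuous_cos.
by rewrite normrM normrN ler_piMl //; exact: sin_max.
Qed.

Lemma norm_sub_sin (a b : R) : `|sin a - sin b| <= `|a - b|.
Proof.
have -> : a - b = (a - pi / 2) - (b - pi / 2) by ring.
by rewrite -!cosBpihalf; exact: norm_sub_cos.
Qed.

Lemma norm_dot_le (k x : V) M : (forall i, `|x i 0| <= M) ->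
  `|dot k x| <= M * (`|k 0 0| + `|k 1 0| + `|k 2 0|).
Proof.
move=> xM; rewrite /dot big_ord3 !mulrDr.
have h i : `|k i 0 * x i 0| <= M * `|k i 0|.
  by rewrite normrM mulrC ler_wpM2r.
by rewrite (le_trans (ler_normD _ _)) // lerD // (le_trans (ler_normD _ _)) // lerD.
Qed.

(** As [F] is 1-Lipschitz and the support of [f] bounded, the transform varies by at most a multiple
    of the displacement of [k]. The cases [cos] and [sin] are treated together. *)
Let continuous_transform (F : R -> R) (f : V -> R) : Cc f ->
  (forall a, `|F a| <= 1) -> (forall a b, `|F a - F b| <= `|a - b|) ->
  (forall k, Cc (fun x => F (dot k x) * f x)) ->
  continuous (fun k => int3 (fun x => F (dot k x) * f x)).
Proof.
move=> Cf F1 Flip CF k0; have [_ [M HM]] := Cf.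
have M0 : 0 <= M by apply: le_trans (HM 0).1; exact: normr_ge0.
pose d i (k : V) := `|k i 0 - k0 i 0|.
pose C := int3 (fun x => `|f x|).
have C0 : 0 <= C by apply: int3_ge0 => x; exact: normr_ge0.
have ifn := integrable3_norm (integrable3_Cc Cf).
have bound k : `|int3 (fun x => F (dot k0 x) * f x) - int3 (fun x => F (dot k x) * f x)|
    <= M * (d 0 k + d 1 k + d 2 k) * C.
  rewrite -int3B; try exact: integrable3_Cc.
  rewrite /C -int3Z //; apply: le_norm_int3.
  - by apply: integrable3B; exact: integrable3_Cc.
  - exact: integrable3Z.
  - move=> x; rewrite -mulrBl normrM; have [_ xM] := HM x.
    have [->|/xM {}xM] := eqVneq (f x) 0; first by rewrite normr0 !mulr0.
    apply: ler_pM => //; apply: le_trans (Flip _ _) _.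
    have -> : dot k0 x - dot k x = - dot (k - k0) x.
      by rewrite /dot !big_ord3 !mxE; ring.
    by rewrite normrN (le_trans (norm_dot_le _ xM)) // !mxE.
have dlim i : d i k @[k --> k0] --> 0.
  have c0 : `|s - k0 i 0| @[s --> k0 i 0] --> 0.
    rewrite -[X in _ --> X](_ : `|k0 i 0 - k0 i 0| = 0); last by rewrite subrr normr0.
    by apply: cvg_norm; apply: cvgB; [exact: cvg_id|exact: cvg_cst].
  have ci : k i 0 @[k --> k0] --> k0 i 0 by exact: coord_continuous.
  exact: (cvg_comp _ _ ci c0).
have lim : M * (d 0 k + d 1 k + d 2 k) * C @[k --> k0] --> 0.
  rewrite -[X in _ --> X](_ : M * (0 + 0 + 0) * C = 0); last by ring.
  exact: (cvgM (cvgM (cvg_cst M) (cvgD (cvgD (dlim 0) (dlim 1)) (dlim 2))) (cvg_cst C)).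
apply/(@cvgrPdist_lt R R^o V (nbhs k0) (nbhs_filter k0)) => e e0.
have H : \forall k \near k0, `|0 - M * (d 0 k + d 1 k + d 2 k) * C| < e.
  exact: ((@cvgrPdist_lt R R^o V (nbhs k0) (nbhs_filter k0) _ _).1 lim e e0).
near=> k; apply: le_lt_trans (bound k) _; apply: le_lt_trans (ler_norm _) _.
by rewrite -normrN -sub0r; near: k.
Unshelve. all: by end_near.
Qed.

Lemma continuous_cosT f : Cc f -> continuous (cosT f).
Proof.
move=> Cf; apply: continuous_transform => // [a|a b|k].
- exact: cos_max.
- exact: norm_sub_cos.
- exact: Cc_cos.
Qed.

Lemma continuous_sinT f : Cc f -> continuous (sinT f).
Proof.
move=> Cf; apply: continuous_transform => // [a|a b|k].
- exact: sin_max.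
- exact: norm_sub_sin.
- exact: Cc_sin.
Qed.

End Transforms.

(** * Injectivity of the transforms *)

Section Uniqueness.
Context {R : realType}.
Local Notation V := 'cV[R]_3.

(** The phase [a] covers sines, and the product-to-sum formula then makes the class an algebra
    without a constructor for products. *)
Inductive trigpoly : (V -> R) -> Prop :=
| trigpoly_cos x a : trigpoly (fun k => cos (dot x k + a))
| trigpoly_add u v : trigpoly u -> trigpoly v -> trigpoly (fun k => u k + v k)
| trigpoly_scale c u : trigpoly u -> trigpoly (fun k => c * u k).

Lemma trigpoly_ext u v : u =1 v -> trigpoly u -> trigpoly v.
Proof. by move=> /funext ->. Qed.

Lemma dotDl (x y k : V) : dot (x + y) k = dot x k + dot y k.
Proof. by rewrite dotC dotDr !(dotC k). Qed.

Lemma dotNl (x k : V) : dot (- x) k = - dot x k.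
Proof. by rewrite dotC dotNr !(dotC k). Qed.

Lemma dot0l (k : V) : dot 0 k = 0.
Proof. by rewrite /dot big1 // => i _; rewrite mxE mul0r. Qed.

Lemma trigpoly_mul u v : trigpoly u -> trigpoly v -> trigpoly (fun k => u k * v k).
Proof.
move=> tu; elim: tu v => [x a|u1 u2 _ IH1 _ IH2|c u1 _ IH] v.
- elim=> [y b|u1 u2 _ IH1 _ IH2|c u1 _ IH].
  + apply: trigpoly_ext (trigpoly_scale 2^-1 (trigpoly_add (trigpoly_cos (x + y) (a + b))
      (trigpoly_cos (x + - y) (a - b)))) => k.
    rewrite !dotDl dotNl.
    have -> : dot x k + dot y k + (a + b) = (dot x k + a) + (dot y k + b) by ring.
    have -> : dot x k - dot y k + (a - b) = (dot x k + a) - (dot y k + b) by ring.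
    by rewrite cosD cosB; field.
  + by apply: trigpoly_ext (trigpoly_add IH1 IH2) => k; rewrite mulrDr.
  + by apply: trigpoly_ext (trigpoly_scale c IH) => k; rewrite mulrCA.
- by move=> tv; apply: trigpoly_ext (trigpoly_add (IH1 _ tv) (IH2 _ tv)) => k; rewrite mulrDl.
- by move=> tv; apply: trigpoly_ext (trigpoly_scale c (IH _ tv)) => k; rewrite mulrA.
Qed.

Lemma trigpoly_cst c : trigpoly (fun=> c).
Proof.
apply: trigpoly_ext (trigpoly_scale c (trigpoly_cos 0 0)) => k.
by rewrite dot0l addr0 cos0 mulr1.
Qed.

Lemma trigpoly_sin x a : trigpoly (fun k => sin (dot x k + a)).
Proof.
by apply: trigpoly_ext (trigpoly_cos x (a - pi / 2)) => k; rewrite addrA cosBpihalf.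
Qed.

Lemma trigpoly_exp u n : trigpoly u -> trigpoly (fun k => u k ^+ n).
Proof.
move=> tu; elim: n => [|n IH]; first exact: trigpoly_cst.
by apply: trigpoly_ext (trigpoly_mul tu IH) => k; rewrite exprS.
Qed.

Lemma trigpoly_continuous u : trigpoly u -> continuous u.
Proof.
elim=> [x a|u1 u2 _ c1 _ c2|c u1 _ c1] k.
- apply: (@continuous_comp _ _ _ (dot x) (fun s => cos (s + a))); first exact: continuous_dot.
  apply: (@continuous_comp _ _ _ (fun s => s + a) cos); last exact: continuous_cos.
  by apply: cvgD; [exact: cvg_id|exact: cvg_cst].
- exact: (cvgD (c1 k) (c2 k)).
- exact: (cvgM (cvg_cst c) (c1 k)).
Qed.

Lemma trigpoly_bounded u : trigpoly u -> exists K, forall k, `|u k| <= K.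
Proof.
elim=> [x a|u1 u2 _ [K1 h1] _ [K2 h2]|c u1 _ [K1 h1]].
- by exists 1 => k; exact: cos_max.
- by exists (K1 + K2) => k; apply: le_trans (ler_normD _ _) _; exact: lerD.
- by exists (`|c| * K1) => k; rewrite normrM ler_wpM2l.
Qed.

Lemma series_exp_coeff_le (x : R) n : `|series (exp_coeff x) n| <= expR `|x|.
Proof.
apply: (@le_trans _ _ (series (exp_coeff `|x|) n)).
  rewrite /series /= (le_trans (ler_norm_sum _ _ _)) // ler_sum // => i _.
  by rewrite /exp_coeff /= normrM normrX normrV ?unitfE ?pnatr_eq0 -?lt0n ?fact_gt0 // normr_nat.
rewrite /expR; apply: nondecreasing_cvgn_le; last exact: is_cvg_series_exp_coeff.
by apply: nondecreasing_series => i _ _; exact: exp_coeff_ge0.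
Qed.

Lemma continuous_cos_dotl (x : V) : continuous (fun k : V => cos (dot k x)).
Proof. by under eq_fun do rewrite dotC; exact: continuous_cos_dot. Qed.

Lemma continuous_sin_dotl (x : V) : continuous (fun k : V => sin (dot k x)).
Proof. by under eq_fun do rewrite dotC; exact: continuous_sin_dot. Qed.

Section Annihilator.
Variable H : V -> R.
Hypothesis cH : continuous H.
Hypothesis iH : integrable3 H.
Hypothesis cosH : forall x, int3 (fun k => cos (dot k x) * H k) = 0.
Hypothesis sinH : forall x, int3 (fun k => sin (dot k x) * H k) = 0.

Let integrable3M (u : V -> R) (K : R) : continuous u -> (forall k, `|u k| <= K) ->
  integrable3 (fun k => u k * H k).
Proof.
move=> cu uK.
have c : continuous (fun k : V => u k * H k) by move=> k; exact: (continuousM (cu k) (@cH k)).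
apply: (integrable3_le c _ (integrable3Z K (integrable3_norm iH))).
by move=> k; rewrite normrM ler_wpM2r.
Qed.

Lemma int3_trigpoly u : trigpoly u -> int3 (fun k => u k * H k) = 0.
Proof.
elim=> [x a|u1 u2 t1 e1 t2 e2|c u1 t1 e1].
- under eq_fun do rewrite cosD mulrBl ![_ * cos a]mulrC ![_ * sin a]mulrC -!mulrA !(dotC x).
  have i1 := integrable3M (@continuous_cos_dotl x) (fun k => cos_max _).
  have i2 := integrable3M (@continuous_sin_dotl x) (fun k => sin_max _).
  rewrite int3B; try exact: (integrable3Z _ i1); try exact: (integrable3Z _ i2).
  by rewrite !int3Z // cosH sinH !mulr0 subrr.
- have [K1 h1] := trigpoly_bounded t1; have [K2 h2] := trigpoly_bounded t2.
  under eq_fun do rewrite mulrDl.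
  rewrite int3D ?e1 ?e2 ?addr0 //.
    exact: (integrable3M (trigpoly_continuous t1) h1).
  exact: (integrable3M (trigpoly_continuous t2) h2).
- have [K1 h1] := trigpoly_bounded t1.
  under eq_fun do rewrite -mulrA.
  rewrite int3Z ?e1 ?mulr0 //.
  exact: (integrable3M (trigpoly_continuous t1) h1).
Qed.

Let int3_limit (u_ : nat -> V -> R) (u : V -> R) (K : R) : (forall n, continuous (u_ n)) ->
  (forall n k, `|u_ n k| <= K) -> (forall k, u_ n k @[n --> \oo] --> u k) ->
  (forall n, int3 (fun k => u_ n k * H k) = 0) -> int3 (fun k => u k * H k) = 0.
Proof.
move=> cu uK ul u0.
have : int3 (fun k => u_ n k * H k) @[n --> \oo] --> int3 (fun k => u k * H k).
  apply: (@cvg_int3 _ (fun n k => u_ n k * H k) _ (fun k => K * `|H k|)).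
  - by move=> n k; exact: (continuousM (cu n k) (@cH k)).
  - by move=> k; apply: cvgM; [exact: ul|exact: cvg_cst].
  - exact: (integrable3Z _ (integrable3_norm iH)).
  - by move=> n k; rewrite normrM ler_wpM2r.
under eq_cvg do rewrite u0.
by move=> /(cvg_lim (@Rhausdorff R)) <-; rewrite lim_cst.
Qed.

(** The partial sums of the exponential series are again trigonometric polynomials, and they are
    bounded by [expR K]. *)
Lemma int3_expR_trigpoly u : trigpoly u -> int3 (fun k => expR (u k) * H k) = 0.
Proof.
move=> tu; have [K uK] := trigpoly_bounded tu.
have ts n : trigpoly (fun k => series (exp_coeff (u k)) n).
  elim: n => [|n IH].
    by apply: trigpoly_ext (trigpoly_cst 0) => k; rewrite /series /= big_geq.
  apply: trigpoly_ext (trigpoly_add IH (trigpoly_scale (n`!%:R^-1) (trigpoly_exp n tu))) => k.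
  by rewrite seriesSr /exp_coeff /= [_^-1 * _]mulrC.
apply: (@int3_limit (fun n k => series (exp_coeff (u k)) n) _ (expR K)).
- by move=> n; exact: trigpoly_continuous.
- by move=> n k; rewrite (le_trans (series_exp_coeff_le _ _)) // ler_expR.
- by move=> k; rewrite /expR; exact: is_cvg_series_exp_coeff.
- by move=> n; exact: int3_trigpoly.
Qed.

Let sq (k0 k : V) := \sum_(i < 3) (k i 0 - k0 i 0) ^+ 2.

Lemma cvg_sin_harmonic (a : R) : n.+1%:R * sin (n.+1%:R^-1 * a) @[n --> \oo] --> a.
Proof.
have [d1 d2] : is_derive (0 : R) (1 : R) (fun s : R => sin (s * a)) a.
  have : is_derive (0 : R) (1 : R) (sin \o (fun s : R => s * a)) (a * cos (0 * a)).
    apply: is_derive_precomp => // h.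
    by rewrite addr0 mul0r addr0 /GRing.scale /= mulr1.
  by rewrite mul0r cos0 mulr1.
pose q (s : R) := s^-1 *: (sin ((s *: (1 : R) + 0) * a) - sin (0 * a)).
have qa : q s @[s --> 0^'] --> a by rewrite -d2; exact: d1.
have -> : (fun n => n.+1%:R * sin (n.+1%:R^-1 * a)) = q \o (fun n => n.+1%:R^-1).
  apply/funext => n; rewrite /q /= addr0 mul0r sin0 subr0 invrK.
  by rewrite /GRing.scale /= mulr1.
exact: (cvg_comp _ _ cvg_harmonic_dnbhs qa).
Qed.

(* [n sin (x_i / n)] is a trigonometric polynomial tending to [x_i], so the
   Gaussian is a bounded limit of functions already known to annihilate [H]. *)
Lemma int3_gaussian (N : R) k0 : 0 <= N ->
  int3 (fun k => expR (- (N * sq k0 k)) * H k) = 0.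
Proof.
move=> N0.
pose s n i (k : V) := n.+1%:R * sin (n.+1%:R^-1 * (k i 0 - k0 i 0)).
have ts n i : trigpoly (s n i).
  apply: trigpoly_ext (trigpoly_scale n.+1%:R (trigpoly_sin (n.+1%:R^-1 *: delta_mx i 0)
    (- (n.+1%:R^-1 * k0 i 0)))) => k.
  by rewrite /s dotC dotZr dot_delta mulrBr.
pose u n (k : V) := - (N * (s n 0 k ^+ 2 + s n 1 k ^+ 2 + s n 2 k ^+ 2)).
have tu n : trigpoly (u n).
  apply: trigpoly_ext (trigpoly_scale (- N) (trigpoly_add (trigpoly_add
    (trigpoly_exp 2 (ts n 0)) (trigpoly_exp 2 (ts n 1))) (trigpoly_exp 2 (ts n 2)))) => k.
  by rewrite /u mulNr.
apply: (@int3_limit (fun n k => expR (u n k)) _ 1).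
- move=> n k; apply: (@continuous_comp _ _ _ (u n) expR); last exact: continuous_expR.
  exact: trigpoly_continuous.
- move=> n k; rewrite ger0_norm ?expR_ge0 // expR_le1 // oppr_le0 mulr_ge0 //.
  by rewrite !addr_ge0 ?sqr_ge0.
- move=> k.
  have sl i : s n i k ^+ 2 @[n --> \oo] --> (k i 0 - k0 i 0) ^+ 2.
    by under eq_cvg do rewrite expr2; rewrite expr2; apply: cvgM; exact: cvg_sin_harmonic.
  have ul : u n k @[n --> \oo] --> - (N * sq k0 k).
    apply: cvgN; apply: cvgM; first exact: cvg_cst.
    by rewrite /sq big_ord3; apply: cvgD; [apply: cvgD|]; exact: sl.
  exact: (cvg_comp _ _ ul (@continuous_expR R _)).
- by move=> n; exact: int3_expR_trigpoly.
Qed.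

(** If [H] exceeds [c > 0] near [k0], integrate it against the Gaussian
    [w = exp (n (r^2 - |k - k0|^2))]. The result is zero, yet [w] is at most 1 away from [k0] and
    exponentially large in [n] close to it, which no finite integral of [|H|] can compensate. *)
Lemma annihilated_le0 k0 : H k0 <= 0.
Proof.
rewrite leNgt; apply/negP => Hk0; pose c := H k0 / 2.
have c0 : 0 < c by rewrite divr_gt0.
have : \forall k \near k0, c < H k.
  have cH0 := @cH k0.
  apply: (@cvgr_gt _ _ (nbhs k0) (nbhs_filter k0) _ _ cH0).
  by rewrite /c; lra.
move=> /nbhs_ballP[r /= r0 Hr].
have r2 : 0 < r ^+ 2 / 4 by rewrite divr_gt0 // exprn_gt0.
have ball3 (e : R) (k : V) : 0 < e -> (forall i, `|k i 0 - k0 i 0| < e) -> ball k0 e k.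
  by move=> e0 h; split => // i j; rewrite (ord1 j) /ball /= distrC.
have key (n : nat) : c * expR (n%:R * (r ^+ 2 / 4)) * (r / 2 *+ 2) ^+ 3 <= int3 (fun k => `|H k|).
  pose w (k : V) := expR (n%:R * (r ^+ 2 - sq k0 k)).
  have we k : w k = expR (n%:R * r ^+ 2) * expR (- (n%:R * sq k0 k)).
    by rewrite -expRD /w mulrBr.
  have csq : continuous (sq k0).
    apply: continuous_big => [|i _ k]; first exact: add_continuous.
    apply: (@continuous_comp _ _ _ (fun k : V => k i 0) (fun s : R => (s - k0 i 0) ^+ 2)).
      exact: coord_continuous.
    apply: (@continuous_comp _ _ _ (fun s : R => s - k0 i 0) (fun s : R => s ^+ 2)).
      by apply: cvgB; [exact: cvg_id|exact: cvg_cst].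
    exact: exprn_continuous.
  have sq0 k : 0 <= sq k0 k by apply: sumr_ge0 => i _; exact: sqr_ge0.
  have cg : continuous (fun k : V => expR (- (n%:R * sq k0 k))).
    move=> k; apply: (@continuous_comp _ _ _ (sq k0) (fun s : R => expR (- (n%:R * s)))).
      exact: csq.
    apply: (@continuous_comp _ _ _ (fun s : R => - (n%:R * s)) expR); last exact: continuous_expR.
    by apply: cvgN; apply: cvgM; [exact: cvg_cst|exact: cvg_id].
  have ig : integrable3 (fun k => expR (- (n%:R * sq k0 k)) * H k).
    apply: (@integrable3M _ 1) => // k.
    by rewrite ger0_norm ?expR_ge0 // expR_le1 // oppr_le0 mulr_ge0.
  have iw : integrable3 (fun k => w k * H k).
    have := integrable3Z (expR (n%:R * r ^+ 2)) ig; congr integrable3.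
    by apply/funext => k; rewrite we mulrA.
  have ew : int3 (fun k => w k * H k) = 0.
    under eq_fun do rewrite we -mulrA.
    by rewrite int3Z // int3_gaussian // mulr0.
  (* Adding the absolute value makes the integrand nonnegative everywhere: where [w > 1] the
     function [H] is positive, elsewhere [w |H|] is at most [|H|]. *)
  have <- : int3 (fun k => w k * H k + `|H k|) = int3 (fun k => `|H k|).
    by rewrite int3D ?ew ?add0r //; exact: integrable3_norm.
  apply: (@le_int3_ball _ _ k0); rewrite ?divr_gt0 //.
  - by rewrite mulr_ge0 ?expR_ge0 // ltW.
  - by apply: integrable3D => //; exact: integrable3_norm.
  - move=> k; have [kr|kr] := leP (r ^+ 2) (sq k0 k).
      have w1 : w k <= 1 by rewrite expR_le1 // mulr_ge0_le0 // subr_le0.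
      have := ler_norm (- (w k * H k)); rewrite normrN normrM ger0_norm ?expR_ge0 // => h.
      have h3 : w k * `|H k| <= `|H k| by rewrite ler_piMl.
      by move: (le_trans h h3); rewrite -subr_ge0 opprK addrC.
    have Hk : c < H k.
      apply: Hr; apply: ball3 => // i.
      have : `|k i 0 - k0 i 0| ^+ 2 < r ^+ 2.
        apply: (le_lt_trans _ kr); rewrite real_normK ?num_real // /sq (bigD1 i) //=.
        by rewrite lerDl sumr_ge0 // => j _; exact: sqr_ge0.
      by rewrite ltr_pXn2r // nnegrE ltW.
    by rewrite addr_ge0 // mulr_ge0 ?expR_ge0 // ltW // (lt_trans c0).
  - move=> k [_ kb].
    have kb' i : `|k i 0 - k0 i 0| < r / 2 by have := kb i 0; rewrite /ball /= distrC.
    have Hk : c < H k.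
      by apply: Hr; apply: ball3 => // i; apply: lt_trans (kb' i) _; lra.
    apply: (@le_trans _ _ (w k * H k)); last by rewrite lerDl.
    (* On the cube of half-side [r / 2] the squared distance is at most [3 r^2 / 4], which leaves
       [r^2 / 4] in the exponent. *)
    have ki i : (k i 0 - k0 i 0) ^+ 2 <= (r / 2) ^+ 2.
      have : `|k i 0 - k0 i 0| ^+ 2 <= (r / 2) ^+ 2.
        by rewrite ler_pXn2r ?nnegrE ?(ltW (kb' i)) // ltW // divr_gt0.
      by rewrite real_normK // num_real.
    rewrite [leLHS]mulrC; apply: ler_pM; rewrite ?expR_ge0 ?(ltW c0) ?(ltW Hk) //.
    rewrite /w ler_expR ler_wpM2l //.
    have := ki 0; have := ki 1; have := ki 2; rewrite /sq big_ord3; lra.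
pose C := int3 (fun k => `|H k|).
pose d := c * (r / 2 *+ 2) ^+ 3.
have d0 : 0 < d by rewrite mulr_gt0 // exprn_gt0 // pmulrn_lgt0 // divr_gt0.
(* Chosen so that [(n + 1) r^2 / 4] exceeds [C / d]; the exponential of it is larger still. *)
pose n := Num.truncn (C / d / (r ^+ 2 / 4)).
have h1 : C / d / (r ^+ 2 / 4) < n.+1%:R by exact: truncnS_gt.
have := key n.+1; rewrite -/C mulrAC -/d leNgt => /negP; apply.
have h2 : n.+1%:R * (r ^+ 2 / 4) < expR (n.+1%:R * (r ^+ 2 / 4)).
  by apply: lt_le_trans (expR_ge1Dx _); rewrite ltrDr.
rewrite mulrC -ltr_pdivrMr //; apply: lt_trans h2.
by rewrite -ltr_pdivrMr.
Qed.

End Annihilator.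

Lemma transform_injective (H : V -> R) : continuous H -> integrable3 H ->
  (forall x, int3 (fun k => cos (dot k x) * H k) = 0) ->
  (forall x, int3 (fun k => sin (dot k x) * H k) = 0) -> forall k, H k = 0.
Proof.
move=> cH iH c0 s0 k; apply/eqP; rewrite eq_le annihilated_le0 //=.
rewrite -oppr_le0; apply: (@annihilated_le0 (fun k => - H k)).
- move=> x; apply: (@continuous_comp _ _ _ H (@GRing.opp R)); first exact: cH.
  exact: opp_continuous.
- by have := integrable3Z (-1) iH; congr integrable3; apply/funext => x; rewrite mulN1r.
- move=> x; rewrite -[RHS](mulr0 (-1)) -(c0 x) -int3Z.
    by congr int3; apply/funext => y; ring.
  have c : continuous (fun k : V => cos (dot k x) * H k).
    by move=> y; exact: (continuousM (@continuous_cos_dotl x y) (cH y)).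
  apply: (integrable3_le c _ (integrable3_norm iH)).
  by move=> y; rewrite normrM ler_piMl // cos_max.
- move=> x; rewrite -[RHS](mulr0 (-1)) -(s0 x) -int3Z.
    by congr int3; apply/funext => y; ring.
  have c : continuous (fun k : V => sin (dot k x) * H k).
    by move=> y; exact: (continuousM (@continuous_sin_dotl x y) (cH y)).
  apply: (integrable3_le c _ (integrable3_norm iH)).
  by move=> y; rewrite normrM ler_piMl // sin_max.
Qed.

End Uniqueness.

(** * Functions flat at the origin *)

Section Flat.
Context {R : realType}.

Lemma is_derive1_comp (f g : R -> R) (x df dg : R) :
  is_derive x (1 : R) f df -> is_derive (f x) (1 : R) g dg ->
  is_derive x (1 : R) (g \o f) (dg * df).
Proof.
move=> [f1 f2] [g1 g2].
have dF := (derivable1_diffP f x).1 f1.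
have dG := (derivable1_diffP g (f x)).1 g1.
have dGF : differentiable (g \o f) x by exact: differentiable_comp.
split; first exact/derivable1_diffP.
by rewrite -derive1E (derive1_comp f1 g1) derive1E g2 derive1E f2.
Qed.

Lemma exp_bounds_monomial (n : nat) (y : R) : 0 <= y -> y ^+ n * expR (- y) <= n`!%:R.
Proof.
move=> y0; rewrite expRN ler_pdivrMr ?expR_gt0 // -ler_pdivrMl ?ltr0n ?fact_gt0 //.
apply: (@le_trans _ _ (series (exp_coeff y) n.+1)).
  rewrite seriesSr /exp_coeff /= mulrC lerDr.
  by apply: sumr_ge0 => i _; exact: exp_coeff_ge0.
by apply: le_trans (ler_norm _) _; rewrite (le_trans (series_exp_coeff_le _ _)) // ger0_norm.
Qed.

Lemma exp_bounds_poly (p : {poly R}) n : exists K, forall y, 0 <= y ->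
  `|y ^+ n * p.[y] * expR (- y)| <= K.
Proof.
elim/poly_ind: p n => [|p c IH] n.
  by exists 0 => y _; rewrite horner0 mulr0 mul0r normr0.
have [K hK] := IH n.+1; exists (K + `|c| * n`!%:R) => y y0.
have -> : y ^+ n * (p * 'X + c%:P).[y] * expR (- y) =
    y ^+ n.+1 * p.[y] * expR (- y) + c * (y ^+ n * expR (- y)).
  by rewrite hornerMXaddC exprS; ring.
apply: le_trans (ler_normD _ _) _; apply: lerD; first exact: hK.
rewrite normrM ler_wpM2l // ger0_norm ?exp_bounds_monomial //.
by rewrite mulr_ge0 ?exprn_ge0 ?expR_ge0.
Qed.

(** The classical [exp (-1/x)], with a polynomial factor in [1/x] so that the family is closed under
    differentiation. *)
Definition flat (p : {poly R}) (x : R) : R :=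
  if 0 < x then p.[x^-1] * expR (- x^-1) else 0.

(** With [y = 1/x] one has [dy/dx = - y^2], so [p(y) exp (- y)] has derivative
    [y^2 (p(y) - p'(y)) exp (- y)]. *)
Definition flat_deriv (p : {poly R}) : {poly R} := 'X ^+ 2 * (p - p^`()).

Lemma is_derive_flat p (x : R) : is_derive x (1 : R) (flat p) (flat (flat_deriv p) x).
Proof.
case: (ltgtP 0 x) => [x0|x0|<-].
- have nr : \near x, (fun y => p.[y^-1] * expR (- y^-1)) x = flat p x.
    near=> y; rewrite /flat ifT //; near: y; exact: lt_nbhsr.
  apply: (near_eq_is_derive nr).
  have dinv : is_derive x (1 : R) (fun y : R => y^-1) (- x ^- 2).
    split; first by apply: derivableV; rewrite ?gt_eqF.
    by rewrite deriveV ?gt_eqF // derive_id /GRing.scale /= mulr1.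
  have dp : is_derive x (1 : R) (fun y => p.[y^-1]) (p^`().[x^-1] * - x ^- 2).
    exact: (is_derive1_comp dinv (is_derive_poly p x^-1)).
  have de : is_derive x (1 : R) (fun y => expR (- y^-1)) (expR (- x^-1) * x ^- 2).
    apply: (@is_derive1_comp (fun y => - y^-1) expR).
    by have := is_deriveN dinv; rewrite opprK.
  have := is_deriveM dp de.
  rewrite /flat x0 /flat_deriv !hornerE /GRing.scale /= => H.
  apply: (is_derive_eq H).
  by rewrite -exprVn; ring.
- have nr : \near x, cst 0 x = flat p x.
    near=> y; rewrite /flat ifF //; apply/negbTE; rewrite -leNgt ltW //.
    near: y; exact: lt_nbhsl.
  apply: (near_eq_is_derive nr).
  by rewrite /flat ltNge (ltW x0) /=; exact: is_derive_cst.
(* The exponent 2 gives [|flat p h| <= K h^2] for [h > 0], so the difference quotient at 0 is at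
   most [K |h|]. *)
- have [K hK] := exp_bounds_poly p 2.
  have K0 : 0 <= K by apply: le_trans (hK 0 (lexx 0)); exact: normr_ge0.
  have n0 : `|h| @[h --> (0:R)^'] --> (0 : R).
    have c : `|h| @[h --> (0:R)] --> (0 : R).
      by have := @norm_continuous R R^o 0; rewrite /continuous_at normr0; exact.
    exact: cvg_within_filter c.
  have n1 : K * `|h| @[h --> (0:R)^'] --> (0 : R).
    by rewrite -[X in _ --> X](mulr0 K); exact: (cvgM (cvg_cst K) n0).
  have lim : h^-1 *: ((flat p \o shift 0) (h *: (1 : R)) - flat p 0) @[h --> 0^'] --> 0.
    apply: (@squeeze_cvgr _ _ _ _ (fun h : R => - (K * `|h|)) (fun h => K * `|h|)).
    + near=> h; rewrite -ler_norml /flat ltxx subr0 /= addr0 /GRing.scale /= mulr1.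
      case: ifP => [h0|_]; last by rewrite mulr0 normr0 mulr_ge0.
      have := hK h^-1; rewrite invr_ge0 (ltW h0) => /(_ isT).
      have -> : h^-1 ^+ 2 * p.[h^-1] * expR (- h^-1) = h^-1 * (h^-1 * (p.[h^-1] * expR (- h^-1))).
        by ring.
      rewrite normrM [X in X * _ <= _]gtr0_norm ?invr_gt0 // ler_pdivrMl // => H.
      by rewrite (gtr0_norm h0) [K * _]mulrC.
    + by rewrite -[X in _ --> X]oppr0; exact: (cvgN n1).
    + exact: n1.
  rewrite /flat ltxx; split.
    by apply/cvg_ex; exists 0.
  exact: cvg_lim.
Unshelve. all: by end_near. Qed.

Lemma continuous_flat p : continuous (flat p).
Proof.
move=> x; have [d _] := is_derive_flat p x.
exact/differentiable_continuous/derivable1_diffP.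
Qed.

End Flat.

(** * A nonnegative test function *)

Section Bump.
Context {R : realType}.
Local Notation V := 'cV[R]_3.
Local Notation ST := (R * V)%type.

(* [l] is affine with linear part [L]. *)
Inductive flatpoly : (ST -> R) -> Prop :=
| flatpoly_flat p (l L : ST -> R) : continuous l ->
    (forall q v (h : R), l (h *: v + q) = h * L v + l q) ->
    flatpoly (fun q => flat p (l q))
| flatpoly_cst c : flatpoly (fun=> c)
| flatpoly_add f g : flatpoly f -> flatpoly g -> flatpoly (fun q => f q + g q)
| flatpoly_mul f g : flatpoly f -> flatpoly g -> flatpoly (fun q => f q * g q).

Lemma flatpoly_derive f : flatpoly f -> [/\ continuous f, forall v p, derivable f p v &
  forall v, flatpoly (fun p => 'D_v f p)].
Proof.
elim=> [p l L cl hl|c|{}f g _ [cf df If] _ [cg dg Ig]|{}f g Ff [cf df If] Fg [cg dg Ig]].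
- have d q v : is_derive q v (fun q => flat p (l q)) (L v * flat (flat_deriv p) (l q)).
    exact: (is_derive_precomp (fun h => hl q v h) (is_derive_flat p (l q))).
  split.
  + move=> q; apply: (@continuous_comp _ _ _ l (flat p)); first exact: cl.
    exact: continuous_flat.
  + by move=> v q; have [] := d q v.
  + move=> v; rewrite (_ : (fun q => _) = fun q => L v * flat (flat_deriv p) (l q)).
      apply: flatpoly_mul; first exact: flatpoly_cst.
      exact: flatpoly_flat cl hl.
    by apply/funext => q; have [] := d q v.
- split; first exact: cst_continuous.
    by move=> v p; exact: derivable_cst.
  move=> v; have -> : (fun p => 'D_v (fun=> c) p) = (fun=> 0) :> (ST -> R).
    by apply/funext => q; exact: derive_cst.
  exact: flatpoly_cst.
- split.
  + by move=> q; exact: (continuousD (cf q) (cg q)).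
  + by move=> v p; exact: derivableD.
  + move=> v; have -> : (fun p => 'D_v (fun q => f q + g q) p) =
      (fun p => 'D_v f p + 'D_v g p) by apply/funext => q; exact: deriveD.
    exact: flatpoly_add.
- split.
  + by move=> q; exact: (continuousM (cf q) (cg q)).
  + by move=> v p; exact: derivableM.
  + move=> v; have -> : (fun p => 'D_v (fun q => f q * g q) p) =
      (fun p => f p * 'D_v g p + g p * 'D_v f p) by apply/funext => q; exact: deriveM.
    by apply: flatpoly_add; apply: flatpoly_mul.
Qed.

Lemma smooth_flatpoly f : flatpoly f -> smooth f.
Proof. exact: (smooth_coind flatpoly_derive). Qed.

Definition tent (a b s : R) : R := flat 1 (a + b * s).

(** A product of one-sided cut-offs [exp (-1/(a + b s))], supported in times from 1 to 3, hence
    inside the domain, and in the cube [[-1, 1]^3]. It is positive at time 2 over the origin, and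
    the slice at time 2 is the one used later. *)
Definition bump (q : ST) : R :=
  tent (-1) 1 q.1 * tent 3 (-1) q.1 *
  (tent 1 (-1) (q.2 0 0) * tent 1 1 (q.2 0 0)) *
  (tent 1 (-1) (q.2 1 0) * tent 1 1 (q.2 1 0)) *
  (tent 1 (-1) (q.2 2 0) * tent 1 1 (q.2 2 0)).

Lemma flatpoly_tent (m : ST -> R) (a b : R) : continuous m ->
  (forall q v (h : R), m (h *: v + q) = h * m v + m q) ->
  flatpoly (fun q => tent a b (m q)).
Proof.
move=> cm hm; apply: (@flatpoly_flat 1 (fun q => a + b * m q) (fun v => b * m v)).
  move=> q; apply: (@continuous_comp _ _ _ m (fun s : R => a + b * s)); first exact: cm.
  by apply: cvgD; [exact: cvg_cst|apply: cvgM; [exact: cvg_cst|exact: cvg_id]].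
by move=> q v h; rewrite hm; ring.
Qed.

Lemma flat1_ge0 (x : R) : 0 <= flat 1 x.
Proof. by rewrite /flat; case: ifP => // _; rewrite hornerC mul1r expR_ge0. Qed.

Lemma flat1_gt0 (x : R) : 0 < x -> 0 < flat 1 x.
Proof. by rewrite /flat => ->; rewrite hornerC mul1r expR_gt0. Qed.

Lemma flat_le0 p (x : R) : x <= 0 -> flat p x = 0.
Proof. by rewrite /flat leNgt => /negbTE ->. Qed.

Lemma bump_ge0 q : 0 <= bump q.
Proof. by rewrite !mulr_ge0 ?flat1_ge0. Qed.

Lemma bump_gt0 : 0 < bump (2, 0).
Proof. by rewrite !mulr_gt0 // /tent flat1_gt0 //= ?mxE ?mulr0 ?addr0 //; lra. Qed.

Lemma smooth_bump : smooth bump.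
Proof.
apply: smooth_flatpoly.
have c2 i : continuous (fun q : ST => q.2 i 0).
  move=> p; apply: (@continuous_comp _ _ _ snd (fun x : V => x i 0)).
    exact: cvg_snd.
  exact: coord_continuous.
have c1 : continuous (fun q : ST => q.1) by move=> q; exact: cvg_fst.
have a1 a b : flatpoly (fun q => tent a b q.1).
  exact: (@flatpoly_tent (fun q => q.1)).
have a3 i a b : flatpoly (fun q => tent a b (q.2 i 0)).
  by apply: (@flatpoly_tent (fun q => q.2 i 0)) => // q v h; rewrite /= !mxE.
have a4 i : flatpoly (fun q => tent 1 (-1) (q.2 i 0) * tent 1 1 (q.2 i 0)).
  exact: flatpoly_mul.
by apply: flatpoly_mul (a4 2); apply: flatpoly_mul (a4 1); apply: flatpoly_mul (a4 0);
  apply: flatpoly_mul.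
Qed.

Lemma compact_cube (M : R) : compact [set x : V | forall i, -M <= x i 0 <= M].
Proof.
have := @rV_compact R 3 (fun _ => [set` `[-M, M]]) (fun _ => @segment_compact R _ _).
have ct : continuous (trmx : 'rV[R]_3 -> V).
  apply: continuous_mx => i j; under eq_fun do rewrite mxE.
  exact: coord_continuous.
move=> /(@continuous_compact _ _ (trmx : 'rV[R]_3 -> V)) H.
have := H (continuous_subspaceT ct); congr compact.
apply/seteqP; split => [_ [x xM <-] i|x xM].
  by have := xM i; rewrite mxE /= in_itv.
by exists x^T; rewrite ?trmxK // => i; rewrite /= in_itv /= mxE.
Qed.

Lemma C0oo_bump : C0oo bump.
Proof.
pose B : set ST := [set` `[1, 3]] `*` [set x : V | forall i, -1 <= x i 0 <= 1].
have cB : compact B by apply: compact_setX; [exact: segment_compact|exact: compact_cube].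
have clB : closed B by apply: compact_closed => //; exact: norm_hausdorff.
have sB : supp bump `<=` B.
  rewrite [X in _ `<=` X](closure_id _).1 //; apply: closure_subset => -[t x] /=.
  rewrite /bump !mulf_eq0 !negb_or /= => h.
  have pos (a b y : R) : tent a b y != 0 -> 0 < a + b * y.
    by move=> fy; rewrite ltNge; apply/negP => /(flat_le0 1)/eqP; rewrite (negbTE fy).
  move: h => /andP[/andP[/andP[/andP[/pos t1 /pos t2] /andP[/pos x1 /pos x2]]
    /andP[/pos y1 /pos y2]] /andP[/pos z1 /pos z2]].
  split => /=; first by rewrite in_itv /=; apply/andP; split; lra.
  by elim/ord3_cases; apply/andP; split; lra.
split; first exact: smooth_bump.
- by apply: subclosed_compact cB sB; exact: closed_closure.
- move=> [t x] /sB [/= + _]; rewrite in_itv /= => /andP[t1 _].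
  by rewrite /Mdom /=; lra.
Qed.

End Bump.

(** * The multiplier and the real form of the operator *)

Section Multiplier.
Context {R : realType}.
Local Notation V := 'cV[R]_3.
Local Notation ST := (R * V)%type.

Lemma int3_odd (f : V -> R) : integrable3 f -> (forall x, f (- x) = - f x) -> int3 f = 0.
Proof.
move=> fi fN; have := int3_invariant f (@int_invariant_opp R).
have -> : f \o -%R = fun x => -1 * f x by apply/funext => x /=; rewrite fN mulN1r.
by rewrite int3Z // mulN1r => /eqP; rewrite eq_sym -addr_eq0 -mulr2n mulrn_eq0 /= => /eqP.
Qed.

Lemma integrable3_invariant (S : V -> V) (f : V -> R) : int_invariant S ->
  continuous (f \o S) -> integrable3 f -> integrable3 (f \o S).
Proof.
move=> iS cfS /integrableP[_ fi]; apply/integrableP; split.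
  by apply/measurable_EFinP; apply: (@continuous_measurable3 _ (f \o S)).
have := iS (fun x => `|(f x)%:E|%E) => /= ->; exact: fi.
Qed.

Lemma cosTN f (k : V) : cosT f (- k) = cosT f k.
Proof. by rewrite /cosT; congr int3; apply/funext => x; rewrite dotNl cosN. Qed.

Lemma sinTN f (k : V) : Cc f -> sinT f (- k) = - sinT f k.
Proof.
move=> Cf; rewrite /sinT -mulN1r -int3Z; last exact/integrable3_Cc/Cc_sin.
by congr int3; apply/funext => x; rewrite dotNl sinN mulN1r mulNr.
Qed.

Lemma cosh_ge1 (x : R) : 1 <= cosh x.
Proof.
rewrite /cosh expRN; set e := expR x; have e0 : 0 < e by exact: expR_gt0.
have -> : (e + e^-1) / 2 = 1 + (e - 1) ^+ 2 / (2 * e) by field; rewrite gt_eqF.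
by rewrite lerDl divr_ge0 ?sqr_ge0 // mulr_ge0 // ltW.
Qed.

Lemma coshN (x : R) : cosh (- x) = cosh x.
Proof. by rewrite /cosh opprK addrC. Qed.

Definition mult (lambda : R) (k : V) : R := cosh (3 * lambda * k 0 0) `^ (- 2^-1).

Lemma mult_ge0 lambda k : 0 <= mult lambda k.
Proof. exact: powR_ge0. Qed.

(** Squaring removes the fractional power and leaves only [cosh], which has an everywhere convergent
    power series. *)
Lemma mult_sqr lambda k : mult lambda k ^+ 2 * cosh (3 * lambda * k 0 0) = 1.
Proof.
have c0 : 0 < cosh (3 * lambda * k 0 0) by apply: lt_le_trans (cosh_ge1 _).
rewrite /mult -powR_mulrn ?powR_ge0 // -powRrM.
have -> : - 2^-1 * 2 = - 1 :> R by field.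
by rewrite powRN powRr1 ?ltW // mulVf // gt_eqF.
Qed.

Lemma mult_le1 lambda k : mult lambda k <= 1.
Proof.
rewrite -(@ler_pXn2r _ 2) ?nnegrE ?mult_ge0 // expr1n -(mult_sqr lambda k).
by rewrite ler_peMr ?sqr_ge0 // cosh_ge1.
Qed.

Lemma eq_mult lambda (k k' : V) : (k 0 0 = k' 0 0 \/ k 0 0 = - k' 0 0) ->
  mult lambda k = mult lambda k'.
Proof. by rewrite /mult => -[->//|->]; rewrite mulrN coshN. Qed.

Lemma multN lambda k : mult lambda (- k) = mult lambda k.
Proof. by apply: eq_mult; right; rewrite mxE. Qed.

Lemma continuous_mult lambda : continuous (mult lambda).
Proof.
move=> k; apply: (@continuous_comp _ _ _ (fun k : V => k 0 0)
  (fun s : R => cosh (3 * lambda * s) `^ (- 2^-1))); first exact: coord_continuous.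
have ce (b : R) : continuous (fun s : R => expR (b * s)).
  move=> s; apply: (@continuous_comp _ _ _ (fun s : R => b * s) expR); last exact: continuous_expR.
  by apply: cvgM; [exact: cvg_cst|exact: cvg_id].
have cc : continuous (fun s : R => cosh (3 * lambda * s)).
  have -> : (fun s => cosh (3 * lambda * s)) =
      (fun s : R => (expR (3 * lambda * s) + expR (- (3 * lambda) * s)) * 2^-1).
    by apply/funext => s; rewrite /cosh mulNr.
  move=> s; exact: (continuousM (continuousD (ce _ s) (ce _ s)) (@cst_continuous _ _ _ s)).
apply: (@continuous_comp _ _ _ (fun s : R => cosh (3 * lambda * s)) (fun u : R => u `^ (- 2^-1))).
  exact: cc.
have c0 : 0 < cosh (3 * lambda * k 0 0) by apply: lt_le_trans (cosh_ge1 _).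
have [d _] : is_derive (cosh (3 * lambda * k 0 0)) (1 : R) (fun u => u `^ (- 2^-1))
  (- 2^-1 * cosh (3 * lambda * k 0 0) `^ (- 2^-1 - 1)) by exact: is_derive1_powR.
exact/differentiable_continuous/derivable1_diffP.
Qed.

Definition sl (psi : ST -> R) (t : R) : V -> R := fun x => psi (t, x).

Lemma continuous_mult_transform lambda psi t : C0oo psi ->
  continuous (fun k => mult lambda k * cosT (sl psi t) k) /\
  continuous (fun k => mult lambda k * sinT (sl psi t) k).
Proof.
move=> /(Cc_slice t) Cp; split => k.
  exact: (continuousM (@continuous_mult lambda k) (continuous_cosT Cp (x := k))).
exact: (continuousM (@continuous_mult lambda k) (continuous_sinT Cp (x := k))).
Qed.

Lemma integrable_mult_transform lambda psi t : C0oo psi ->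
  integrable3 (fun k => mult lambda k * cosT (sl psi t) k) /\
  integrable3 (fun k => mult lambda k * sinT (sl psi t) k).
Proof.
move=> Cp; have [c1 c2] := continuous_mult_transform lambda t Cp.
have [K hK] := transform_decay t Cp.
have i := integrable3Z K (@integrable3_decay R).
by split; [apply: (integrable3_le c1 _ i)|apply: (integrable3_le c2 _ i)] => k;
  have [h1 h2] := hK k; rewrite normrM ger0_norm ?mult_ge0 //;
  [apply: le_trans h1|apply: le_trans h2]; rewrite ler_piMl // mult_le1.
Qed.

Lemma integrable3M (u H : V -> R) : continuous u -> (forall k, `|u k| <= 1) ->
  continuous H -> integrable3 H -> integrable3 (fun k => u k * H k).
Proof.
move=> cu u1 cH iH.
have c : continuous (fun k : V => u k * H k) by move=> k; exact: (continuousM (cu k) (cH k)).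
by apply: (integrable3_le c _ (integrable3_norm iH)) => k; rewrite normrM ler_piMl.
Qed.

(* [(2 pi)^3 S psi]: the imaginary part of the inverse transform vanishes by
   parity. *)
Definition Sre lambda psi t (x : V) : R := int3 (fun k =>
  cos (dot k x) * (mult lambda k * cosT (sl psi t) k) +
  sin (dot k x) * (mult lambda k * sinT (sl psi t) k)).

Local Open Scope complex_scope.

Lemma fourier_realE (psi : ST -> R) t k :
  fourier (fun q => (psi q)%:C) (t, k) = cosT (sl psi t) k +i* sinT (sl psi t) k.
Proof.
rewrite /fourier /integral3; congr (_ +i* _).
  by rewrite /cosT /int3; congr Rintegral; apply/funext => y /=; rewrite mulr0 subr0.
by rewrite /sinT /int3; congr Rintegral; apply/funext => y /=; rewrite mulr0 add0r.
Qed.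

Lemma S_op_realE lambda (psi : ST -> R) t x : C0oo psi ->
  S_op lambda (fun q => (psi q)%:C) (t, x) = ((2 * pi) ^- 3 * Sre lambda psi t x)%:C.
Proof.
move=> Cp; have [i1 i2] := integrable_mult_transform lambda t Cp.
have [c1 c2] := continuous_mult_transform lambda t Cp.
have Cs := Cc_slice t Cp.
rewrite /S_op /inv_fourier /integral3.
set a := Rintegral _ _ _; set b := Rintegral _ _ _.
have -> : a = Sre lambda psi t x.
  rewrite /a /Sre /int3; congr Rintegral; apply/funext => y.
  by rewrite fourier_realE /= cosN sinN -/(mult _ _); ring.
have -> : b = 0.
  (* Odd in [k]: [mult], [cos] and [cosT] are even while [sin] and [sinT] are odd. *)
  pose f k := cos (dot k x) * (mult lambda k * sinT (sl psi t) k) -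
              sin (dot k x) * (mult lambda k * cosT (sl psi t) k).
  have -> : b = int3 f.
    rewrite /b /int3; congr Rintegral; apply/funext => y.
    by rewrite /f fourier_realE /= cosN sinN -/(mult _ _); ring.
  apply: int3_odd.
    apply: integrable3B.
      exact: (integrable3M (@continuous_cos_dotl _ x) (fun k => cos_max _) c2 i2).
    exact: (integrable3M (@continuous_sin_dotl _ x) (fun k => sin_max _) c1 i1).
  by move=> k; rewrite /f dotNl cosN sinN multN cosTN sinTN //; ring.
by apply/eqP; rewrite eq_complex /=; apply/andP; split; apply/eqP; ring.
Qed.

Lemma CimgP lambda (phi : ST -> R) : Cimg lambda phi <->
  exists2 psi, C0oo psi & forall t x, phi (t, x) = (2 * pi) ^- 3 * Sre lambda psi t x.
Proof.
split=> -[psi Cp h]; exists psi => //.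
  by move=> t x; have := h (t, x); rewrite S_op_realE // => -[].
by move=> [t x]; rewrite S_op_realE // h.
Qed.

End Multiplier.

(** * Action of motions on the image *)

Section Covariance.
Context {R : realType}.
Local Notation V := 'cV[R]_3.
Local Notation ST := (R * V)%type.

Lemma SO_trmxK n (A : 'M[R]_n) : SO R n A -> A^T *m A = 1%:M.
Proof. by move=> [h _]; exact: mulmx1C. Qed.

Lemma SO_invmx n (A : 'M[R]_n) : SO R n A -> invmx A = A^T.
Proof.
move=> hA; have [u _] := mulmx1_unit hA.1.
by rewrite -[LHS]mulmx1 -hA.1 mulmxA mulVmx // mul1mx.
Qed.

Lemma SO_trmx n (A : 'M[R]_n) : SO R n A -> SO R n A^T.
Proof. by move=> hA; split; [rewrite trmxK SO_trmxK|rewrite det_tr hA.2]. Qed.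

Lemma SO_mulmx n (A B : 'M[R]_n) : SO R n A -> SO R n B -> SO R n (A *m B).
Proof.
move=> [a1 a2] [b1 b2]; split; last by rewrite det_mulmx a2 b2 mulr1.
by rewrite trmx_mul mulmxA -[A *m B *m B^T]mulmxA b1 mulmx1.
Qed.

Lemma SO1 n : SO R n 1%:M.
Proof. by split; rewrite ?trmx1 ?mulmx1 ?det1. Qed.

Lemma C0oo_geom_action (A : 'M[R]_3) a psi : SO R 3 A -> C0oo psi ->
  C0oo (geom_action (A, a) psi).
Proof.
move=> hA Cp; have iA := SO_invmx hA.
pose T (p : ST) : ST := (p.1, A^T *m (p.2 - a)).
pose S (p : ST) : ST := (p.1, A *m p.2 + a).
have cp (f : V -> V) : continuous f -> continuous (fun p : ST => (p.1, f p.2)).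
  move=> cf p; have c2 : f q.2 @[q --> p] --> f p.2.
    by apply: (@continuous_comp _ _ _ snd f); [exact: cvg_snd|exact: cf].
  have c1 : q.1 @[q --> p] --> p.1 by exact: cvg_fst.
  exact: (cvg_pair c1 c2).
rewrite (_ : geom_action _ _ = psi \o T); last by rewrite /geom_action /T /= iA.
apply: (@C0oo_precomp _ T S (fun v => (v.1, A^T *m v.2))) => //.
- apply: (cp (fun x => A^T *m (x - a))) => x.
  apply: (@continuous_comp _ _ _ (fun x : V => x - a) (mulmx A^T)).
    exact: (continuousB (@cvg_id _ (nbhs x)) (@cst_continuous _ _ a x)).
  exact: continuous_mulmx.
- apply: (cp (fun x => A *m x + a)) => x.
  exact: (continuousD (@continuous_mulmx _ _ _ _ A x) (@cst_continuous _ _ a x)).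
- by move=> [t x]; rewrite /T /S /= mulmxA hA.1 mul1mx subrK.
- by move=> [t x]; rewrite /T /S /= addrK mulmxA SO_trmxK // mul1mx.
- move=> p v h; rewrite /T [RHS]surjective_pairing /=.
  by rewrite -addrA mulmxDr -scalemxAr.
Qed.

Lemma int3_motion (A : 'M[R]_3) a (f : V -> R) : SO R 3 A ->
  int3 f = int3 (fun y => f (A *m y + a)).
Proof.
move=> [_ dA]; rewrite -[LHS](int3_invariant _ (int_invariant_translation a)).
by rewrite -[LHS](int3_invariant _ (int_invariant_mulmx dA)).
Qed.

(** The real and imaginary parts of the covariance law: the transform at [A^T k] times the phase
    [e^{ika}]. *)
Lemma transform_geom_action (A : 'M[R]_3) a psi t k : SO R 3 A -> C0oo psi ->
  cosT (sl (geom_action (A, a) psi) t) k =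
    cos (dot k a) * cosT (sl psi t) (A^T *m k) - sin (dot k a) * sinT (sl psi t) (A^T *m k) /\
  sinT (sl (geom_action (A, a) psi) t) k =
    sin (dot k a) * cosT (sl psi t) (A^T *m k) + cos (dot k a) * sinT (sl psi t) (A^T *m k).
Proof.
move=> hA Cp; have Cs := Cc_slice t Cp.
have e y : sl (geom_action (A, a) psi) t (A *m y + a) = sl psi t y.
  by rewrite /sl /geom_action /= addrK SO_invmx // mulmxA SO_trmxK // mul1mx.
have ic := integrable3_Cc (Cc_cos (A^T *m k) Cs).
have is_ := integrable3_Cc (Cc_sin (A^T *m k) Cs).
have := integrable3Z (cos (dot k a)) ic; have := integrable3Z (sin (dot k a)) ic.
have := integrable3Z (cos (dot k a)) is_; have := integrable3Z (sin (dot k a)) is_.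
move=> i1 i2 i3 i4.
split; rewrite /cosT /sinT (int3_motion a _ hA) -!int3Z // -?int3B -?int3D //;
  congr int3; apply/funext => y; rewrite e dotDr dot_mulmx ?cosD ?sinD; ring.
Qed.

(** Phrased on momenta: the first coordinate changes at most by a sign, which is what leaves [mult]
    unchanged. *)
Definition preserves_axis (A : 'M[R]_3) :=
  exists2 s : R, s ^+ 2 = 1 & forall k : V, (A *m k) 0 0 = s * k 0 0.

Lemma Sre_geom_action lambda (A : 'M[R]_3) a psi t x : SO R 3 A -> preserves_axis A ->
  C0oo psi ->
  Sre lambda (geom_action (A, a) psi) t x = Sre lambda psi t (A^T *m (x - a)).
Proof.
move=> hA [s s1 hs] Cp; rewrite /Sre.
rewrite [LHS](int3_motion 0 _ hA); congr int3; apply/funext => k; rewrite addr0.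
have [-> ->] := transform_geom_action a t (A *m k) hA Cp.
rewrite mulmxA SO_trmxK // mul1mx.
have -> : mult lambda (A *m k) = mult lambda k.
  apply: (@eq_mult R lambda (A *m k) k); rewrite hs.
  move/eqP: s1; rewrite sqrf_eq1 => /orP[/eqP ->|/eqP ->].
    by left; rewrite mul1r.
  by right; rewrite mulN1r.
have -> : dot k (A^T *m (x - a)) = dot (A *m k) x - dot (A *m k) a.
  by rewrite dot_mulmx trmxK dotDr dotNr.
rewrite cosB sinB; ring.
Qed.

Lemma preserves_axis_rotation lambda (A : 'M[R]_3) a : SO R 3 A -> preserves_axis A ->
  preserves (Cimg lambda) (A, a).
Proof.
move=> hA ax phi /CimgP[psi Cp h]; apply/CimgP; exists (geom_action (A, a) psi).
  exact: C0oo_geom_action.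
by move=> t x; rewrite Sre_geom_action // /geom_action /= h SO_invmx.
Qed.

Lemma Cimg_S (lambda : R) (psi : ST -> R) : C0oo psi ->
  Cimg lambda (fun p : ST => (2 * pi) ^- 3 * Sre lambda psi p.1 p.2).
Proof. by move=> Cp; apply/CimgP; exists psi. Qed.

Lemma preserves_mul C (g h : 'M[R]_3 * V) : SO R 3 g.1 -> SO R 3 h.1 ->
  preserves C g -> preserves C h -> preserves C (motion_mul g h).
Proof.
move=> hg hh pg ph phi Cphi.
have -> : geom_action (motion_mul g h) phi = geom_action g (geom_action h phi).
  apply/funext => p; rewrite /geom_action /= !SO_invmx //; last exact: SO_mulmx.
  rewrite trmx_mul -[h.1^T *m g.1^T *m _]mulmxA; congr (phi (_, _ *m _)).
  by rewrite [_ *m _ + _]addrC opprD addrA mulmxBr mulmxA SO_trmxK // mul1mx.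
exact/pg/ph.
Qed.

Let fourier_cst_neq0 : (2 * pi : R) ^- 3 != 0.
Proof. by rewrite lt0r_neq0 // invr_gt0 exprn_gt0 // mulr_gt0 // pi_gt0. Qed.

Let add_sub_eq0 (p q : R) : p + -1 * q = 0 -> p + q = 0 -> p = 0.
Proof. lra. Qed.

(** The rotated image of [psi] is the image of some [psi']. After the substitution [k -> A^T k] both
    are inverse transforms of continuous integrable functions, and these must agree by
    injectivity. *)
Lemma transform_of_preserves lambda (A : 'M[R]_3) psi : SO R 3 A ->
  preserves (Cimg lambda) (A, 0) -> C0oo psi ->
  exists2 psi', C0oo psi' & forall t k,
    mult lambda (A^T *m k) * cosT (sl psi t) (A^T *m k) = mult lambda k * cosT (sl psi' t) k.
Proof.
move=> hA pA Cp; have /CimgP[psi' Cp' h] := pA _ (Cimg_S lambda Cp).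
exists psi' => // t; have hAt := SO_trmx hA.
have [i1 i2] := integrable_mult_transform lambda t Cp.
have [c1 c2] := continuous_mult_transform lambda t Cp.
have [i1' i2'] := integrable_mult_transform lambda t Cp'.
have [c1' c2'] := continuous_mult_transform lambda t Cp'.
have Cs := Cc_slice t Cp; have Cs' := Cc_slice t Cp'.
pose F k := mult lambda k * cosT (sl psi t) k.
pose G k := mult lambda k * sinT (sl psi t) k.
pose F' k := mult lambda k * cosT (sl psi' t) k.
pose G' k := mult lambda k * sinT (sl psi' t) k.
have ca (f : V -> R) : continuous f -> continuous (f \o mulmx A^T).
  move=> cf k; apply: (@continuous_comp _ _ _ (mulmx A^T) f); last exact: cf.
  exact: continuous_mulmx.
have inv : int_invariant (mulmx A^T) by apply: int_invariant_mulmx; exact: hAt.2.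
have ia f : continuous f -> integrable3 f -> integrable3 (f \o mulmx A^T).
  by move=> cf; apply: integrable3_invariant => //; exact: ca.
pose H1 k := (F \o mulmx A^T) k - F' k.
pose H2 k := (G \o mulmx A^T) k - G' k.
have cH1 : continuous H1 by move=> k; exact: (continuousB (ca _ c1 k) (c1' k)).
have cH2 : continuous H2 by move=> k; exact: (continuousB (ca _ c2 k) (c2' k)).
have iH1 : integrable3 H1 by apply: integrable3B; [exact: ia|].
have iH2 : integrable3 H2 by apply: integrable3B; [exact: ia|].
have icos x (f : V -> R) : continuous f -> integrable3 f ->
    integrable3 (fun k => cos (dot k x) * f k).
  by move=> cf fi; exact: (integrable3M (@continuous_cos_dotl _ x) (fun k => cos_max _) cf fi).
have isin x (f : V -> R) : continuous f -> integrable3 f ->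
    integrable3 (fun k => sin (dot k x) * f k).
  by move=> cf fi; exact: (integrable3M (@continuous_sin_dotl _ x) (fun k => sin_max _) cf fi).
have key x : int3 (fun k => cos (dot k x) * H1 k) + int3 (fun k => sin (dot k x) * H2 k) = 0.
  have e := h t x; rewrite /geom_action /= in e.
  move: e => /(mulfI fourier_cst_neq0).
  rewrite (SO_invmx hA) subr0 /Sre [LHS](int3_motion 0 _ hAt) => e.
  rewrite -int3D; try exact: icos; try exact: isin.
  transitivity (int3 (fun k =>
     (cos (dot k x) * (F \o mulmx A^T) k + sin (dot k x) * (G \o mulmx A^T) k) -
     (cos (dot k x) * F' k + sin (dot k x) * G' k))).
    by congr int3; apply/funext => k; rewrite /H1 /H2; ring.
  have j1 := icos x _ (ca _ c1) (ia _ c1 i1); have j2 := isin x _ (ca _ c2) (ia _ c2 i2).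
  have j3 := icos x _ c1' i1'; have j4 := isin x _ c2' i2'.
  rewrite int3B; [|exact: integrable3D|exact: integrable3D].
  rewrite -[X in _ - X]e; apply/eqP; rewrite subr_eq0; apply/eqP; congr int3.
  apply/funext => k; rewrite addr0 /F /G /=.
  by rewrite dot_mulmx trmxK mulmxA hA.1 mul1mx.
have H1c x : int3 (fun k => cos (dot k x) * H1 k) = 0.
  (* The cosine integral is even in [x] and the sine integral odd, so the two instances together
     kill each separately. *)
  have := key x; have := key (- x).
  under eq_fun do rewrite dotNr cosN.
  under [X in _ + int3 X]eq_fun do rewrite dotNr sinN mulNr -mulN1r.
  rewrite int3Z; last exact: isin.
  exact: add_sub_eq0.
(* [H1] is even in [k], being built from [mult] and [cosT]. *)
have H1s x : int3 (fun k => sin (dot k x) * H1 k) = 0.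
  apply: int3_odd; first exact: isin.
  by move=> k; rewrite /H1 /F /F' /= dotNl sinN mulmxN !multN !cosTN mulNr.
move=> k; have := transform_injective cH1 iH1 H1c H1s k.
by move/eqP; rewrite subr_eq0 => /eqP.
Qed.

End Covariance.

(** * The common power series of [cos] and [cosh] *)

Section EvenSeries.
Context {R : realType}.

(** Truncations of one entire function whose value at [- s^2] is [cos s] and at [s^2] is [cosh s].
    Changing the sign of the argument thus replaces [s] by [i s] without complex numbers. *)
Definition even_exp (n : nat) (x : R) : R := \sum_(j < n) x ^+ j / (j.*2)`!%:R.

Lemma even_expS n x : even_exp n.+1 x = even_exp n x + x ^+ n / (n.*2)`!%:R.
Proof. by rewrite /even_exp big_ord_recr. Qed.

Lemma cvg_even_exp_cos (x : R) : even_exp n (- x ^+ 2) @[n --> \oo] --> cos x.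
Proof.
have -> : (fun n => even_exp n (- x ^+ 2)) = series (cos_coeff' x).
  apply/funext => n; rewrite /series /= big_mkord; apply: eq_bigr => j _.
  by rewrite /cos_coeff' exprNn -exprM mul2n.
exact: cvg_cos_coeff'.
Qed.

Lemma cvg_even_exp_cosh (x : R) : even_exp n (x ^+ 2) @[n --> \oo] --> cosh x.
Proof.
have e n : even_exp n (x ^+ 2) = (series (exp_coeff x) n.*2 + series (exp_coeff (- x)) n.*2) / 2.
  elim: n => [|n IH]; first by rewrite /even_exp big_ord0 /series /= !big_geq ?addr0 ?mul0r.
  have e2 y : y ^+ n.*2 = (y ^+ 2) ^+ n :> R by rewrite -exprM mul2n.
  rewrite even_expS IH doubleS !seriesSr /exp_coeff /=.
  rewrite [x ^+ n.*2.+1]exprS [(- x) ^+ n.*2.+1]exprS !e2 sqrrN.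
  by field; rewrite !pnatr_eq0 -!lt0n !fact_gt0.
have c2 : n.*2 @[n --> \oo] --> \oo.
  move=> A [N _ NA]; exists N => // n /= Nn; apply: NA => /=.
  by rewrite (leq_trans Nn) // -addnn leq_addr.
have h y : series (exp_coeff y) n.*2 @[n --> \oo] --> expR y.
  have e' : series (exp_coeff y) n @[n --> \oo] --> expR y.
    exact: is_cvg_series_exp_coeff.
  exact: (cvg_comp _ _ c2 e').
rewrite (funext e) /cosh; apply: cvgM; last exact: cvg_cst.
by apply: cvgD; exact: h.
Qed.

Lemma sum_exp_le (z : R) m n : 0 <= z -> \sum_(m <= j < n) z ^+ j / j`!%:R <= expR z.
Proof.
move=> z0; apply: (@le_trans _ _ (series (exp_coeff z) n)).
  rewrite /series /=; have [mn|nm] := leqP m n.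
    rewrite (@big_cat_nat _ _ _ m 0 n) //= lerDr; apply: sumr_ge0 => j _; exact: exp_coeff_ge0.
  by rewrite big_geq ?(ltnW nm) // sumr_ge0 // => j _; exact: exp_coeff_ge0.
by apply: le_trans (ler_norm _) _; rewrite (le_trans (series_exp_coeff_le _ _)) // ger0_norm.
Qed.

Lemma fact_double_le j : j`!%:R <= (j.*2)`!%:R :> R.
Proof. by rewrite ler_nat; apply: leq_fact; rewrite -addnn leq_addr. Qed.

(** Every term of the tail contains [z ^+ j] with [j >= n], at most [z ^+ n]. What remains is
    dominated by the exponential series of [B], since [(2j)!] is at least [j!]. *)
Lemma even_exp_remainder (z w B l : R) n : 0 <= z <= 1 -> `|w| <= B ->
  even_exp m (z * w) @[m --> \oo] --> l -> `|l - even_exp n (z * w)| <= z ^+ n * expR B.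
Proof.
move=> /andP[z0 z1] wB ml.
have c : `|even_exp m (z * w) - even_exp n (z * w)| @[m --> \oo] -->
    `|l - even_exp n (z * w)|.
  by apply: cvg_norm; apply: cvgB => //; exact: cvg_cst.
rewrite -(cvg_lim (@Rhausdorff R) c); apply: limr_le.
  by apply/cvg_ex; eexists; exact: c.
near=> m.
have nm : (n <= m)%N by near: m; exists n.
have B0 : 0 <= B by apply: le_trans wB; exact: normr_ge0.
have -> : even_exp m (z * w) - even_exp n (z * w) =
    \sum_(n <= j < m) (z * w) ^+ j / (j.*2)`!%:R.
  rewrite /even_exp -!(big_mkord xpredT (fun j => (z * w) ^+ j / (j.*2)`!%:R)).
  by rewrite [X in X - _](@big_cat_nat _ _ _ n 0 m) //= addrAC subrr add0r.
apply: (@le_trans _ _ (\sum_(n <= j < m) z ^+ n * (B ^+ j / j`!%:R))); last first.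
  by rewrite -mulr_sumr ler_wpM2l ?exprn_ge0 // sum_exp_le.
apply: le_trans (ler_norm_sum _ _ _) _; rewrite big_nat_cond [leRHS]big_nat_cond.
apply: ler_sum => j /andP[/andP[nj _] _].
have f0 : 0 < j`!%:R :> R by rewrite ltr0n fact_gt0.
have f20 : 0 < (j.*2)`!%:R :> R by rewrite ltr0n fact_gt0.
rewrite normrM normrV ?unitfE ?gt_eqF // normr_nat normrX normrM (ger0_norm z0) exprMn -mulrA.
apply: ler_pM; rewrite ?exprn_ge0 ?divr_ge0 ?exprn_ge0 //.
  by rewrite ler_wiXn2l.
apply: ler_pM; rewrite ?invr_ge0 ?exprn_ge0 //.
  by rewrite lerXn2r // nnegrE.
by rewrite lef_pV2 // ?posrE // fact_double_le.
Unshelve. all: by end_near. Qed.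

End EvenSeries.

(** * Polynomials dominated by an exponential *)

Section DominatedPolynomials.
Context {R : realType}.

(** The coefficients are bounded by those of [K exp (B x)], with no reference to the degree. This
    uniformity stands in for convergence of the full power series. *)
Definition exp_dominated (p : {poly R}) (K B : R) :=
  forall j, `|p`_j| <= K * (B ^+ j / j`!%:R).

Lemma exp_dominated_sub p q K L B : exp_dominated p K B -> exp_dominated q L B ->
  exp_dominated (p - q) (K + L) B.
Proof.
by move=> hp hq j; rewrite coefB mulrDl (le_trans (ler_normB _ _)) // lerD.
Qed.

(** The binomial theorem, in the form [exp (B x) exp (B x) = exp (2 B x)] coefficient by
    coefficient. *)
Lemma exp_dominated_mul p q K L B : 0 <= K -> 0 <= L -> 0 <= B ->
  exp_dominated p K B -> exp_dominated q L B -> exp_dominated (p * q) (K * L) (2 * B).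
Proof.
move=> K0 L0 B0 hp hq j; rewrite coefM.
apply: le_trans (ler_norm_sum _ _ _) _.
have f0 i : (i`!%:R : R) != 0 by rewrite pnatr_eq0 -lt0n fact_gt0.
have -> : K * L * ((2 * B) ^+ j / j`!%:R) =
    \sum_(i < j.+1) (K * (B ^+ i / i`!%:R)) * (L * (B ^+ (j - i) / (j - i)`!%:R)).
  rewrite exprMn (_ : 2 = 1 + 1) // exprDn mulr_suml mulr_suml mulr_sumr.
  apply: eq_bigr => i _; have ij : (i <= j)%N by rewrite -ltnS.
  rewrite !expr1n mulr1 -[B ^+ j](_ : B ^+ i * B ^+ (j - i) = _); last first.
    by rewrite -exprD subnKC.
  have -> : 'C(j, i)%:R = j`!%:R / (i`!%:R * (j - i)`!%:R) :> R.
    by rewrite -(bin_fact ij) !natrM mulfK // mulf_neq0.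
  by field; rewrite !f0.
by apply: ler_sum => i _; rewrite normrM ler_pM.
Qed.

(** Only powers [j >= n] occur, and there [x^j] is at most [(2 x)^j / 2^n]: doubling the argument
    pays for the geometric factor. *)
Lemma exp_dominated_horner_le p K B x n : 0 <= K -> 0 <= B -> 0 <= x -> exp_dominated p K B ->
  (forall j, (j < n)%N -> p`_j = 0) -> `|p.[x]| <= K * expR (2 * (B * x)) / 2 ^+ n.
Proof.
move=> K0 B0 x0 hp low; rewrite horner_coef; apply: le_trans (ler_norm_sum _ _ _) _.
apply: (@le_trans _ _ (\sum_(j < size p) K / 2 ^+ n * ((2 * (B * x)) ^+ j / j`!%:R))).
  apply: ler_sum => j _; have [jn|nj] := ltnP j n.
    by rewrite low // mul0r normr0 !mulr_ge0 ?invr_ge0 ?exprn_ge0 ?mulr_ge0.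
  rewrite normrM normrX (ger0_norm x0).
  apply: le_trans (ler_wpM2r (exprn_ge0 _ x0) (hp j)) _.
  have -> : K / 2 ^+ n * ((2 * (B * x)) ^+ j / j`!%:R) =
      K * (B ^+ j / j`!%:R) * x ^+ j * (2 ^+ j / 2 ^+ n) by rewrite !exprMn; ring.
  rewrite ler_peMr ?mulr_ge0 ?invr_ge0 ?exprn_ge0 // ler_pdivlMr ?exprn_gt0 // mul1r.
  by rewrite ler_weXn2l // ler1n.
rewrite -mulr_sumr mulrAC ler_wpM2r ?invr_ge0 ?exprn_ge0 // ler_wpM2l //.
by rewrite -(big_mkord xpredT (fun j => _ ^+ j / j`!%:R)) sum_exp_le // !mulr_ge0.
Qed.

(** Letting [z] tend to 0 kills the constant term; dividing by the variable lowers the order by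
    one. *)
Lemma poly_low_coef (p : {poly R}) K n :
  (forall z, 0 < z <= 1 -> `|p.[- z]| <= K * z ^+ n) -> forall j, (j < n)%N -> p`_j = 0.
Proof.
elim: n p K => // n IH; elim/poly_ind => [|q c _] K hp j jn; first by rewrite coef0.
have K0 : 0 <= K.
  by have := hp 1; rewrite ltr01 lexx expr1n mulr1 => /(_ isT); apply: le_trans.
pose Q := \sum_(i < size q) `|q`_i|.
have qQ z : 0 < z <= 1 -> `|q.[- z]| <= Q.
  move=> /andP[z0 z1]; rewrite horner_coef (le_trans (ler_norm_sum _ _ _)) // ler_sum // => i _.
  by rewrite normrM normrX normrN (gtr0_norm z0) ler_piMr // exprn_ile1 // ltW.
have Q0 : 0 <= Q by apply: sumr_ge0 => i _; exact: normr_ge0.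
have ez z : (q * 'X + c%:P).[- z] = q.[- z] * (- z) + c by rewrite hornerMXaddC.
have c0 : c = 0.
  apply/eqP; rewrite -normr_le0 leNgt; apply/negP => cpos.
  (* With [z = |c| / d] the bound [|c| <= (K + Q) z] would force [d <= K + Q]; the summand [|c|]
     keeps [z] below 1. *)
  pose d := K + Q + `|c| + 1.
  have d0 : 0 < d by rewrite /d; lra.
  pose z := `|c| / d.
  have zpos : 0 < z by rewrite divr_gt0.
  have z1 : z <= 1 by rewrite ler_pdivrMr // mul1r /d; lra.
  have zz : 0 < z <= 1 by rewrite zpos z1.
  have := hp z zz; rewrite ez => h1.
  have h2 := qQ z zz.
  have h3 : `|c| <= `|q.[- z] * (- z) + c| + `|q.[- z] * (- z)|.
    by have := ler_normB (q.[- z] * (- z) + c) (q.[- z] * (- z)); rewrite addrAC subrr add0r.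
  have h4 : `|q.[- z] * (- z)| <= Q * z by rewrite normrM normrN (gtr0_norm zpos) ler_wpM2r // ltW.
  have h5 : K * z ^+ n.+1 <= K * z.
    by rewrite ler_wpM2l // exprS ler_piMr ?(ltW zpos) // exprn_ile1 // ltW.
  have : `|c| <= (K + Q) * z by rewrite mulrDl; lra.
  rewrite /z mulrA ler_pdivlMr // [leRHS]mulrC ler_pM2l // /d; lra.
move: hp ez; rewrite c0 addr0 => hp ez.
case: j jn => [|j] jn; first by rewrite coefMX.
rewrite coefMX /=; apply: (IH q K) => // z zz; have := hp z zz.
move: zz => /andP[zpos z1]; rewrite hornerMX normrM normrN (gtr0_norm zpos).
by rewrite exprSr mulrA ler_pM2r.
Qed.

(** Here [z] plays the role of [s^2] and the polynomial variable that of [X = - s^2], hence the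
    evaluation at [- z]. The bound on [f] is what lets products be approximated. *)
Definition poly_approx n (f : R -> R) (p : {poly R}) := exists K, forall z, 0 < z <= 1 ->
  `|f z| <= K /\ `|f z - p.[- z]| <= K * z ^+ n.

Lemma poly_approx_sub n f g p q : poly_approx n f p -> poly_approx n g q ->
  poly_approx n (fun z => f z - g z) (p - q).
Proof.
move=> [K hK] [L hL]; exists (K + L) => z zz; have [k1 k2] := hK z zz.
have [l1 l2] := hL z zz; split; first by rewrite (le_trans (ler_normB _ _)) // lerD.
rewrite hornerD hornerN mulrDl.
have -> : f z - g z - (p.[- z] - q.[- z]) = (f z - p.[- z]) - (g z - q.[- z]) by ring.
by rewrite (le_trans (ler_normB _ _)) // lerD.
Qed.

Lemma poly_approx_mul n f g p q : poly_approx n f p -> poly_approx n g q ->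
  poly_approx n (fun z => f z * g z) (p * q).
Proof.
move=> [K hK] [L hL]; exists (3 * K * L) => z zz; have [k1 k2] := hK z zz.
have [l1 l2] := hL z zz.
have K0 : 0 <= K by apply: le_trans k1.
have L0 : 0 <= L by apply: le_trans l1.
move: zz => /andP[zpos z1].
have zn0 : 0 <= z ^+ n by rewrite exprn_ge0 // ltW.
have zn1 : z ^+ n <= 1 by rewrite exprn_ile1 // ltW.
split.
  rewrite normrM (le_trans (ler_pM _ _ k1 l1)) // -mulrA ler_peMl ?mulr_ge0 //; lra.
rewrite hornerM.
have -> : f z * g z - p.[- z] * q.[- z] = f z * (g z - q.[- z]) + (f z - p.[- z]) * g z
   - (f z - p.[- z]) * (g z - q.[- z]) by ring.
have h1 : `|f z * (g z - q.[- z])| <= K * (L * z ^+ n) by rewrite normrM ler_pM.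
have h2 : `|(f z - p.[- z]) * g z| <= K * z ^+ n * L by rewrite normrM ler_pM.
have h3 : `|(f z - p.[- z]) * (g z - q.[- z])| <= K * z ^+ n * L.
  rewrite normrM (le_trans (ler_pM _ _ k2 l2)) //.
  by rewrite mulrA ler_piMr // !mulr_ge0.
rewrite (le_trans (ler_normB _ _)) //.
have h4 := ler_normD (f z * (g z - q.[- z])) ((f z - p.[- z]) * g z).
lra.
Qed.

End DominatedPolynomials.

(** * Continuation to imaginary arguments *)

Section Wick.
Context {R : realType}.
Local Notation V := 'cV[R]_3.

Lemma Cc_dotM (v : V) h : Cc h -> Cc (fun x => dot v x * h x).
Proof.
move=> [ch [M HM]]; split; first by move=> x; exact: (cvgM (@continuous_dot _ v x) (ch x)).
have M0 : 0 <= M by apply: le_trans (HM 0).1; exact: normr_ge0.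
pose S := `|v 0 0| + `|v 1 0| + `|v 2 0|.
have S0 : 0 <= S by rewrite !addr_ge0.
exists (M * S * M + M) => x; have [h1 h2] := HM x; split.
  have [->|/h2 xM] := eqVneq (h x) 0; first by rewrite mulr0 normr0 addr_ge0 // !mulr_ge0.
  rewrite normrM (@le_trans _ _ (M * S * M)) ?lerDl //.
  by apply: ler_pM => //; exact: norm_dot_le.
rewrite mulf_eq0 negb_or => /andP[_ /h2 H] i.
by rewrite (le_trans (H i)) // lerDr !mulr_ge0.
Qed.

Lemma Cc_dotX (v : V) h n : Cc h -> Cc (fun x => dot v x ^+ n * h x).
Proof.
move=> Ch; elim: n => [|n IH].
  by rewrite (_ : (fun x => _) = h) //; apply/funext => x; rewrite expr0 mul1r.
rewrite (_ : (fun x => _) = fun x => dot v x * (dot v x ^+ n * h x)); first exact: Cc_dotM.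
by apply/funext => x; rewrite exprS mulrA.
Qed.

Lemma Cc_dot_bounded (v : V) f : Cc f -> exists2 B, 0 <= B &
  forall x, f x != 0 -> dot v x ^+ 2 <= B.
Proof.
move=> [_ [M HM]]; exists ((M * (`|v 0 0| + `|v 1 0| + `|v 2 0|)) ^+ 2).
  exact: sqr_ge0.
move=> x /(HM x).2 xM; rewrite -[leLHS]real_normK ?num_real //.
by rewrite lerXn2r ?nnegrE ?(le_trans (normr_ge0 _) (norm_dot_le v xM)) // norm_dot_le.
Qed.

Definition moment (f : V -> R) v j := int3 (fun x => dot v x ^+ j.*2 * f x).

(** The Taylor truncation, in [X = - s^2], of the cosine transform of [f] along the line of [v]. At
    [X > 0] it truncates the integral of [cosh (sqrt X (v . x)) f]. *)
Definition moment_poly f v n := \poly_(j < n) (moment f v j / (j.*2)`!%:R).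

Lemma Cc_even_exp (v : V) f n X : Cc f -> Cc (fun x => even_exp n (X * dot v x ^+ 2) * f x).
Proof.
move=> Cf; elim: n => [|n IH].
  rewrite (_ : (fun x => _) = fun x => 0 * f x); first exact: CcZ.
  by apply/funext => x; rewrite /even_exp big_ord0.
rewrite (_ : (fun x => _) = fun x => even_exp n (X * dot v x ^+ 2) * f x +
   (X ^+ n / (n.*2)`!%:R) * (dot v x ^+ n.*2 * f x)).
  by apply: Cc_add => //; apply: CcZ; exact: Cc_dotX.
by apply/funext => x; rewrite even_expS exprMn -exprM mul2n; ring.
Qed.

Lemma horner_moment_poly (v : V) f n X : Cc f ->
  (moment_poly f v n).[X] = int3 (fun x => even_exp n (X * dot v x ^+ 2) * f x).
Proof.
move=> Cf; rewrite horner_poly; elim: n => [|n IH].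
  rewrite big_ord0 -[LHS](mul0r (int3 f)) -int3Z; last exact: integrable3_Cc.
  by congr int3; apply/funext => x; rewrite /even_exp big_ord0.
rewrite big_ord_recr /= IH.
have -> : moment f v n / (n.*2)`!%:R * X ^+ n =
    int3 (fun x => (X ^+ n / (n.*2)`!%:R) * (dot v x ^+ n.*2 * f x)).
  rewrite int3Z; last exact/integrable3_Cc/Cc_dotX.
  by rewrite /moment; ring.
rewrite -int3D.
- by congr int3; apply/funext => x; rewrite even_expS exprMn -exprM mul2n; ring.
- exact/integrable3_Cc/Cc_even_exp.
- exact/integrable3_Cc/CcZ/Cc_dotX.
Qed.

Lemma moment_poly_dominated (v : V) f n B : Cc f -> 0 <= B ->
  (forall x, f x != 0 -> dot v x ^+ 2 <= B) ->
  exp_dominated (moment_poly f v n) (int3 (fun x => `|f x|)) B.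
Proof.
move=> Cf B0 fB j.
have I0 : 0 <= int3 (fun x => `|f x|) by exact: int3_ge0.
have f0 : 0 < j`!%:R :> R by rewrite ltr0n fact_gt0.
have f20 : 0 < (j.*2)`!%:R :> R by rewrite ltr0n fact_gt0.
rewrite coef_poly; case: ifP => _; last first.
  by rewrite normr0 !mulr_ge0 ?invr_ge0 ?exprn_ge0 // ltW.
rewrite normrM normfV (gtr0_norm f20) mulrA; apply: ler_pM => //.
- rewrite mulrC -int3Z; last exact/integrable3_norm/integrable3_Cc.
  apply: le_norm_int3.
  + exact/integrable3_Cc/Cc_dotX.
  + exact/integrable3Z/integrable3_norm/integrable3_Cc.
  + move=> x; have [->|/fB h] := eqVneq (f x) 0; first by rewrite mulr0 normr0 mulr0.
    have d0 : 0 <= dot v x ^+ 2 by exact: sqr_ge0.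
    rewrite normrM ler_wpM2r // -mul2n exprM (ger0_norm (exprn_ge0 _ d0)).
    by rewrite lerXn2r // nnegrE.
- by rewrite lef_pV2 // fact_double_le.
Qed.

Lemma moment_poly_approx (v : V) f n B : Cc f -> 0 <= B ->
  (forall x, f x != 0 -> dot v x ^+ 2 <= B) ->
  poly_approx n (fun z => int3 (fun x => cos (Num.sqrt z * dot v x) * f x)) (moment_poly f v n).
Proof.
move=> Cf B0 fB; exists (expR B * int3 (fun x => `|f x|)) => z /andP[z0 z1].
have ifn := integrable3_norm (integrable3_Cc Cf).
have I0 : 0 <= int3 (fun x => `|f x|) by exact: int3_ge0.
have ccos : Cc (fun x => cos (Num.sqrt z * dot v x) * f x).
  have := Cc_cos (Num.sqrt z *: v) Cf; congr Cc; apply/funext => x.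
  by rewrite dotC dotZr dotC.
split.
  apply: (@le_trans _ _ (int3 (fun x => `|f x|))).
    apply: le_norm_int3 => //; first exact: integrable3_Cc.
    by move=> x; rewrite normrM ler_piMl // cos_max.
  by rewrite ler_peMl // (le_trans _ (expR_ge1Dx B)) // lerDl.
rewrite horner_moment_poly // -int3B; try exact: integrable3_Cc; last first.
  exact/integrable3_Cc/Cc_even_exp.
rewrite mulrAC -int3Z //; apply: le_norm_int3.
- apply: integrable3B; first exact: integrable3_Cc.
  exact/integrable3_Cc/Cc_even_exp.
- exact: integrable3Z.
move=> x; rewrite -mulrBl normrM.
have [->|/fB h] := eqVneq (f x) 0; first by rewrite normr0 !mulr0.
rewrite ler_wpM2r // [leRHS]mulrC.
have e : - z * dot v x ^+ 2 = z * - dot v x ^+ 2 by ring.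
rewrite e; apply: even_exp_remainder; first by rewrite (ltW z0).
  by rewrite normrN ger0_norm ?sqr_ge0.
rewrite -e (_ : - z * _ = - (Num.sqrt z * dot v x) ^+ 2); first exact: cvg_even_exp_cos.
by rewrite exprMn sqr_sqrtr ?mulNr // ltW.
Qed.

(** The truncation of [cosh (a s)] in the variable [X = - s^2]; at [X > 0] it truncates
    [cos (a sqrt X)]. *)
Definition cosh_poly (a : R) n := \poly_(j < n) ((- a ^+ 2) ^+ j / (j.*2)`!%:R).

Lemma horner_cosh_poly a n X : (cosh_poly a n).[X] = even_exp n (- a ^+ 2 * X).
Proof.
by rewrite horner_poly; apply: eq_bigr => j _; rewrite exprMn mulrAC.
Qed.

Lemma cosh_poly_dominated a n : exp_dominated (cosh_poly a n) 1 (a ^+ 2).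
Proof.
move=> j; rewrite coef_poly mul1r.
have f0 : 0 < j`!%:R :> R by rewrite ltr0n fact_gt0.
have f20 : 0 < (j.*2)`!%:R :> R by rewrite ltr0n fact_gt0.
have a20 : 0 <= a ^+ 2 by exact: sqr_ge0.
case: ifP => _; last by rewrite normr0 divr_ge0 ?(ltW f0) // exprn_ge0.
rewrite normrM normfV (gtr0_norm f20) normrX normrN (ger0_norm a20).
rewrite ler_wpM2l //; first by rewrite exprn_ge0.
by rewrite lef_pV2 // fact_double_le.
Qed.

Lemma cosh_poly_approx a n : poly_approx n (fun z => cosh (a * Num.sqrt z)) (cosh_poly a n).
Proof.
exists (expR (a ^+ 2)) => z /andP[z0 z1].
have c : even_exp m (z * a ^+ 2) @[m --> \oo] --> cosh (a * Num.sqrt z).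
  rewrite (_ : z * _ = (a * Num.sqrt z) ^+ 2); first exact: cvg_even_exp_cosh.
  by rewrite exprMn sqr_sqrtr 1?mulrC // ltW.
have zz : 0 <= z <= 1 by rewrite (ltW z0).
have a2 : `|a ^+ 2| <= a ^+ 2 by rewrite ger0_norm ?sqr_ge0.
split.
  have := even_exp_remainder 0 zz a2 c.
  by rewrite /even_exp big_ord0 subr0 expr0 mul1r.
rewrite horner_cosh_poly mulrNN [a ^+ 2 * z]mulrC [leRHS]mulrC.
exact: even_exp_remainder.
Qed.

Lemma exp_dominatedW (p : {poly R}) K B B' : 0 <= K -> 0 <= B <= B' ->
  exp_dominated p K B -> exp_dominated p K B'.
Proof.
move=> K0 /andP[B0 BB] hp j; apply: le_trans (hp j) _; rewrite ler_wpM2l //.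
rewrite ler_wpM2r ?invr_ge0 // lerXn2r // nnegrE //; exact: le_trans BB.
Qed.

(* Both sides are power series in [X = - s ^ 2] with infinite radius of
   convergence, so the identity persists for [X > 0], where [cosh (a * s)] has
   turned into a cosine while the transform of the nonnegative [f] has become a
   Laplace transform, which does not vanish. *)
Lemma cosh_transform_absurd (f f' : V -> R) (v v' : V) (a : R) : 0 < a ->
  Cc f -> Cc f' -> (forall x, 0 <= f x) -> 0 < int3 f ->
  ~ (forall s, int3 (fun x => cos (s * dot v' x) * f' x) ^+ 2 =
       int3 (fun x => cos (s * dot v x) * f x) ^+ 2 * cosh (a * s)).
Proof.
move=> a0 Cf Cf' f0 If idt.
have [B1 B10 fB1] := Cc_dot_bounded v Cf; have [B2 B20 fB2] := Cc_dot_bounded v' Cf'.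
pose B := B1 + B2 + a ^+ 2.
have a20 : 0 <= a ^+ 2 by exact: sqr_ge0.
have B0 : 0 <= B by rewrite !addr_ge0.
have fB x : f x != 0 -> dot v x ^+ 2 <= B by move=> /fB1; rewrite /B; lra.
have fB' x : f' x != 0 -> dot v' x ^+ 2 <= B by move=> /fB2; rewrite /B; lra.
(* The truncated difference of the two sides. The identity makes its coefficients below [n] vanish
   and the others are dominated uniformly in [n], so it tends to 0 at every fixed [X >= 0]. *)
pose D n := moment_poly f' v' n * moment_poly f' v' n -
  moment_poly f v n * moment_poly f v n * cosh_poly a n.
pose K := int3 (fun x => `|f x|); pose K' := int3 (fun x => `|f' x|).
have K0 : 0 <= K by exact: int3_ge0.
have K'0 : 0 <= K' by exact: int3_ge0.
have BB : 0 <= B <= 2 * B by rewrite B0 ler_peMl // ler1n.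
have BB2 : 0 <= 2 * B <= 2 * (2 * B) by rewrite mulr_ge0 // ler_peMl ?mulr_ge0 // ler1n.
have domD n : exp_dominated (D n) (K' * K' + K * K * 1) (2 * (2 * B)).
  apply: exp_dominated_sub.
    apply: (exp_dominatedW (mulr_ge0 K'0 K'0) BB2).
    by apply: exp_dominated_mul => //; exact: moment_poly_dominated.
  apply: exp_dominated_mul; rewrite ?mulr_ge0 //.
    by apply: exp_dominated_mul => //; exact: moment_poly_dominated.
  apply: exp_dominatedW (cosh_poly_dominated a n) => //.
  by rewrite sqr_ge0 /=; move: BB => /andP[_]; rewrite /B; lra.
have lowD n j : (j < n)%N -> (D n)`_j = 0.
  have A1 := moment_poly_approx n Cf B0 fB; have A2 := moment_poly_approx n Cf' B0 fB'.
  have [L hL] := poly_approx_sub (poly_approx_mul A2 A2)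
    (poly_approx_mul (poly_approx_mul A1 A1) (cosh_poly_approx a n)).
  move=> jn; apply: (@poly_low_coef _ (D n) L n) => // z zz.
  by have [_] := hL z zz; rewrite -!expr2 idt subrr sub0r normrN.
(* Here [a sqrt X = pi], so that [cosh_poly] tends to [cos pi = -1]. *)
pose X := (pi / a) ^+ 2.
have X0 : 0 <= X by exact: sqr_ge0.
pose Q := (K' * K' + K * K * 1) * expR (2 * (2 * (2 * B) * X)).
have upD n : `|(D n).[X]| <= Q / 2 ^+ n.
  apply: exp_dominated_horner_le (domD n) (@lowD n) => //.
    by rewrite addr_ge0 // !mulr_ge0.
  by rewrite !mulr_ge0.
have c : even_exp n (- a ^+ 2 * X) @[n --> \oo] --> (-1 : R).
  rewrite (_ : - a ^+ 2 * X = - pi ^+ 2); first by rewrite -cospi; exact: cvg_even_exp_cos.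
  by rewrite /X exprMn exprVn; field; rewrite gt_eqF.
have [N _ hN] : \forall n \near \oo, even_exp n (- a ^+ 2 * X) < - 2^-1.
  by apply: (cvgr_lt _ c); lra.
(* For [X >= 0] every term of [even_exp] is nonnegative and the first is 1; together with [f >= 0]
   this bounds the truncation below. *)
have mf n : (0 < n)%N -> int3 f <= (moment_poly f v n).[X].
  case: n => // n _; rewrite horner_moment_poly //.
  apply: le_int3; [exact: integrable3_Cc|exact/integrable3_Cc/Cc_even_exp|].
  move=> x; rewrite ler_peMl // /even_exp big_ord_recl /= expr0 divr1 lerDl.
  by apply: sumr_ge0 => j _; rewrite divr_ge0 // exprn_ge0 // mulr_ge0 // sqr_ge0.
(* Once [cosh_poly] is below [-1/2], the subtracted product in [D n] contributes at least half the
   square of [int3 f]. *)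
pose m := int3 f ^+ 2 / 2.
have m0 : 0 < m by rewrite divr_gt0 // exprn_gt0.
(* Beyond [N] the lower bound applies, and [2^n > n > Q / m] makes the upper bound smaller than
   [m]. *)
pose n := maxn N (Num.truncn (Q / m)).+1.
have nN : (N <= n)%N by exact: leq_maxl.
have n0 : (0 < n)%N by rewrite (leq_trans _ (leq_maxr _ _)).
have low : m <= (D n).[X].
  rewrite /D hornerD hornerN !hornerM horner_cosh_poly -!expr2.
  have h1 := hN n nN; rewrite /= in h1.
  have h2 : int3 f ^+ 2 <= (moment_poly f v n).[X] ^+ 2.
    by rewrite lerXn2r ?nnegrE ?(ltW If) ?(le_trans (ltW If)) // mf.
  have h3 := sqr_ge0 ((moment_poly f' v' n).[X]).
  rewrite /m; nra.
have : (D n).[X] < m.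
  apply: le_lt_trans (ler_norm _) _; apply: le_lt_trans (upD n) _.
  rewrite ltr_pdivrMr ?exprn_gt0 // mulrC -ltr_pdivrMr //.
  apply: (@lt_trans _ _ n%:R); last by rewrite -natrX ltr_nat ltn_expl.
  apply: (@lt_le_trans _ _ (Num.truncn (Q / m)).+1%:R); first exact: truncnS_gt.
  by rewrite ler_nat leq_maxr.
by rewrite ltNge low.
Qed.

End Wick.

(** * Rotations of the axis and the preserved subgroup *)

Section AxisRotations.
Context {R : realType}.
Local Notation V := 'cV[R]_3.
Local Notation motion := ('M[R]_3 * V)%type.
Local Notation e1 := (delta_mx 0 0 : V).

Lemma mulmx_e1 (A : 'M[R]_3) i : (A *m e1) i 0 = A i 0.
Proof.
rewrite mxE (bigD1 0) //= mxE eqxx mulr1 big1 ?addr0 // => j /negPf j0.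
by rewrite mxE j0 mulr0.
Qed.

Lemma SO_sqr_col (A : 'M[R]_3) : SO R 3 A -> A 0 0 ^+ 2 + A 1 0 ^+ 2 + A 2 0 ^+ 2 = 1.
Proof.
move=> /SO_trmxK /matrixP /(_ 0 0); rewrite !mxE big_ord3 !mxE /= => e.
by rewrite !expr2 e.
Qed.

(** The factor [s] is the only nonzero entry of the first column, whose length is 1. *)
Lemma axis_rotationP (A : 'M[R]_3) : x1_axis_rotations R A <->
  SO R 3 A /\ exists2 s : R, s ^+ 2 = 1 & A *m e1 = s *: e1.
Proof.
split=> [[hA ax]|[hA [s s1 As]]]; split => //.
  have : x1_axis (A *m e1) by rewrite -ax; exists e1 => //; exists 1; rewrite scale1r.
  move=> [s As]; exists s => //.
  have Ai i : A i 0 = s * (i == 0)%:R by rewrite -mulmx_e1 As !mxE andbT.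
  by have := SO_sqr_col hA; rewrite !Ai /= !mulr0 !mulr1 expr0n /= !addr0.
apply/seteqP; split => [_ [_ [r ->] <-]|_ [r ->]].
  by exists (r * s); rewrite -scalemxAr As scalerA.
exists ((r * s) *: e1); first by exists (r * s).
by rewrite -scalemxAr As scalerA -mulrA -expr2 s1 mulr1.
Qed.

Lemma axis_rotation_tr (A : 'M[R]_3) s : SO R 3 A -> s ^+ 2 = 1 -> A *m e1 = s *: e1 ->
  A^T *m e1 = s *: e1.
Proof.
move=> hA s1 As; have : A^T *m (A *m e1) = e1 by rewrite mulmxA SO_trmxK // mul1mx.
rewrite As -scalemxAr => /(congr1 (fun x => s *: x)).
by rewrite scalerA -expr2 s1 scale1r.
Qed.

Lemma axis_rotation_preserves_axis (A : 'M[R]_3) : x1_axis_rotations R A -> preserves_axis A.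
Proof.
move=> /axis_rotationP[hA [s s1 As]]; exists s => // k.
have := axis_rotation_tr hA s1 As => At.
rewrite -(dot_delta (A *m k)) -(dot_delta k) [LHS]dotC dot_mulmx At [LHS]dotC.
by rewrite dotZr.
Qed.

Lemma axis_rotations_subgroup :
  is_subgroup (semidirect (x1_axis_rotations R)) (semidirect (SO R 3)).
Proof.
split.
- by move=> g [].
- by apply/axis_rotationP; split; [exact: SO1|exists 1; rewrite ?expr1n // mul1mx scale1r].
- move=> g h /axis_rotationP[hg [s s1 gs]] /axis_rotationP[hh [r r1 hr]].
  apply/axis_rotationP; split; first exact: SO_mulmx.
  exists (r * s); first by rewrite exprMn r1 s1 mulr1.
  by rewrite /= -mulmxA hr -scalemxAr gs scalerA.
- move=> g /axis_rotationP[hg [s s1 gs]].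
  apply/axis_rotationP; rewrite /= SO_invmx //; split; first exact: SO_trmx.
  by exists s => //; exact: axis_rotation_tr.
Qed.

Lemma int3_bump_gt0 : 0 < int3 (sl (@bump R) 2).
Proof.
have Cb := Cc_slice 2 (@C0oo_bump R).
pose c := bump (2, 0) / 2 : R; have c0 : 0 < c by rewrite divr_gt0 // bump_gt0.
have : \forall x \near (0 : V), c < sl (@bump R) 2 x.
  have cb := Cb.1 0.
  apply: (@cvgr_gt _ _ (nbhs (0 : V)) (nbhs_filter (0 : V)) _ _ cb).
  by rewrite /c; have := @bump_gt0 R; lra.
move=> /nbhs_ballP[r /= r0 Hr].
apply: (@lt_le_trans _ _ (c * (r *+ 2) ^+ 3)).
  by rewrite mulr_gt0 // exprn_gt0 // pmulrn_lgt0.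
apply: (@le_int3_ball _ _ 0) => //; [exact: ltW|exact: integrable3_Cc| |].
- by move=> x; exact: bump_ge0.
- by move=> x /Hr /ltW.
Qed.

Lemma preserves_fixes_axis (lambda : R) (A : 'M[R]_3) (u : V) : 0 < lambda -> SO R 3 A ->
  preserves (Cimg lambda) (A, 0) -> u 0 0 = 1 -> (A^T *m u) 0 0 <> 0.
Proof.
move=> l0 hA pA u1 Au.
have [psi Cp tr] := transform_of_preserves hA pA (@C0oo_bump R).
have Cf := Cc_slice 2 (@C0oo_bump R); have Cf' := Cc_slice 2 Cp.
have a0 : 0 < 3 * lambda by rewrite mulr_gt0.
apply: (@cosh_transform_absurd _ (sl (@bump R) 2) (sl psi 2) (A^T *m u) u _ a0 Cf Cf').
- by move=> x; exact: bump_ge0.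
- exact: int3_bump_gt0.
- move=> s; have := tr 2 (s *: u).
  (* The whole line through [A^T u] has first coordinate zero, where the multiplier is trivial;
     along [u] it is the full [cosh (3 lambda s)^(-1/2)]. *)
  have m1 : mult lambda (A^T *m (s *: u)) = 1.
    rewrite /mult -scalemxAr mxE Au !mulr0 /cosh oppr0 expR0.
    by rewrite (_ : (1 + 1) / 2 = 1) ?powR1 //; field.
  rewrite m1 mul1r => e.
  have e1' : int3 (fun x => cos (s * dot (A^T *m u) x) * sl bump 2 x) =
      cosT (sl bump 2) (A^T *m (s *: u)).
    by congr int3; apply/funext => x; rewrite -scalemxAr [dot _ x in RHS]dotC dotZr dotC.
  have e2' : int3 (fun x => cos (s * dot u x) * sl psi 2 x) = cosT (sl psi 2) (s *: u).
    by congr int3; apply/funext => x; rewrite [dot _ x in RHS]dotC dotZr dotC.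
  rewrite e1' e2' e exprMn mulrAC.
  have := mult_sqr lambda (s *: u); rewrite mxE u1 mulr1 => ->.
  by rewrite mul1r.
Qed.

Lemma preserved_subgroupE (lambda : R) : 0 < lambda ->
  preserved_subgroup (Cimg lambda) = semidirect (x1_axis_rotations R).
Proof.
move=> l0; apply/seteqP; split => -[A a] /=; last first.
  move=> hA; split; first by case: hA.
  by apply: preserves_axis_rotation; [case: hA|exact: axis_rotation_preserves_axis].
move=> [hA pA]; rewrite /semidirect /= in hA.
(* Translations preserve the image, so composing with this one reduces the motion to its rotation
   part. *)
have pT : preserves (Cimg lambda) (1%:M, - a).
  apply: preserves_axis_rotation; first exact: SO1.
  by exists 1; rewrite ?expr1n // => k; rewrite mul1mx mul1r.
have := @preserves_mul _ _ (1%:M, - a) (A, a) (SO1 3) hA pT pA.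
rewrite /motion_mul /= !mul1mx subrr => pA0.
have off j : j != 0 -> A j 0 = 0.
  move=> j0; apply: contrapT => /eqP Aj.
  (* The coefficient is chosen so that the first coordinate of [A^T u], namely [A 0 0] plus the
     coefficient times [A j 0], cancels. *)
  pose u : V := e1 + (- A 0 0 / A j 0) *: delta_mx j 0.
  have u1 : u 0 0 = 1 by rewrite !mxE eqxx [0 == j]eq_sym (negPf j0) /= mulr0 addr0.
  apply: (preserves_fixes_axis l0 hA pA0 u1).
  rewrite /u mulmxDr -scalemxAr mxE [X in _ + X]mxE.
  have col i : (A^T *m delta_mx i 0 : V) 0 0 = A i 0.
    rewrite mxE (bigD1 i) //= !mxE !eqxx mulr1 big1 ?addr0 // => k /negPf ki.
    by rewrite !mxE ki mulr0.
  by rewrite !col -mulrA mulVf // mulr1 subrr.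
apply/axis_rotationP; split => //; exists (A 0 0).
  by have := SO_sqr_col hA; rewrite (off 1) // (off 2) // expr0n /= !addr0.
apply/matrixP => i j; rewrite (ord1 j) mulmx_e1 !mxE andbT.
by have [->|/off ->] := eqVneq i 0; rewrite ?mulr1 ?mulr0.
Qed.

(** The rotation permuting the three coordinate axes cyclically, with [j + 1] taken modulo 3; it
    carries the first axis to the second. *)
Definition cyclic_mx : 'M[R]_3 := \matrix_(i, j) (i == j + 1)%:R.

Lemma SO_cyclic_mx : SO R 3 cyclic_mx.
Proof.
split; last by rewrite det_mx33 !mxE /=; ring.
apply/matrixP => i j; rewrite !mxE big_ord3 !mxE.
by elim/ord3_cases: i; elim/ord3_cases: j; rewrite /=; ring.
Qed.

Lemma not_invariant (lambda : R) : 0 < lambda ->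
  ~ invariant_under (semidirect (SO R 3)) (Cimg lambda).
Proof.
move=> l0 inv.
have : preserved_subgroup (Cimg lambda) (cyclic_mx, 0).
  by split; [exact: SO_cyclic_mx|apply: inv; exact: SO_cyclic_mx].
rewrite preserved_subgroupE // => /axis_rotationP[_ [s _ /matrixP /(_ 1 0)]].
by rewrite mulmx_e1 !mxE /= mulr0 => /eqP; rewrite oner_eq0.
Qed.

(** The sign [A 0 0] excludes the reversals of the axis. Then [e_1] is fixed by [A] and by its
    transpose, so the first column and row are trivial and the lower block inherits orthogonality
    and determinant. *)
Lemma SO2_x1P (A : 'M[R]_3) : SO2_x1 R A <-> x1_axis_rotations R A /\ A 0 0 = 1.
Proof.
split=> [[Q [Q1 Q2] <-]|[/axis_rotationP[hA [s s1 As]] A1]].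
  have i0 : (0 : 'I_3) = lshift 2 (0 : 'I_1) by apply/val_inj.
  have B1 : (block_mx (1%:M : 'M[R]_1) 0 0 Q : 'M[R]_3) 0 0 = 1.
    by rewrite i0 (block_mxEul (1%:M : 'M[R]_1)) mxE.
  split => //; apply/axis_rotationP; split; last first.
    exists 1; first by rewrite expr1n.
    apply/matrixP => i j; rewrite (ord1 j) mulmx_e1 scale1r [RHS]mxE andbT.
    have [->//|/negPf iN] := eqVneq i 0.
    have [k ->] : exists k : 'I_2, i = rshift 1 k.
      case: i iN => -[|i] hi // _; exists (Ordinal (hi : (i < 2)%N)); exact/val_inj.
    by rewrite i0 (block_mxEdl (1%:M : 'M[R]_1)) mxE.
  split.
    pose B : 'M[R]_(1 + 2) := block_mx 1%:M 0 0 Q.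
    have : B *m B^T = 1%:M; last by [].
    rewrite /B tr_block_mx mulmx_block.
    by rewrite !trmx0 !mul0mx !mulmx0 trmx1 mul1mx !addr0 add0r Q1 -scalar_mx_block.
  by rewrite (det_ublock (1%:M : 'M[R]_1)) det1 mul1r.
have s1' : s = 1 by have := congr1 (fun M : V => M 0 0) As; rewrite mulmx_e1 A1 !mxE mulr1.
rewrite s1' scale1r in As; have At := axis_rotation_tr hA (expr1n _ 2).
rewrite scale1r in At; have {}At := At As.
pose A' : 'M[R]_(1 + 2) := A.
have ul : ulsubmx A' = 1%:M.
  apply/matrixP => i j; rewrite (ord1 i) (ord1 j) !mxE -A1; congr (A _ _); exact/val_inj.
have dl : dlsubmx A' = 0.
  apply/matrixP => i j; rewrite (ord1 j) !mxE.
  have -> : lshift 2 (0 : 'I_1) = (0 : 'I_3) by apply/val_inj.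
  by rewrite /A' -mulmx_e1 As mxE.
have ur : ursubmx A' = 0.
  apply/matrixP => i j; rewrite (ord1 i) !mxE.
  have -> : lshift 2 (0 : 'I_1) = (0 : 'I_3) by apply/val_inj.
  by have := mulmx_e1 A^T (rshift 1 j); rewrite At !mxE.
have AE : A' = block_mx 1%:M 0 0 (drsubmx A') by rewrite -[LHS]submxK ul dl ur.
exists (drsubmx A') => //; case: hA => h1 h2; split.
  have : A' *m A'^T = 1%:M by exact: h1.
  rewrite AE tr_block_mx mulmx_block scalar_mx_block => /eq_block_mx[_ _ _].
  by rewrite trmx0 mul0mx add0r block_mxKdr.
by have := h2; rewrite -/A' AE (det_ublock (1%:M : 'M[R]_1)) det1 mul1r block_mxKdr.
Qed.

End AxisRotations.

(** * The connected component of the identity *)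

Section IdentityComponent.
Context {R : realType}.
Local Notation V := 'cV[R]_3.
Local Notation motion := ('M[R]_3 * V)%type.

Lemma cos_sin_ex (x y : R) : x ^+ 2 + y ^+ 2 = 1 -> exists t, cos t = x /\ sin t = y.
Proof.
move=> e; have x1 : x ^+ 2 <= 1 by rewrite -e lerDl sqr_ge0.
have xi : -1 <= x <= 1 by rewrite -ler_norml -(@expr_le1 _ 2) // real_normK ?num_real.
have sE : sin (acos x) = `|y|.
  by rewrite sin_acos // -e addrC addKr sqrtr_sqr.
have cE : cos (acos x) = x by rewrite acosK // in_itv.
have [y0|y0] := leP 0 y; [exists (acos x)|exists (- acos x)].
  by rewrite cE sE ger0_norm.
by rewrite cosN sinN cE sE ltr0_norm ?opprK.
Qed.

Definition rotation2 (t : R) : 'M[R]_2 :=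
  \matrix_(i, j) (if i == j then cos t else if i == 0 then - sin t else sin t).

Lemma rotation20 : rotation2 0 = 1%:M.
Proof.
by apply/matrixP => i j; rewrite !mxE cos0 sin0 oppr0 if_same; case: (i == j).
Qed.

Lemma ord2_cases (P : 'I_2 -> Prop) : P 0 -> P 1 -> forall i, P i.
Proof.
move=> P0 P1 [[|[|i]] hi] //.
  by have -> : Ordinal hi = 0 by apply/val_inj.
by have -> : Ordinal hi = 1 by apply/val_inj.
Qed.

(** The angle is what later gives a path to the identity. Orthonormal rows and determinant 1
    determine the second column from the first, which is a point of the unit circle. *)
Lemma SO2E : SO R 2 = range rotation2.
Proof.
apply/seteqP; split => [Q [Q1 Q2]|_ [t _ <-]]; last first.
  have c2 := @cos2Dsin2 R t.
  split; last by rewrite det_mx22 !mxE /= -c2; ring.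
  apply/matrixP => i j; rewrite !mxE big_ord_recl big_ord1 !mxE.
  have -> : lift ord0 (0 : 'I_1) = 1 :> 'I_2 by apply/val_inj.
  by elim/ord2_cases: i; elim/ord2_cases: j; rewrite /= ?mulr1n ?mulr0n -?c2; ring.
have E i j := congr1 (fun M : 'M[R]_2 => M i j) Q1.
have /= {}E i j : Q i 0 * Q j 0 + Q i 1 * Q j 1 = (i == j)%:R.
  have := E i j; rewrite !mxE big_ord_recl big_ord1 !mxE.
  by have -> : lift ord0 (0 : 'I_1) = 1 :> 'I_2 by apply/val_inj.
have E00 : Q 0 0 * Q 0 0 + Q 0 1 * Q 0 1 = 1 := E 0 0.
have E01 : Q 0 0 * Q 1 0 + Q 0 1 * Q 1 1 = 0 := E 0 1.
move: Q2; rewrite det_mx22 => D.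
have s1 : Q 1 1 = Q 0 0.
  have : Q 1 1 * (Q 0 0 * Q 0 0 + Q 0 1 * Q 0 1) = Q 0 0 * (Q 0 0 * Q 1 1 - Q 0 1 * Q 1 0)
    + Q 0 1 * (Q 0 0 * Q 1 0 + Q 0 1 * Q 1 1) by ring.
  by rewrite E00 E01 D mulr0 addr0 !mulr1.
have s2 : Q 0 1 = - Q 1 0.
  have : Q 1 0 * (Q 0 0 * Q 0 0 + Q 0 1 * Q 0 1) = Q 0 0 * (Q 0 0 * Q 1 0 + Q 0 1 * Q 1 1)
    - Q 0 1 * (Q 0 0 * Q 1 1 - Q 0 1 * Q 1 0) by ring.
  by rewrite E00 E01 D mulr0 add0r !mulr1 => ->; rewrite opprK.
have [|t [ct st]] := @cos_sin_ex (Q 0 0) (Q 1 0).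
  by rewrite -E00 s2; ring.
exists t => //; apply/matrixP => i j; rewrite mxE ct st.
by elim/ord2_cases: i; elim/ord2_cases: j; rewrite //= ?s1 ?s2.
Qed.

Definition rotation3 (t : R) : 'M[R]_3 := block_mx (1%:M : 'M[R]_1) 0 0 (rotation2 t).

Lemma SO2_x1E : SO2_x1 R = range rotation3.
Proof.
rewrite /SO2_x1 SO2E; apply/seteqP; split => [_ [_ [t _ <-] <-]|_ [t _ <-]].
  by exists t.
by exists (rotation2 t) => //; exists t.
Qed.

Lemma rotation30 : rotation3 0 = 1%:M.
Proof. by rewrite /rotation3 rotation20 -scalar_mx_block. Qed.

Lemma continuous_rotation3 : continuous rotation3.
Proof.
apply: continuous_mx => i j.
case: (@split_ordP 1 2 i) => k ->; case: (@split_ordP 1 2 j) => l ->.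
- under eq_fun do rewrite (block_mxEul (1%:M : 'M[R]_1)); exact: cst_continuous.
- under eq_fun do rewrite (block_mxEur (1%:M : 'M[R]_1)); exact: cst_continuous.
- under eq_fun do rewrite (block_mxEdl (1%:M : 'M[R]_1)); exact: cst_continuous.
under eq_fun do rewrite (block_mxEdr (1%:M : 'M[R]_1)) mxE.
case: eqP => _; first exact: continuous_cos.
case: eqP => _; last exact: continuous_sin.
by move=> t; apply: cvgN; exact: continuous_sin.
Qed.

Lemma SO2_x1_path (A : 'M[R]_3) (a : V) : SO2_x1 R A ->
  exists2 B : set motion, connected B /\ B `<=` semidirect (SO2_x1 R) &
    B motion1 /\ B (A, a).
Proof.
rewrite SO2_x1E => -[t _ <-].
(* Angle and translation are scaled together, from the identity at [r = 0] to the given motion at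
   [r = 1]. *)
pose g (r : R) : motion := (rotation3 (r * t), r *: a).
have cg : continuous g.
  move=> r.
  have ct : continuous (fun r : R => r * t).
    by move=> x; apply: cvgMl; exact: cvg_id.
  have c1 : (fun r : R => rotation3 (r * t)) @ r --> rotation3 (r * t).
    exact: (@continuous_comp R R 'M[R]_3 (fun r : R => r * t) rotation3 r (ct r)
      (@continuous_rotation3 _)).
  have c2 : (fun r : R => r *: a) @ r --> r *: a.
    exact: (@cvgZr_tmp R V R (nbhs r) (nbhs_filter r) id r a (@cvg_id _ (nbhs r))).
  exact: (@cvg_pair _ _ _ (nbhs r) (nbhs (rotation3 (r * t))) (nbhs (r *: a))
    (nbhs_filter _) (nbhs_filter _) (nbhs_filter _) _ _ c1 c2).
exists (range g); first split.
- apply: connected_continuous_connected.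
    by apply/connected_intervalP.
  exact: continuous_subspaceT.
- by move=> _ [r _ <-]; exists (r * t).
- split; last by exists 1; rewrite // /g mul1r scale1r.
  by exists 0; rewrite // /g mul0r scale0r rotation30.
Qed.

Lemma identity_component :
  connected_component (semidirect (x1_axis_rotations R)) motion1 = semidirect (SO2_x1 R).
Proof.
have SK : semidirect (SO2_x1 R) `<=` semidirect (x1_axis_rotations R).
  by move=> g /SO2_x1P[].
apply/seteqP; split => [g Cg|[A a] hA]; last first.
  have [B [cB BS] [B1 Bg]] := SO2_x1_path a hA.
  exact: (@connected_component_max _ _ B _ B1 (subset_trans BS SK) cB _ Bg).
have gK := connected_component_sub Cg.
apply/SO2_x1P; split => //.
have sq (h : motion) : semidirect (x1_axis_rotations R) h -> h.1 0 0 ^+ 2 = 1.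
  move=> /axis_rotationP[_ [s s1 hs]].
  by have := congr1 (fun M : V => M 0 0) hs; rewrite mulmx_e1 !mxE mulr1 => ->.
pose f (h : motion) : R := h.1 0 0.
have cf : continuous f.
  move=> h; have := @coord_continuous R 3 3 0 0 h.1.
  exact: (@continuous_comp _ _ _ fst (fun M : 'M[R]_3 => M 0 0) h cvg_fst).
have /connected_intervalP I : connected
    (f @` connected_component (semidirect (x1_axis_rotations R)) motion1).
  apply: connected_continuous_connected; first exact: component_connected.
  exact: continuous_subspaceT.
(* The image of the component under [f] is an interval containing 1; if it contained -1 it would
   also contain 0, whose square is not 1. *)
have := sq g gK; move/eqP; rewrite sqrf_eq1 => /orP[/eqP//|/eqP gN].
have [|||h Ch fh] := I (-1) 1 _ _ 0.
- by exists g.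
- exists motion1; last by rewrite /f mxE.
  by apply: connected_component_refl; case: (@axis_rotations_subgroup R).
- by rewrite lerN10 ler01.
have := sq h (connected_component_sub Ch).
by rewrite [h.1 0 0]fh expr0n /= => /eqP; rewrite eq_sym oner_eq0.
Qed.

End IdentityComponent.

Theorem mainTheorem9 (R : realType) (lambda : R) (hlambda : 0 < lambda) :
  [/\ ~ invariant_under (semidirect (SO R 3)) (Cimg lambda),
      is_subgroup (preserved_subgroup (Cimg lambda)) (semidirect (SO R 3)),
      preserved_subgroup (Cimg lambda) = semidirect (x1_axis_rotations R)
    & connected_component (preserved_subgroup (Cimg lambda)) motion1 =
        semidirect (SO2_x1 R)].
Proof.
rewrite preserved_subgroupE //; split => //.
- exact: not_invariant.
- exact: axis_rotations_subgroup.
- exact: identity_component.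
Qed.
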